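(* Let $\eta$ be a nonzero complex number and let $a$ be a nonzero finite complex number. Then there is no non-constant entire function $f(z)$ of finite order such that $f(z)$ and $\Delta_{\eta}f(z)=f(z+\eta)-f(z)$ share the pairs $(0,0)$ and $(a,-a)$ IM.
   Context: For complex numbers $c,d$, two non-constant meromorphic functions $f$ and $g$ are said to share the pair $(c,d)$ IM if $f-c$ and $g-d$ have the same zeros, ignoring multiplicities. The order of a meromorphic function $f$ is $\rho(f)=\limsup_{r\to\infty}\frac{\log^{+}T(r,f)}{\log r}$, where $T(r,f)$ is the Nevanlinna characteristic function. *)

(* Defs.v *)
From Stdlib Require Import Reals.
From Coquelicot Require Import Coquelicot.
Open Scope R_scope.

Definition entire (f : C -> C) : Prop :=
  forall z : C, @ex_derive C_AbsRing C_NormedModule f z.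

Definition nonconstant (f : C -> C) : Prop :=
  exists z1 z2 : C, f z1 <> f z2.

Definition logplus (x : R) : R := Rmax 0 (ln x).

(* Nevanlinna characteristic of an entire function: T(r,f) = m(r,f) + N(r,f)
   with N(r,f) = 0 since f has no poles, and
   m(r,f) = (1/2pi) \int_0^{2pi} log^+ |f(r e^{i theta})| d theta. *)
Definition nev_T (f : C -> C) (r : R) : R :=
  / (2 * PI) * RInt (fun t => logplus (Cmod (f (r * cos t, r * sin t)%R))) 0 (2 * PI).

(* Finite order: rho(f) = limsup_{r->oo} log^+ T(r,f) / log r < +oo,
   i.e. the quotient is eventually bounded above by some real constant. *)
Definition finite_order (f : C -> C) : Prop :=
  exists (s R0 : R), forall r : R, R0 < r -> 1 < r ->
    logplus (nev_T f r) / ln r <= s.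

Definition share_pair_IM (f g : C -> C) (c d : C) : Prop :=
  forall z : C, f z = c <-> g z = d.

Definition cdiff (eta : C) (f : C -> C) : C -> C :=
  fun z => (f (z + eta) - f z)%C.

(* Main.v *)
Require Import Defs.
From Stdlib Require Import Reals.
From Coquelicot Require Import Coquelicot.
From Stdlib Require Import Lra Lia Psatz List Classical ClassicalEpsilon.

(** Write f_n(z) = f(z + n eta).  Sharing makes f_1, and hence f_2, vanish wherever f is 0 or a,
    so phi_n = f_n f' / (f (f - a)) is entire for n = 1, 2.  On suitable circles phi_n is the shift
    quotient f_n / f times the logarithmic derivative of f - a, so if log M(r, f) = O(r^s log r) then
    log M(r, phi_n) = O(r^(s - 1/2) log r); call such functions small.  From phi_1 f_2 = phi_2 f_1 one
    gets f_1 / f = p / q with p, q small, and then p f' = phi_1 q (f - a).  By the converse half of the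
    sharing hypothesis, Y = q (f - f_1 - a) vanishes only where p q does, so p q Y' / Y is also entire
    and small.  Eliminating f' writes f as a quotient of small functions, unless the coefficients
    cancel; in that case w = p / q satisfies w' = phi_1 (1 - w), the quantity (f - a) (1 - w) / w is
    constant, and f is again such a quotient.  Thus f is small itself, and after finitely many steps
    log M(r, f) = O(log r).  Then f has O(sqrt r) zeros in |z| < r, too
    few for a chain z + n eta, so it has none; and then f' / f = O(r^(-1/2)) on |z| < r / 2, so f' = 0. *)

(** The gain of one half in the order comes from counting zeros. A function of size [gauge k] has
    O(gauge k a) zeros up to a fixed multiple of a, and some r in [a, 2 a] makes the sum of |r -
    |b||^(-1/2) over these zeros b at most O(gauge k a / sqrt a). The exponent 1/2 balances two
    needs: 1 / |r - x| is not integrable in r, so averaging over radii would fail for it, while ln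
    (1 + x) <= 2 sqrt x lets the factor 1 + |eta| / d, by which a shift changes a linear factor at
    distance d from its zero, be paid with d^(-1/2). Logarithmic derivatives cost only O(log a);
    hence the factor 1 + ln x in [gauge], and hence the descent stops at k = 0. Orders are counted
    in half steps by a natural number, so the descent is a plain induction. Sharing without
    multiplicities is enough because the functions made entire come from logarithmic derivatives,
    whose poles are simple. The hypothesis [eta <> 0] enters at the very end, where the zeros z + n
    eta must be distinct. *)

(** * Differentiability *)

(* One notion for both complex derivatives ([D] everything) and derivatives along curves ([D] the real axis). *)
Definition derivD (D : C -> Prop) (f : C -> C) (z l : C) : Prop :=
  forall eps, 0 < eps -> exists d, 0 < d /\ forall w, D w -> Cmod (w - z) < d ->
    Cmod (f w - f z - l * (w - z)) <= eps * Cmod (w - z).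

Definition contD (D : C -> Prop) (f : C -> C) (z : C) : Prop :=
  forall eps, 0 < eps -> exists d, 0 < d /\ forall w, D w -> Cmod (w - z) < d ->
    Cmod (f w - f z) < eps.

Lemma Cmod_minus_sym (z w : C) : Cmod (z - w) = Cmod (w - z).
Proof. rewrite <- Cmod_opp. f_equal. ring. Qed.

Lemma Cmod_triangle_sub (z w : C) : Cmod z <= Cmod w + Cmod (z - w).
Proof.
  replace z with (w + (z - w))%C at 1 by ring. apply Cmod_triangle.
Qed.

Lemma Cmod_triangle_minus (z w : C) : Cmod (z - w) <= Cmod z + Cmod w.
Proof.
  unfold Cminus. rewrite <- (Cmod_opp w). apply Cmod_triangle.
Qed.

Lemma Cmod_RtoC_nonneg (x : R) : 0 <= x -> Cmod (RtoC x) = x.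
Proof. intros H. rewrite Cmod_R. apply Rabs_pos_eq, H. Qed.

Lemma derivD_const (D : C -> Prop) (c z : C) : derivD D (fun _ => c) z 0.
Proof.
  intros e He. exists 1. split; [lra|]. intros w _ _.
  replace (c - c - 0 * (w - z))%C with (RtoC 0) by ring.
  rewrite Cmod_0. apply Rmult_le_pos; [lra | apply Cmod_ge_0].
Qed.

Lemma derivD_id (D : C -> Prop) (z : C) : derivD D (fun w => w) z 1.
Proof.
  intros e He. exists 1. split; [lra|]. intros w _ _.
  replace (w - z - 1 * (w - z))%C with (RtoC 0) by ring.
  rewrite Cmod_0. apply Rmult_le_pos; [lra | apply Cmod_ge_0].
Qed.

Lemma derivD_plus (D : C -> Prop) (f g : C -> C) (z l m : C) :
  derivD D f z l -> derivD D g z m -> derivD D (fun w => f w + g w)%C z (l + m).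
Proof.
  intros Hf Hg e He.
  destruct (Hf (e / 2) ltac:(lra)) as [d1 [Hd1 H1]].
  destruct (Hg (e / 2) ltac:(lra)) as [d2 [Hd2 H2]].
  exists (Rmin d1 d2). split; [apply Rmin_pos; assumption|].
  intros w HD Hw.
  specialize (H1 w HD (Rlt_le_trans _ _ _ Hw (Rmin_l _ _))).
  specialize (H2 w HD (Rlt_le_trans _ _ _ Hw (Rmin_r _ _))).
  replace (f w + g w - (f z + g z) - (l + m) * (w - z))%C
    with ((f w - f z - l * (w - z)) + (g w - g z - m * (w - z)))%C by ring.
  eapply Rle_trans; [apply Cmod_triangle|]. lra.
Qed.

Lemma derivD_contD (D : C -> Prop) (f : C -> C) (z l : C) :
  derivD D f z l -> contD D f z.
Proof.
  intros Hf e He.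
  destruct (Hf 1 ltac:(lra)) as [d [Hd H]].
  assert (Hl := Cmod_ge_0 l).
  exists (Rmin d (e / (2 + Cmod l))). split.
  { apply Rmin_pos; [assumption|]. apply Rdiv_lt_0_compat; lra. }
  intros w HD Hw.
  specialize (H w HD (Rlt_le_trans _ _ _ Hw (Rmin_l _ _))).
  assert (Hw2 := Rlt_le_trans _ _ _ Hw (Rmin_r _ _)).
  replace (f w - f z)%C with ((f w - f z - l * (w - z)) + l * (w - z))%C by ring.
  eapply Rle_lt_trans; [apply Cmod_triangle|]. rewrite Cmod_mult.
  apply Rlt_div_r in Hw2; [|lra].
  assert (Hz := Cmod_ge_0 (w - z)). nra.
Qed.

Lemma derivD_mult (D : C -> Prop) (f g : C -> C) (z l m : C) :
  derivD D f z l -> derivD D g z m ->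
  derivD D (fun w => f w * g w)%C z (l * g z + f z * m).
Proof.
  intros Hf Hg e He.
  set (K := 1 + Cmod (g z) + Cmod (f z) + Cmod l).
  assert (HK : 0 < K).
  { unfold K. assert (H1 := Cmod_ge_0 (g z)). assert (H2 := Cmod_ge_0 (f z)).
    assert (H3 := Cmod_ge_0 l). lra. }
  set (e' := e / (3 * K)).
  assert (He' : 0 < e') by (apply Rdiv_lt_0_compat; lra).
  destruct (Hf e' He') as [d1 [Hd1 H1]].
  destruct (Hg e' He') as [d2 [Hd2 H2]].
  (* Two bounds on the increment of g: at most 1 for its product with the remainder of f, at most e'
     for its product with l (w - z). *)
  destruct (derivD_contD _ _ _ _ Hg (Rmin 1 e') ltac:(apply Rmin_pos; lra)) as [d3 [Hd3 H3]].
  exists (Rmin d1 (Rmin d2 d3)). split; [repeat apply Rmin_pos; assumption|].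
  intros w HD Hw.
  assert (Hw1 : Cmod (w - z) < d1) by (eapply Rlt_le_trans; [apply Hw | apply Rmin_l]).
  assert (Hw2 : Cmod (w - z) < d2).
  { eapply Rlt_le_trans; [apply Hw |]. eapply Rle_trans; [apply Rmin_r | apply Rmin_l]. }
  assert (Hw3 : Cmod (w - z) < d3).
  { eapply Rlt_le_trans; [apply Hw |]. eapply Rle_trans; [apply Rmin_r | apply Rmin_r]. }
  specialize (H1 w HD Hw1). specialize (H2 w HD Hw2). specialize (H3 w HD Hw3).
  assert (H3' : Cmod (g w - g z) <= 1).
  { left. eapply Rlt_le_trans; [apply H3 | apply Rmin_l]. }
  assert (H3'' : Cmod (g w - g z) <= e').
  { left. eapply Rlt_le_trans; [apply H3 | apply Rmin_r]. }
  replace (f w * g w - f z * g z - (l * g z + f z * m) * (w - z))%C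
    with ((f w - f z - l * (w - z)) * g z + (f w - f z - l * (w - z)) * (g w - g z)
          + (f z * (g w - g z - m * (w - z)) + l * (w - z) * (g w - g z)))%C by ring.
  set (x := Cmod (w - z)) in *.
  assert (Hx : 0 <= x) by apply Cmod_ge_0.
  assert (Gz := Cmod_ge_0 (g z)). assert (Fz := Cmod_ge_0 (f z)). assert (Hl := Cmod_ge_0 l).
  assert (Gw := Cmod_ge_0 (g w - g z)).
  eapply Rle_trans; [apply Cmod_triangle|].
  eapply Rle_trans; [apply Rplus_le_compat; apply Cmod_triangle|].
  rewrite !Cmod_mult. fold x.
  assert (E : e * x = 3 * (K * (e' * x))) by (unfold e'; field; lra).
  rewrite E.
  assert (Hex : 0 <= e' * x) by nra.
  assert (A1 := Rmult_le_compat_r _ _ _ Gz H1).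
  assert (A2 : Cmod (f w - f z - l * (w - z)) * Cmod (g w - g z) <= e' * x * 1).
  { apply Rmult_le_compat; try assumption; apply Cmod_ge_0. }
  assert (A3 := Rmult_le_compat_l _ _ _ Fz H2).
  assert (A4 : Cmod l * x * Cmod (g w - g z) <= Cmod l * x * e').
  { apply Rmult_le_compat_l; [nra|assumption]. }
  unfold K. nra.
Qed.

Lemma derivD_comp (D D' : C -> Prop) (f g : C -> C) (z l m : C) :
  (forall w, D w -> D' (g w)) ->
  derivD D' f (g z) l -> derivD D g z m -> derivD D (fun w => f (g w)) z (l * m).
Proof.
  intros HDD Hf Hg e He.
  assert (Hl := Cmod_ge_0 l). assert (Hm := Cmod_ge_0 m).
  set (e1 := e / (2 * (Cmod m + 1))).
  set (e2 := Rmin 1 (e / (2 * (Cmod l + 1)))).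
  assert (He1 : 0 < e1) by (apply Rdiv_lt_0_compat; lra).
  assert (He2 : 0 < e2) by (apply Rmin_pos; [lra | apply Rdiv_lt_0_compat; lra]).
  destruct (Hf e1 He1) as [d1 [Hd1 H1]].
  destruct (Hg e2 He2) as [d2 [Hd2 H2]].
  destruct (derivD_contD _ _ _ _ Hg d1 Hd1) as [d3 [Hd3 H3]].
  exists (Rmin d2 d3). split; [apply Rmin_pos; assumption|].
  intros w HD Hw.
  assert (Hw2 := Rlt_le_trans _ _ _ Hw (Rmin_l _ _)).
  assert (Hw3 := Rlt_le_trans _ _ _ Hw (Rmin_r _ _)).
  specialize (H2 w HD Hw2). specialize (H1 (g w) (HDD _ HD) (H3 w HD Hw3)).
  set (x := Cmod (w - z)) in *. assert (Hx : 0 <= x) by apply Cmod_ge_0.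
  assert (Hgw : Cmod (g w - g z) <= (Cmod m + 1) * x).
  { replace (g w - g z)%C with ((g w - g z - m * (w - z)) + m * (w - z))%C by ring.
    eapply Rle_trans; [apply Cmod_triangle|]. rewrite Cmod_mult. fold x.
    assert (e2 <= 1) by apply Rmin_l. nra. }
  replace (f (g w) - f (g z) - l * m * (w - z))%C
    with ((f (g w) - f (g z) - l * (g w - g z)) + l * (g w - g z - m * (w - z)))%C by ring.
  eapply Rle_trans; [apply Cmod_triangle|]. rewrite Cmod_mult.
  assert (B1 : e1 * Cmod (g w - g z) <= e / 2 * x).
  { eapply Rle_trans; [apply Rmult_le_compat_l; [lra | apply Hgw]|].
    right. unfold e1. field. lra. }
  assert (B2 : Cmod l * (e2 * x) <= e / 2 * x).
  { assert (e2 <= e / (2 * (Cmod l + 1))) by apply Rmin_r.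
    assert (Cmod l * e2 <= e / 2).
    { eapply Rle_trans; [apply Rmult_le_compat_l; [assumption | apply H]|].
      apply Rmult_le_reg_r with (2 * (Cmod l + 1)); [lra|].
      replace (Cmod l * (e / (2 * (Cmod l + 1))) * (2 * (Cmod l + 1))) with (Cmod l * e)
        by (field; lra). nra. }
    nra. }
  assert (B3 : Cmod l * Cmod (g w - g z - m * (w - z)) <= Cmod l * (e2 * x))
    by (apply Rmult_le_compat_l; assumption).
  lra.
Qed.

Lemma derivD_eq (D : C -> Prop) (f : C -> C) (z l l' : C) :
  derivD D f z l -> l = l' -> derivD D f z l'.
Proof. intros H E. rewrite <- E. exact H. Qed.

Lemma derivD_loc (D : C -> Prop) (f g : C -> C) (z l : C) (r : R) :
  0 < r -> D z -> (forall w, D w -> Cmod (w - z) < r -> f w = g w) -> derivD D f z l -> derivD D g z l.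
Proof.
  intros Hr Dz Hfg Hf e He. destruct (Hf e He) as [d [Hd H]].
  exists (Rmin d r). split; [apply Rmin_pos; assumption|].
  intros w HD Hw. rewrite <- !Hfg; try assumption.
  - apply H; [assumption|]. eapply Rlt_le_trans; [apply Hw | apply Rmin_l].
  - replace (z - z)%C with (RtoC 0) by ring. rewrite Cmod_0. assumption.
  - eapply Rlt_le_trans; [apply Hw | apply Rmin_r].
Qed.

Lemma derivD_scal (D : C -> Prop) (f : C -> C) (c z l : C) :
  derivD D f z l -> derivD D (fun w => c * f w)%C z (c * l).
Proof.
  intros H. eapply derivD_eq; [apply (derivD_mult D (fun _ => c) f); [apply derivD_const | apply H]|]. cbv beta. ring.
Qed.

Lemma derivD_opp (D : C -> Prop) (f : C -> C) (z l : C) :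
  derivD D f z l -> derivD D (fun w => - f w)%C z (- l).
Proof.
  intros H e He. destruct (H e He) as [d [Hd H']]. exists d. split; [assumption|].
  intros w HD Hw. replace (- f w - - f z - - l * (w - z))%C
    with (- (f w - f z - l * (w - z)))%C by ring. rewrite Cmod_opp. apply H'; assumption.
Qed.

Lemma derivD_minus (D : C -> Prop) (f g : C -> C) (z l m : C) :
  derivD D f z l -> derivD D g z m -> derivD D (fun w => f w - g w)%C z (l - m).
Proof. intros Hf Hg. apply derivD_plus; [|apply derivD_opp]; assumption. Qed.

Lemma derivD_inv_id (z : C) : z <> 0 -> derivD (fun _ => True) Cinv z (- / (z * z)).
Proof.
  intros Hz e He. assert (Hm : 0 < Cmod z) by (apply Cmod_gt_0; assumption).
  set (m := Cmod z) in *.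
  (* The first bound keeps |w| >= m / 2; the second then controls the exact remainder (w - z)^2 / (w
     z^2). *)
  exists (Rmin (m / 2) (e * (m * m * m) / 2)). split.
  { apply Rmin_pos; [lra|]. assert (0 < m * m * m) by (repeat apply Rmult_lt_0_compat; lra). nra. }
  intros w _ Hw. set (x := Cmod (w - z)) in *.
  assert (Hw1 := Rlt_le_trans _ _ _ Hw (Rmin_l _ _)).
  assert (Hw2 := Rlt_le_trans _ _ _ Hw (Rmin_r _ _)).
  assert (Hx : 0 <= x) by apply Cmod_ge_0.
  assert (Hwm : m / 2 <= Cmod w).
  { assert (H := Cmod_triangle_sub z w). rewrite Cmod_minus_sym in H. fold x m in H. lra. }
  assert (Hw0 : w <> 0) by (apply Cmod_gt_0; lra).
  replace (/ w - / z - - / (z * z) * (w - z))%C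
    with ((w - z) * (w - z) * (/ w * / (z * z)))%C by (field; split; assumption).
  rewrite !Cmod_mult, !Cmod_inv, !Cmod_mult by (try apply Cmult_neq_0; assumption).
  fold x m.
  apply Rmult_le_reg_r with (Cmod w * (m * m)).
  { repeat apply Rmult_lt_0_compat; lra. }
  replace (x * x * (/ Cmod w * / (m * m)) * (Cmod w * (m * m))) with (x * x)
    by (field; lra).
  assert (e * (m * m * m) / 2 <= e * (Cmod w * (m * m))).
  { assert (0 <= m * m) by nra. assert (0 <= e * (m * m)) by nra. nra. }
  nra.
Qed.

Lemma derivD_inv (D : C -> Prop) (f : C -> C) (z l : C) :
  f z <> 0 -> derivD D f z l -> derivD D (fun w => / f w)%C z (- l / (f z * f z)).
Proof.
  intros Hz Hf. eapply derivD_eq.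
  - apply (derivD_comp D (fun _ => True) Cinv f); [auto | apply derivD_inv_id; assumption | apply Hf].
  - field. assumption.
Qed.

Lemma contD_const (D : C -> Prop) (c z : C) : contD D (fun _ => c) z.
Proof. eapply derivD_contD, derivD_const. Qed.

Lemma contD_id (D : C -> Prop) (z : C) : contD D (fun w => w) z.
Proof. eapply derivD_contD, derivD_id. Qed.

Lemma contD_comp (D D' : C -> Prop) (f g : C -> C) (z : C) :
  (forall w, D w -> D' (g w)) ->
  contD D' f (g z) -> contD D g z -> contD D (fun w => f (g w)) z.
Proof.
  intros HDD Hf Hg e He. destruct (Hf e He) as [d [Hd H]].
  destruct (Hg d Hd) as [d' [Hd' H']]. exists d'. split; [assumption|]. auto.
Qed.

Lemma contD_plus (D : C -> Prop) (f g : C -> C) (z : C) :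
  contD D f z -> contD D g z -> contD D (fun w => f w + g w)%C z.
Proof.
  intros Hf Hg e He.
  destruct (Hf (e / 2) ltac:(lra)) as [d1 [Hd1 H1]].
  destruct (Hg (e / 2) ltac:(lra)) as [d2 [Hd2 H2]].
  exists (Rmin d1 d2). split; [apply Rmin_pos; assumption|].
  intros w HD Hw.
  specialize (H1 w HD (Rlt_le_trans _ _ _ Hw (Rmin_l _ _))).
  specialize (H2 w HD (Rlt_le_trans _ _ _ Hw (Rmin_r _ _))).
  replace (f w + g w - (f z + g z))%C with ((f w - f z) + (g w - g z))%C by ring.
  eapply Rle_lt_trans; [apply Cmod_triangle|]. lra.
Qed.

Lemma contD_mult (D : C -> Prop) (f g : C -> C) (z : C) :
  contD D f z -> contD D g z -> contD D (fun w => f w * g w)%C z.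
Proof.
  intros Hf Hg e He.
  set (K := 1 + Cmod (g z) + Cmod (f z)).
  assert (Gz := Cmod_ge_0 (g z)). assert (Fz := Cmod_ge_0 (f z)).
  assert (HK : 0 < K) by (unfold K; lra).
  set (e' := e / (3 * K)).
  assert (He' : 0 < e') by (apply Rdiv_lt_0_compat; lra).
  destruct (Hf e' He') as [d1 [Hd1 H1]].
  destruct (Hg (Rmin 1 e') ltac:(apply Rmin_pos; lra)) as [d2 [Hd2 H2]].
  exists (Rmin d1 d2). split; [apply Rmin_pos; assumption|].
  intros w HD Hw.
  specialize (H1 w HD (Rlt_le_trans _ _ _ Hw (Rmin_l _ _))).
  specialize (H2 w HD (Rlt_le_trans _ _ _ Hw (Rmin_r _ _))).
  assert (H3 := Rlt_le_trans _ _ _ H2 (Rmin_l _ _)).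
  assert (H4 := Rlt_le_trans _ _ _ H2 (Rmin_r _ _)).
  replace (f w * g w - f z * g z)%C
    with ((f w - f z) * (g w - g z) + ((f w - f z) * g z + f z * (g w - g z)))%C by ring.
  eapply Rle_lt_trans; [apply Cmod_triangle|].
  eapply Rle_lt_trans; [apply Rplus_le_compat_l, Cmod_triangle|].
  rewrite !Cmod_mult.
  assert (Gw := Cmod_ge_0 (g w - g z)). assert (Fw := Cmod_ge_0 (f w - f z)).
  assert (E : e = 3 * (K * e')) by (unfold e'; field; lra).
  assert (A1 : Cmod (f w - f z) * Cmod (g w - g z) <= e' * 1) by (apply Rmult_le_compat; lra).
  unfold K in E. nra.
Qed.

Lemma contD_opp (D : C -> Prop) (f : C -> C) (z : C) :
  contD D f z -> contD D (fun w => - f w)%C z.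
Proof.
  intros Hf e He. destruct (Hf e He) as [d [Hd H]]. exists d. split; [assumption|].
  intros w HD Hw. replace (- f w - - f z)%C with (- (f w - f z))%C by ring.
  rewrite Cmod_opp. auto.
Qed.

Lemma contD_minus (D : C -> Prop) (f g : C -> C) (z : C) :
  contD D f z -> contD D g z -> contD D (fun w => f w - g w)%C z.
Proof. intros Hf Hg. apply contD_plus; [|apply contD_opp]; assumption. Qed.

Lemma contD_conj (D : C -> Prop) (f : C -> C) (z : C) :
  contD D f z -> contD D (fun w => Cconj (f w)) z.
Proof.
  intros Hf e He. destruct (Hf e He) as [d [Hd H]]. exists d. split; [assumption|].
  intros w HD Hw. rewrite <- Cminus_conj, Cmod_conj. auto.
Qed.

Notation cderiv := (derivD (fun _ => True)).
Notation ccont := (contD (fun _ => True)).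

Lemma cderiv_unique (f : C -> C) (z l m : C) : cderiv f z l -> cderiv f z m -> l = m.
Proof.
  intros Hl Hm. destruct (Ceq_dec l m) as [|Hne]; [assumption|exfalso].
  assert (Hp : 0 < Cmod (l - m)) by (apply Cmod_gt_0, Cminus_eq_contra; assumption).
  set (e := Cmod (l - m) / 4).
  destruct (Hl e ltac:(unfold e; lra)) as [d1 [Hd1 H1]].
  destruct (Hm e ltac:(unfold e; lra)) as [d2 [Hd2 H2]].
  set (d := Rmin d1 d2 / 2).
  assert (Hd : 0 < d) by (assert (0 < Rmin d1 d2) by (apply Rmin_pos; assumption); unfold d; lra).
  assert (Ed : Cmod (z + d - z) = d).
  { replace (z + d - z)%C with (RtoC d) by ring. apply Cmod_RtoC_nonneg. lra. }
  assert (D1 : d < d1) by (unfold d in *; assert (H := Rmin_l d1 d2); lra).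
  assert (D2 : d < d2) by (unfold d in *; assert (H := Rmin_r d1 d2); lra).
  specialize (H1 (z + d)%C I ltac:(lra)). specialize (H2 (z + d)%C I ltac:(lra)).
  rewrite Ed in H1, H2.
  assert (K : Cmod ((l - m) * d) <= 2 * e * d).
  { replace ((l - m) * d)%C with
      ((f (z + d) - f z - m * (z + d - z)) - (f (z + d) - f z - l * (z + d - z)))%C by ring.
    eapply Rle_trans; [apply Cmod_triangle_minus|]. lra. }
  rewrite Cmod_mult, (Cmod_RtoC_nonneg d) in K by lra. unfold e in K. nra.
Qed.

Lemma ex_derive_cderiv (f : C -> C) (z : C) :
  @ex_derive C_AbsRing C_NormedModule f z -> exists l, cderiv f z l.
Proof.
  intros [l Hl]. exists l. intros e He. destruct Hl as [_ Hl].
  specialize (Hl z (fun P H => H) (mkposreal e He)).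
  destruct Hl as [d Hd].
  exists d. split; [apply cond_pos|]. intros w _ Hw.
  specialize (Hd w Hw). simpl in Hd.
  change (norm (minus w z)) with (Cmod (w - z)) in Hd.
  change (norm (minus (minus (f w) (f z)) (scal (minus w z) l)))
    with (Cmod (f w - f z - (w - z) * l)) in Hd.
  rewrite (Cmult_comm l). exact Hd.
Qed.

(** * Curves and their integrals *)

Definition RL (w : C) : Prop := w = RtoC (Re w).
(** The curve is extended to the plane along [Re] and examined within the real axis, so the calculus
    rules for [derivD] and [contD] apply to curves without new epsilon arguments. *)
Definition rderiv (g : R -> C) (t : R) (l : C) : Prop := derivD RL (fun w => g (Re w)) (RtoC t) l.
Definition rcont (g : R -> C) (t : R) : Prop := contD RL (fun w => g (Re w)) (RtoC t).

Lemma rderiv_RtoC (t : R) : rderiv RtoC t 1.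
Proof.
  unfold rderiv. apply (derivD_loc RL (fun w => w) _ _ _ 1); [lra| reflexivity | | apply derivD_id].
  intros w H _. exact H.
Qed.

Lemma rderiv_elim (g : R -> C) (t : R) (l : C) : rderiv g t l ->
  forall eps, 0 < eps -> exists d, 0 < d /\ forall s, Rabs (s - t) < d ->
    Cmod (g s - g t - l * RtoC (s - t)) <= eps * Rabs (s - t).
Proof.
  intros H e He. destruct (H e He) as [d [Hd H']]. exists d. split; [assumption|].
  intros s Hs. specialize (H' (RtoC s) eq_refl).
  rewrite <- RtoC_minus, Cmod_R in H'. apply H'. assumption.
Qed.

Lemma rderiv_intro (g : R -> C) (t : R) (l : C) :
  (forall eps, 0 < eps -> exists d, 0 < d /\ forall s, Rabs (s - t) < d ->
    Cmod (g s - g t - l * RtoC (s - t)) <= eps * Rabs (s - t)) -> rderiv g t l.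
Proof.
  intros H e He. destruct (H e He) as [d [Hd H']]. exists d. split; [assumption|].
  intros w Hw. red in Hw. rewrite Hw. generalize (Re w). intros s.
  rewrite <- RtoC_minus, Cmod_R. apply H'.
Qed.

Lemma rcont_elim (g : R -> C) (t : R) : rcont g t ->
  forall eps, 0 < eps -> exists d, 0 < d /\ forall s, Rabs (s - t) < d ->
    Cmod (g s - g t) < eps.
Proof.
  intros H e He. destruct (H e He) as [d [Hd H']]. exists d. split; [assumption|].
  intros s Hs. specialize (H' (RtoC s) eq_refl).
  rewrite <- RtoC_minus, Cmod_R in H'. apply H'. assumption.
Qed.

Lemma rderiv_comp (f : C -> C) (g : R -> C) (t : R) (l m : C) :
  cderiv f (g t) l -> rderiv g t m -> rderiv (fun s => f (g s)) t (l * m).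
Proof. intros Hf Hg. apply (derivD_comp RL (fun _ => True) f); auto. Qed.

Lemma rcont_comp (f : C -> C) (g : R -> C) (t : R) :
  ccont f (g t) -> rcont g t -> rcont (fun s => f (g s)) t.
Proof. intros Hf Hg. apply (contD_comp RL (fun _ => True) f); auto. Qed.

Lemma rderiv_const (c : C) (t : R) : rderiv (fun _ => c) t 0.
Proof. apply derivD_const. Qed.

Lemma rderiv_plus (f g : R -> C) (t : R) (l m : C) :
  rderiv f t l -> rderiv g t m -> rderiv (fun s => f s + g s)%C t (l + m).
Proof. apply derivD_plus. Qed.

Lemma rderiv_mult (f g : R -> C) (t : R) (l m : C) :
  rderiv f t l -> rderiv g t m -> rderiv (fun s => f s * g s)%C t (l * g t + f t * m).
Proof. apply derivD_mult. Qed.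

Lemma rderiv_eq (f : R -> C) (t : R) (l m : C) : rderiv f t l -> l = m -> rderiv f t m.
Proof. intros H <-. exact H. Qed.

Lemma rderiv_scal (f : R -> C) (c : C) (t : R) (l : C) :
  rderiv f t l -> rderiv (fun s => c * f s)%C t (c * l).
Proof. apply derivD_scal. Qed.

Lemma rcont_rderiv (f : R -> C) (t : R) (l : C) : rderiv f t l -> rcont f t.
Proof. apply derivD_contD. Qed.

Lemma rcont_const (c : C) (t : R) : rcont (fun _ => c) t.
Proof. apply contD_const. Qed.

Lemma rcont_RtoC (t : R) : rcont RtoC t.
Proof. eapply rcont_rderiv, rderiv_RtoC. Qed.

Lemma rcont_plus (f g : R -> C) (t : R) :
  rcont f t -> rcont g t -> rcont (fun s => f s + g s)%C t.
Proof. apply contD_plus. Qed.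

Lemma rcont_minus (f g : R -> C) (t : R) :
  rcont f t -> rcont g t -> rcont (fun s => f s - g s)%C t.
Proof. apply contD_minus. Qed.

Lemma rcont_mult (f g : R -> C) (t : R) :
  rcont f t -> rcont g t -> rcont (fun s => f s * g s)%C t.
Proof. apply contD_mult. Qed.

Lemma rcont_conj (f : R -> C) (t : R) : rcont f t -> rcont (fun s => Cconj (f s)) t.
Proof. apply contD_conj. Qed.

Lemma Im_le_Cmod (z : C) : Rabs (Im z) <= Cmod z.
Proof. eapply Rle_trans; [|apply Rmax_Cmod]. apply Rmax_r. Qed.

Lemma Re_minus (z w : C) : Re (z - w) = Re z - Re w.
Proof. reflexivity. Qed.

Lemma Im_minus (z w : C) : Im (z - w) = Im z - Im w.
Proof. reflexivity. Qed.

Lemma is_derive_eps (h : R -> R) (t l : R) :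
  (forall eps, 0 < eps -> exists d, 0 < d /\ forall s, Rabs (s - t) < d ->
    Rabs (h s - h t - l * (s - t)) <= eps * Rabs (s - t)) <-> is_derive h t l.
Proof.
  rewrite is_derive_Reals. split.
  - intros H e He. destruct (H (e / 2) ltac:(lra)) as [d [Hd H']].
    exists (mkposreal d Hd). intros x Hx0 Hx. simpl in Hx.
    specialize (H' (t + x)). replace (t + x - t) with x in H' by ring.
    specialize (H' Hx).
    assert (0 < Rabs x) by (apply Rabs_pos_lt; assumption).
    replace ((h (t + x) - h t) / x - l) with ((h (t + x) - h t - l * x) / x) by (field; assumption).
    unfold Rdiv. rewrite Rabs_mult, Rabs_inv.
    apply Rmult_lt_reg_r with (Rabs x); [assumption|].
    rewrite Rmult_assoc, Rinv_l by lra. nra.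
  - intros H e He. destruct (H e He) as [d H']. exists d. split; [apply cond_pos|].
    intros s Hs. destruct (Req_dec s t) as [->|Hne].
    { replace (h t - h t - l * (t - t)) with 0 by ring. rewrite Rminus_diag, Rabs_R0. lra. }
    assert (Hx : s - t <> 0) by lra.
    specialize (H' (s - t) Hx Hs). replace (t + (s - t)) with s in H' by ring.
    replace (h s - h t - l * (s - t)) with (((h s - h t) / (s - t) - l) * (s - t)) by (field; assumption).
    rewrite Rabs_mult. apply Rmult_le_compat_r; [apply Rabs_pos | lra].
Qed.

Lemma rderiv_Re (g : R -> C) (t : R) (l : C) : rderiv g t l -> is_derive (fun s => Re (g s)) t (Re l).
Proof.
  intros H. apply is_derive_eps. intros e He.
  destruct (rderiv_elim _ _ _ H e He) as [d [Hd H']]. exists d. split; [assumption|].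
  intros s Hs. specialize (H' s Hs). eapply Rle_trans; [|apply H'].
  rewrite <- re_scal_r, <- !Re_minus. apply re_le_Cmod.
Qed.

Lemma rderiv_Im (g : R -> C) (t : R) (l : C) : rderiv g t l -> is_derive (fun s => Im (g s)) t (Im l).
Proof.
  intros H. apply is_derive_eps. intros e He.
  destruct (rderiv_elim _ _ _ H e He) as [d [Hd H']]. exists d. split; [assumption|].
  intros s Hs. specialize (H' s Hs). eapply Rle_trans; [|apply H'].
  rewrite <- im_scal_r, <- !Im_minus. apply Im_le_Cmod.
Qed.

Lemma rderiv_of_real (h : R -> R) (t l : R) : is_derive h t l -> rderiv (fun s => RtoC (h s)) t l.
Proof.
  intros H. apply rderiv_intro. intros e He.
  destruct (proj2 (is_derive_eps _ _ _) H e He) as [d [Hd H']]. exists d. split; [assumption|].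
  intros s Hs. rewrite <- RtoC_mult, <- !RtoC_minus, Cmod_R. auto.
Qed.

Lemma rcont_of_real (h : R -> R) (t : R) : continuous h t -> rcont (fun s => RtoC (h s)) t.
Proof.
  intros H e He. destruct (proj1 (filterlim_locally _ _) H (mkposreal e He)) as [d Hd].
  exists d. split; [apply cond_pos|]. intros w HR. red in HR. rewrite HR.
  generalize (Re w). intros s Hs. rewrite <- RtoC_minus, Cmod_R in Hs.
  rewrite <- RtoC_minus, Cmod_R. apply (Hd s). exact Hs.
Qed.

Lemma rcont_Re (g : R -> C) (t : R) : rcont g t -> continuous (fun s => Re (g s)) t.
Proof.
  intros H. apply filterlim_locally. intros e.
  destruct (rcont_elim _ _ H e (cond_pos e)) as [d [Hd H']].
  exists (mkposreal d Hd). intros s Hs. specialize (H' s Hs).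
  change (Rabs (Re (g s) - Re (g t)) < e). rewrite <- Re_minus.
  eapply Rle_lt_trans; [apply re_le_Cmod | exact H'].
Qed.

Lemma rcont_Im (g : R -> C) (t : R) : rcont g t -> continuous (fun s => Im (g s)) t.
Proof.
  intros H. apply filterlim_locally. intros e.
  destruct (rcont_elim _ _ H e (cond_pos e)) as [d [Hd H']].
  exists (mkposreal d Hd). intros s Hs. specialize (H' s Hs).
  change (Rabs (Im (g s) - Im (g t)) < e). rewrite <- Im_minus.
  eapply Rle_lt_trans; [apply Im_le_Cmod | exact H'].
Qed.

Lemma rcont_Cmod (g : R -> C) (t : R) : rcont g t -> continuous (fun s => Cmod (g s)) t.
Proof.
  intros H. apply filterlim_locally. intros e.
  destruct (rcont_elim _ _ H e (cond_pos e)) as [d [Hd H']].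
  exists (mkposreal d Hd). intros s Hs. specialize (H' s Hs).
  change (Rabs (Cmod (g s) - Cmod (g t)) < e).
  assert (A := Cmod_triangle_sub (g s) (g t)). assert (B := Cmod_triangle_sub (g t) (g s)).
  rewrite (Cmod_minus_sym (g t)) in B. apply Rabs_def1; lra.
Qed.

Lemma rcont_continuous (g : R -> C) (t : R) :
  rcont g t -> @continuous R_UniformSpace C_R_CompleteNormedModule g t.
Proof.
  intros H. apply filterlim_locally. intros e.
  destruct (rcont_elim _ _ H e (cond_pos e)) as [d [Hd H']].
  exists (mkposreal d Hd). intros s Hs. specialize (H' s Hs).
  split.
  - change (Rabs (Re (g s) - Re (g t)) < e). rewrite <- Re_minus.
    eapply Rle_lt_trans; [apply re_le_Cmod | exact H'].
  - change (Rabs (Im (g s) - Im (g t)) < e). rewrite <- Im_minus.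
    eapply Rle_lt_trans; [apply Im_le_Cmod | exact H'].
Qed.

(** * The unit circle and complex-valued integrals *)

Definition cis (t : R) : C := (cos t, sin t).

Lemma pair_RtoC (x y : R) : ((x, y) : C) = (RtoC x + Ci * RtoC y)%C.
Proof. unfold Cplus, Cmult, Ci, RtoC; simpl. f_equal; ring. Qed.

Lemma rderiv_ext (f g : R -> C) (t : R) (l : C) : (forall s, f s = g s) -> rderiv f t l -> rderiv g t l.
Proof.
  intros H Hf. apply (derivD_loc RL (fun w => f (Re w)) _ _ _ 1); [lra | reflexivity | | exact Hf].
  intros. apply H.
Qed.

Lemma rderiv_cis (t : R) : rderiv cis t (Ci * cis t).
Proof.
  eapply rderiv_ext; [intros s; symmetry; apply pair_RtoC|].
  eapply rderiv_eq.
  - apply (rderiv_plus (fun s => RtoC (cos s)) (fun s => Ci * RtoC (sin s))%C).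
    + apply rderiv_of_real. apply is_derive_cos.
    + apply (rderiv_scal (fun s => RtoC (sin s))). apply rderiv_of_real. apply is_derive_sin.
  - unfold cis, Cplus, Cmult, Ci, RtoC; simpl. f_equal; ring.
Qed.

Lemma rcont_cis (t : R) : rcont cis t.
Proof. eapply rcont_rderiv, rderiv_cis. Qed.

Lemma Cmod_cis (t : R) : Cmod (cis t) = 1.
Proof.
  unfold Cmod, cis; simpl. replace (cos t * (cos t * 1) + sin t * (sin t * 1)) with 1.
  - apply sqrt_1.
  - assert (H := sin2_cos2 t). unfold Rsqr in H. lra.
Qed.

Lemma cis_conj (t : R) : (cis t * Cconj (cis t))%C = 1.
Proof. rewrite <- Cmod2_conj, Cmod_cis. f_equal. ring. Qed.

Lemma cis_0 : cis 0 = 1.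
Proof. unfold cis. rewrite cos_0, sin_0. reflexivity. Qed.

Lemma cis_2PI : cis (2 * PI) = 1.
Proof. unfold cis. rewrite cos_2PI, sin_2PI. reflexivity. Qed.

Definition Cint (g : R -> C) (a b : R) : C := @RInt C_R_CompleteNormedModule g a b.

Lemma ex_Cint (g : R -> C) (a b : R) : a <= b -> (forall t, a <= t <= b -> rcont g t) ->
  @ex_RInt C_R_CompleteNormedModule g a b.
Proof.
  intros Hab H. apply ex_RInt_continuous. intros z Hz.
  rewrite Rmin_left, Rmax_right in Hz by assumption. apply rcont_continuous. auto.
Qed.

Lemma Cint_correct (g : R -> C) (a b : R) : a <= b -> (forall t, a <= t <= b -> rcont g t) ->
  @is_RInt C_R_CompleteNormedModule g a b (Cint g a b).
Proof. intros Hab H. apply (@RInt_correct C_R_CompleteNormedModule). apply ex_Cint; assumption. Qed.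

Lemma Cint_ext (f g : R -> C) (a b : R) : a <= b -> (forall t, a <= t <= b -> f t = g t) ->
  Cint f a b = Cint g a b.
Proof.
  intros Hab H. apply (@RInt_ext C_R_CompleteNormedModule). intros x Hx.
  rewrite Rmin_left, Rmax_right in Hx by assumption. apply H. lra.
Qed.

Lemma Cint_plus (f g : R -> C) (a b : R) : a <= b ->
  (forall t, a <= t <= b -> rcont f t) -> (forall t, a <= t <= b -> rcont g t) ->
  Cint (fun t => f t + g t)%C a b = (Cint f a b + Cint g a b)%C.
Proof.
  intros Hab Hf Hg. apply (@RInt_plus C_R_CompleteNormedModule f g); apply ex_Cint; assumption.
Qed.

Lemma Cint_Re (g : R -> C) (a b : R) : a <= b -> (forall t, a <= t <= b -> rcont g t) ->
  Re (Cint g a b) = RInt (fun t => Re (g t)) a b.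
Proof.
  intros Hab H. symmetry. apply is_RInt_unique.
  apply (@is_RInt_fct_extend_fst R_NormedModule R_NormedModule g a b (Cint g a b)).
  apply Cint_correct; assumption.
Qed.

Lemma Cint_Im (g : R -> C) (a b : R) : a <= b -> (forall t, a <= t <= b -> rcont g t) ->
  Im (Cint g a b) = RInt (fun t => Im (g t)) a b.
Proof.
  intros Hab H. symmetry. apply is_RInt_unique.
  apply (@is_RInt_fct_extend_snd R_NormedModule R_NormedModule g a b (Cint g a b)).
  apply Cint_correct; assumption.
Qed.

Lemma Cint_norm_le (g : R -> C) (h : R -> R) (a b : R) : a <= b ->
  (forall t, a <= t <= b -> rcont g t) -> (forall t, a <= t <= b -> continuous h t) ->
  (forall t, a <= t <= b -> Cmod (g t) <= h t) -> Cmod (Cint g a b) <= RInt h a b.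
Proof.
  intros Hab Hg Hh H. rewrite Cmod_norm.
  apply (norm_RInt_le g h a b (Cint g a b) (RInt h a b) Hab).
  - intros x Hx. rewrite <- (H x Hx) || (eapply Rle_trans; [|apply (H x Hx)]).
    rewrite Cmod_norm. apply Rle_refl.
  - apply Cint_correct; assumption.
  - apply (@RInt_correct R_CompleteNormedModule). apply (@ex_RInt_continuous R_CompleteNormedModule). intros z Hz.
    rewrite Rmin_left, Rmax_right in Hz by assumption. auto.
Qed.

Lemma Cint_norm_const (g : R -> C) (M a b : R) : a <= b ->
  (forall t, a <= t <= b -> rcont g t) ->
  (forall t, a <= t <= b -> Cmod (g t) <= M) -> Cmod (Cint g a b) <= M * (b - a).
Proof.
  intros Hab Hg H. eapply Rle_trans.
  - apply (Cint_norm_le g (fun _ => M)); try assumption. intros. apply continuous_const.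
  - rewrite RInt_const. change (scal (b - a) M) with ((b - a) * M). right; ring.
Qed.

Lemma Cint_const (c : C) (a b : R) : Cint (fun _ => c) a b = (RtoC (b - a) * c)%C.
Proof.
  unfold Cint. rewrite RInt_const. apply scal_R_Cmult.
Qed.

Lemma Cint_FTC (G g : R -> C) (a b : R) : a <= b ->
  (forall t, a <= t <= b -> rderiv G t (g t)) -> (forall t, a <= t <= b -> rcont g t) ->
  Cint g a b = (G b - G a)%C.
Proof.
  intros Hab HG Hg.
  assert (Hc : forall h : R -> R, (forall t, a <= t <= b -> continuous h t) ->
     forall z, Rmin a b <= z <= Rmax a b -> continuous h z).
  { intros h Hh z Hz. rewrite Rmin_left, Rmax_right in Hz by assumption. auto. }
  apply injective_projections.
  - change (fst (Cint g a b)) with (Re (Cint g a b)). rewrite Cint_Re by assumption.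
    apply is_RInt_unique.
    apply (@is_RInt_derive R_CompleteNormedModule (fun t => Re (G t)) (fun t => Re (g t))).
    + intros x Hx. rewrite Rmin_left, Rmax_right in Hx by assumption. apply rderiv_Re. auto.
    + apply Hc. intros. apply rcont_Re. auto.
  - change (snd (Cint g a b)) with (Im (Cint g a b)). rewrite Cint_Im by assumption.
    apply is_RInt_unique.
    apply (@is_RInt_derive R_CompleteNormedModule (fun t => Im (G t)) (fun t => Im (g t))).
    + intros x Hx. rewrite Rmin_left, Rmax_right in Hx by assumption. apply rderiv_Im. auto.
    + apply Hc. intros. apply rcont_Im. auto.
Qed.

Lemma RInt_cont_ex (h : R -> R) (a b : R) : a <= b -> (forall t, a <= t <= b -> continuous h t) ->
  ex_RInt h a b.
Proof.
  intros Hab H. apply (@ex_RInt_continuous R_CompleteNormedModule). intros z Hz.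
  rewrite Rmin_left, Rmax_right in Hz by assumption. auto.
Qed.

(** The module structure behind [Cint] has real scalars, so complex ones are handled through real
    and imaginary parts. *)
Lemma Cint_scal (c : C) (g : R -> C) (a b : R) : a <= b -> (forall t, a <= t <= b -> rcont g t) ->
  Cint (fun t => c * g t)%C a b = (c * Cint g a b)%C.
Proof.
  intros Hab H.
  assert (H' : forall t, a <= t <= b -> rcont (fun t => c * g t)%C t).
  { intros. apply rcont_mult; [apply rcont_const | auto]. }
  assert (E1 := RInt_cont_ex _ a b Hab (fun t Ht => rcont_Re g t (H t Ht))).
  assert (E2 := RInt_cont_ex _ a b Hab (fun t Ht => rcont_Im g t (H t Ht))).
  apply injective_projections.
  - change (fst (Cint (fun t => c * g t)%C a b)) with (Re (Cint (fun t => c * g t)%C a b)).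
    change (fst (c * Cint g a b)%C) with (Re (c * Cint g a b)).
    rewrite re_mult, !Cint_Re, Cint_Im by assumption.
    apply is_RInt_unique.
    apply (@is_RInt_ext R_NormedModule (fun t => minus (scal (Re c) (Re (g t))) (scal (Im c) (Im (g t))))).
    { intros. symmetry. apply re_mult. }
    apply (@is_RInt_minus R_NormedModule); apply (@is_RInt_scal R_NormedModule);
      apply (@RInt_correct R_CompleteNormedModule); assumption.
  - change (snd (Cint (fun t => c * g t)%C a b)) with (Im (Cint (fun t => c * g t)%C a b)).
    change (snd (c * Cint g a b)%C) with (Im (c * Cint g a b)).
    rewrite im_mult, Cint_Re, !Cint_Im by assumption.
    apply is_RInt_unique.
    apply (@is_RInt_ext R_NormedModule (fun t => plus (scal (Re c) (Im (g t))) (scal (Im c) (Re (g t))))).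
    { intros. symmetry. apply im_mult. }
    apply (@is_RInt_plus R_NormedModule); apply (@is_RInt_scal R_NormedModule);
      apply (@RInt_correct R_CompleteNormedModule); assumption.
Qed.

Lemma Cint_minus (f g : R -> C) (a b : R) : a <= b ->
  (forall t, a <= t <= b -> rcont f t) -> (forall t, a <= t <= b -> rcont g t) ->
  Cint (fun t => f t - g t)%C a b = (Cint f a b - Cint g a b)%C.
Proof.
  intros Hab Hf Hg. apply (@RInt_minus C_R_CompleteNormedModule f g); apply ex_Cint; assumption.
Qed.

Lemma Cint_conj (g : R -> C) (a b : R) : a <= b -> (forall t, a <= t <= b -> rcont g t) ->
  Cint (fun t => Cconj (g t)) a b = Cconj (Cint g a b).
Proof.
  intros Hab H.
  assert (H' : forall t, a <= t <= b -> rcont (fun t => Cconj (g t)) t).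
  { intros. apply rcont_conj. auto. }
  assert (E2 := RInt_cont_ex _ a b Hab (fun t Ht => rcont_Im g t (H t Ht))).
  apply injective_projections.
  - change (fst (Cint (fun t => Cconj (g t)) a b)) with (Re (Cint (fun t => Cconj (g t)) a b)).
    change (fst (Cconj (Cint g a b))) with (Re (Cconj (Cint g a b))).
    rewrite re_conj, !Cint_Re by assumption. reflexivity.
  - change (snd (Cint (fun t => Cconj (g t)) a b)) with (Im (Cint (fun t => Cconj (g t)) a b)).
    change (snd (Cconj (Cint g a b))) with (Im (Cconj (Cint g a b))).
    rewrite im_conj, !Cint_Im by assumption.
    apply (@RInt_opp R_CompleteNormedModule). assumption.
Qed.

(** * Goursat's theorem *)

Definition seg_int (f : C -> C) (a b : C) : C :=
  ((b - a) * Cint (fun t => f (a + RtoC t * (b - a))%C) 0 1)%C.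

Definition tri_int (f : C -> C) (a b c : C) : C := (seg_int f a b + seg_int f b c + seg_int f c a)%C.

Definition holo (rho : R) (f : C -> C) : Prop :=
  forall z, Cmod z < rho -> exists l, cderiv f z l.

Definition contb (rho : R) (f : C -> C) : Prop := forall z, Cmod z < rho -> ccont f z.

Lemma holo_contb (rho : R) (f : C -> C) : holo rho f -> contb rho f.
Proof. intros H z Hz. destruct (H z Hz) as [l Hl]. eapply derivD_contD, Hl. Qed.

Lemma seg_int_point_dist (a b : C) (t : R) : 0 <= t <= 1 -> Cmod (a + RtoC t * (b - a) - a) <= Cmod (b - a).
Proof.
  intros Ht. replace (a + RtoC t * (b - a) - a)%C with (RtoC t * (b - a))%C by ring.
  rewrite Cmod_mult, Cmod_RtoC_nonneg by lra. assert (H := Cmod_ge_0 (b - a)). nra.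
Qed.

Lemma seg_int_point_le (a b : C) (t rho : R) : 0 <= t <= 1 -> Cmod a <= rho -> Cmod b <= rho ->
  Cmod (a + RtoC t * (b - a)) <= rho.
Proof.
  intros Ht Ha Hb. replace (a + RtoC t * (b - a))%C with (RtoC (1 - t) * a + RtoC t * b)%C
    by (rewrite RtoC_minus; ring).
  eapply Rle_trans; [apply Cmod_triangle|]. rewrite !Cmod_mult, !Cmod_RtoC_nonneg by lra. nra.
Qed.

Lemma seg_int_point_lt (a b : C) (t rho : R) : 0 <= t <= 1 -> Cmod a < rho -> Cmod b < rho ->
  Cmod (a + RtoC t * (b - a)) < rho.
Proof.
  intros Ht Ha Hb. apply Rle_lt_trans with (Rmax (Cmod a) (Cmod b)).
  - apply seg_int_point_le; [assumption | apply Rmax_l | apply Rmax_r].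
  - apply Rmax_lub_lt; assumption.
Qed.

Lemma rderiv_line (a d : C) (t : R) : rderiv (fun s => a + RtoC s * d)%C t d.
Proof.
  eapply rderiv_eq.
  - apply (rderiv_plus (fun _ => a) (fun s => RtoC s * d)%C); [apply rderiv_const|].
    apply (rderiv_mult RtoC (fun _ => d)); [apply rderiv_RtoC | apply rderiv_const].
  - cbv beta. ring.
Qed.

Lemma rcont_line (a d : C) (t : R) : rcont (fun s => a + RtoC s * d)%C t.
Proof. eapply rcont_rderiv, rderiv_line. Qed.

Lemma rcont_seg_int (f : C -> C) (rho : R) (a b : C) : contb rho f -> Cmod a < rho -> Cmod b < rho ->
  forall t, 0 <= t <= 1 -> rcont (fun t => f (a + RtoC t * (b - a))%C) t.
Proof.
  intros Hf Ha Hb t Ht. apply (rcont_comp f).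
  - apply Hf, seg_int_point_lt; assumption.
  - apply rcont_line.
Qed.

Lemma Cint_lin (g : R -> C) (u v a b : R) :
  @ex_RInt C_R_CompleteNormedModule g (u * a + v) (u * b + v) ->
  Cint (fun t => RtoC u * g (u * t + v)%R)%C a b = Cint g (u * a + v) (u * b + v).
Proof.
  intros H. unfold Cint. rewrite <- (@RInt_comp_lin C_R_CompleteNormedModule g u v a b H).
  apply (@RInt_ext C_R_CompleteNormedModule). intros. symmetry. apply scal_R_Cmult.
Qed.

Lemma seg_int_rev (f : C -> C) (rho : R) (a b : C) : contb rho f -> Cmod a < rho -> Cmod b < rho ->
  seg_int f b a = (- seg_int f a b)%C.
Proof.
  intros Hf Ha Hb. unfold seg_int.
  assert (Hc := rcont_seg_int f rho a b Hf Ha Hb).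
  assert (E := Cint_lin (fun t => f (a + RtoC t * (b - a))%C) (-1) 1 0 1).
  replace (-1 * 0 + 1) with 1 in E by ring. replace (-1 * 1 + 1) with 0 in E by ring.
  assert (H1 : @ex_RInt C_R_CompleteNormedModule (fun t => f (a + RtoC t * (b - a))%C) 0 1).
  { apply ex_Cint; [lra|assumption]. }
  specialize (E (@ex_RInt_swap C_R_NormedModule _ _ _ H1)).
  assert (E2 : Cint (fun t => f (a + RtoC t * (b - a))%C) 1 0 =
          Copp (Cint (fun t => f (a + RtoC t * (b - a))%C) 0 1)).
  { symmetry. apply (@opp_RInt_swap C_R_CompleteNormedModule).
    assumption. }
  rewrite E2 in E.
  assert (E3 : Cint (fun t => RtoC (-1) * f (a + RtoC (-1 * t + 1)%R * (b - a)))%C 0 1 =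
     (RtoC (-1) * Cint (fun t => f (b + RtoC t * (a - b))%C) 0 1)%C).
  { rewrite <- Cint_scal; [|lra | apply (rcont_seg_int f rho); assumption].
    apply Cint_ext; [lra|]. intros t _. do 2 f_equal.
    rewrite RtoC_plus, RtoC_mult. ring. }
  rewrite E3 in E.
  replace (Cint (fun t => f (b + RtoC t * (a - b))%C) 0 1)
    with (- (RtoC (-1) * Cint (fun t => f (b + RtoC t * (a - b))%C) 0 1))%C
    by ring.
  rewrite E. ring.
Qed.

Definition mid (a b : C) : C := ((a + b) / 2)%C.

Lemma Cmod_mid_le (a b : C) (rho : R) : Cmod a <= rho -> Cmod b <= rho -> Cmod (mid a b) <= rho.
Proof.
  intros. replace (mid a b) with (a + RtoC (/ 2) * (b - a))%C.
  - apply seg_int_point_le; try assumption; lra.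
  - unfold mid. rewrite RtoC_inv by lra. field.
Qed.

Lemma Cmod_mid_lt (a b : C) (rho : R) : Cmod a < rho -> Cmod b < rho -> Cmod (mid a b) < rho.
Proof.
  intros. apply Rle_lt_trans with (Rmax (Cmod a) (Cmod b)).
  - apply Cmod_mid_le; [apply Rmax_l | apply Rmax_r].
  - apply Rmax_lub_lt; assumption.
Qed.

Lemma C2_neq0 : RtoC 2 <> 0.
Proof. intros E; injection E; lra. Qed.

Lemma seg_int_mid (f : C -> C) (rho : R) (a b : C) : contb rho f -> Cmod a < rho -> Cmod b < rho ->
  seg_int f a b = (seg_int f a (mid a b) + seg_int f (mid a b) b)%C.
Proof.
  intros Hf Ha Hb.
  assert (Hm := Cmod_mid_lt _ _ _ Ha Hb).
  assert (Hc := rcont_seg_int f rho a b Hf Ha Hb).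
  set (g := fun t => f (a + RtoC t * (b - a))%C) in *.
  assert (X1 : @ex_RInt C_R_CompleteNormedModule g 0 (/2)).
  { apply ex_Cint; [lra|]. intros. apply Hc. lra. }
  assert (X2 : @ex_RInt C_R_CompleteNormedModule g (/2) 1).
  { apply ex_Cint; [lra|]. intros. apply Hc. lra. }
  assert (E1 := Cint_lin g (/2) 0 0 1). assert (E2 := Cint_lin g (/2) (/2) 0 1).
  replace (/2 * 0 + 0) with 0 in E1 by field. replace (/2 * 1 + 0) with (/2) in E1 by field.
  replace (/2 * 0 + /2) with (/2) in E2 by field. replace (/2 * 1 + /2) with 1 in E2 by field.
  specialize (E1 X1). specialize (E2 X2).
  assert (E : Cint g 0 1 = (Cint g 0 (/2) + Cint g (/2) 1)%C).
  { symmetry. apply (@RInt_Chasles C_R_CompleteNormedModule); assumption. }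
  unfold seg_int. fold g. rewrite E, <- E1, <- E2.
  rewrite (Cint_ext (fun t => RtoC (/ 2) * g (/ 2 * t + 0)%R)%C
     (fun t => RtoC (/2) * f (a + RtoC t * (mid a b - a)))%C); [|lra|].
  2:{ intros t _. unfold g, mid. do 2 f_equal. rewrite RtoC_plus, RtoC_mult, RtoC_inv by lra.
      field. }
  rewrite (Cint_ext (fun t => RtoC (/ 2) * g (/ 2 * t + / 2)%R)%C
     (fun t => RtoC (/2) * f (mid a b + RtoC t * (b - mid a b)))%C); [|lra|].
  2:{ intros t _. unfold g, mid. do 2 f_equal. rewrite RtoC_plus, RtoC_mult, RtoC_inv by lra.
      field. }
  rewrite !Cint_scal by (try lra; apply (rcont_seg_int f rho); assumption).
  replace (mid a b - a)%C with (RtoC (/2) * (b - a))%C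
    by (unfold mid; rewrite RtoC_inv by lra; field).
  replace (b - mid a b)%C with (RtoC (/2) * (b - a))%C
    by (unfold mid; rewrite RtoC_inv by lra; field).
  ring.
Qed.

Lemma seg_int_norm (f : C -> C) (rho : R) (a b : C) (M : R) : contb rho f -> Cmod a < rho -> Cmod b < rho ->
  (forall t, 0 <= t <= 1 -> Cmod (f (a + RtoC t * (b - a))%C) <= M) ->
  Cmod (seg_int f a b) <= M * Cmod (b - a).
Proof.
  intros Hf Ha Hb H. unfold seg_int. rewrite Cmod_mult, Rmult_comm.
  apply Rmult_le_compat_r; [apply Cmod_ge_0|].
  eapply Rle_trans; [apply (Cint_norm_const _ M); [lra | apply (rcont_seg_int f rho); assumption | assumption]|].
  lra.
Qed.

Lemma seg_int_minus (f g : C -> C) (rho : R) (a b : C) : contb rho f -> contb rho g ->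
  Cmod a < rho -> Cmod b < rho ->
  seg_int (fun z => f z - g z)%C a b = (seg_int f a b - seg_int g a b)%C.
Proof.
  intros Hf Hg Ha Hb. unfold seg_int.
  rewrite (Cint_minus (fun t => f (a + RtoC t * (b - a))%C) (fun t => g (a + RtoC t * (b - a))%C));
    [ring | lra | |]; apply (rcont_seg_int _ rho); assumption.
Qed.

Lemma seg_int_FTC (F f : C -> C) (rho : R) (a b : C) : contb rho f ->
  (forall z, Cmod z < rho -> cderiv F z (f z)) ->
  Cmod a < rho -> Cmod b < rho -> seg_int f a b = (F b - F a)%C.
Proof.
  intros Hf HF Ha Hb. unfold seg_int.
  rewrite <- Cint_scal; [|lra | apply (rcont_seg_int f rho); assumption].
  rewrite (Cint_FTC (fun t => F (a + RtoC t * (b - a))%C)).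
  - f_equal; [|f_equal]; f_equal; ring.
  - lra.
  - intros t Ht. eapply rderiv_eq.
    + apply (rderiv_comp F); [|apply rderiv_line]. apply HF, seg_int_point_lt; assumption.
    + cbv beta. ring.
  - intros t Ht. apply rcont_mult; [apply rcont_const | apply (rcont_seg_int f rho); assumption].
Qed.

Lemma tri_int_split (f : C -> C) (rho : R) (a b c : C) : contb rho f ->
  Cmod a < rho -> Cmod b < rho -> Cmod c < rho ->
  tri_int f a b c = (tri_int f a (mid a b) (mid c a) + tri_int f (mid a b) b (mid b c)
     + tri_int f (mid c a) (mid b c) c + tri_int f (mid a b) (mid b c) (mid c a))%C.
Proof.
  intros Hf Ha Hb Hc. unfold tri_int.
  assert (H1 := Cmod_mid_lt _ _ _ Ha Hb). assert (H2 := Cmod_mid_lt _ _ _ Hb Hc).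
  assert (H3 := Cmod_mid_lt _ _ _ Hc Ha).
  rewrite (seg_int_mid f rho a b), (seg_int_mid f rho b c), (seg_int_mid f rho c a) by assumption.
  rewrite (seg_int_rev f rho (mid a b) (mid c a)), (seg_int_rev f rho (mid b c) (mid a b)),
    (seg_int_rev f rho (mid c a) (mid b c)) by assumption.
  ring.
Qed.

Lemma tri_int_affine (A B a b c : C) : tri_int (fun z => A + B * z)%C a b c = 0.
Proof.
  set (F := fun z => (A * z + B * (z * z) / 2)%C).
  set (rho := 1 + Cmod a + Cmod b + Cmod c).
  assert (Ha := Cmod_ge_0 a). assert (Hb := Cmod_ge_0 b). assert (Hc := Cmod_ge_0 c).
  assert (HF : forall z, Cmod z < rho -> cderiv F z (A + B * z)%C).
  { intros z _. unfold F. eapply derivD_eq.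
    - apply derivD_plus; [apply derivD_scal, derivD_id|]. unfold Cdiv.
      apply (derivD_mult _ (fun w => B * (w * w))%C (fun _ => / 2)%C); [|apply derivD_const].
      apply derivD_scal. apply (derivD_mult _ (fun w => w) (fun w => w)); apply derivD_id.
    - cbv beta. field. }
  assert (Hc' : contb rho (fun z => A + B * z)%C).
  { intros z _. apply contD_plus; [apply contD_const|]. apply contD_mult; [apply contD_const | apply contD_id]. }
  unfold tri_int. rewrite !(seg_int_FTC F _ rho) by (try assumption; unfold rho; lra). ring.
Qed.

Definition tri3 (f : C -> C) (T : C * C * C) : C := tri_int f (fst (fst T)) (snd (fst T)) (snd T).

(** The bisection step of Goursat's proof. The last triangle is taken without a test: when the first
    three fall below a quarter of the integral, [tri_int_split] forces it to be large. *)
Definition tri_int_next (f : C -> C) (T : C * C * C) : C * C * C :=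
  let '(a, b, c) := T in
  let m := Cmod (tri_int f a b c) / 4 in
  if Rle_dec m (Cmod (tri_int f a (mid a b) (mid c a))) then (a, mid a b, mid c a)
  else if Rle_dec m (Cmod (tri_int f (mid a b) b (mid b c))) then (mid a b, b, mid b c)
  else if Rle_dec m (Cmod (tri_int f (mid c a) (mid b c) c)) then (mid c a, mid b c, c)
  else (mid a b, mid b c, mid c a).

Fixpoint tri_int_seq (f : C -> C) (T : C * C * C) (n : nat) : C * C * C :=
  match n with O => T | S n => tri_int_next f (tri_int_seq f T n) end.

Definition tri_int_bound (T : C * C * C) (rho L : R) : Prop :=
  let '(a, b, c) := T in
  (Cmod a <= rho /\ Cmod b <= rho /\ Cmod c <= rho) /\
  (Cmod (b - a) <= L /\ Cmod (c - b) <= L /\ Cmod (a - c) <= L).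

Lemma Cmod_half (z : C) : Cmod (z / 2) = Cmod z / 2.
Proof. rewrite Cmod_div by apply C2_neq0. rewrite Cmod_RtoC_nonneg by lra. reflexivity. Qed.

Lemma tri_int_next_bound (f : C -> C) (T : C * C * C) (rho L : R) :
  tri_int_bound T rho L -> tri_int_bound (tri_int_next f T) rho (L / 2) /\
  Cmod (fst (fst (tri_int_next f T)) - fst (fst T)) <= L.
Proof.
  destruct T as [[a b] c]. intros [[Ha [Hb Hc]] [H1 [H2 H3]]].
  assert (M1 := Cmod_mid_le _ _ _ Ha Hb). assert (M2 := Cmod_mid_le _ _ _ Hb Hc).
  assert (M3 := Cmod_mid_le _ _ _ Hc Ha).
  assert (L0 : 0 <= L) by (eapply Rle_trans; [apply Cmod_ge_0 | apply H1]).
  assert (Half : forall u v : C, forall x, Cmod v <= L -> u = (v / 2)%C -> x = L / 2 -> Cmod u <= x).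
  { intros u v x Hv -> ->. rewrite Cmod_half. lra. }
  assert (N1 : Cmod (a - b) <= L) by (rewrite Cmod_minus_sym; assumption).
  assert (N2 : Cmod (b - c) <= L) by (rewrite Cmod_minus_sym; assumption).
  assert (N3 : Cmod (c - a) <= L) by (rewrite Cmod_minus_sym; assumption).
  assert (Z : Cmod (a - a) <= L).
  { replace (a - a)%C with (RtoC 0) by ring. rewrite Cmod_0. assumption. }
  assert (Z1 : Cmod (mid a b - a) <= L / 2).
  { apply (Half _ (b - a)%C); [assumption | unfold mid; field | reflexivity]. }
  assert (Z2 : Cmod (mid c a - a) <= L / 2).
  { apply (Half _ (c - a)%C); [assumption | unfold mid; field | reflexivity]. }
  unfold tri_int_next.
  repeat match goal with |- context [Rle_dec ?x ?y] => destruct (Rle_dec x y) end;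
  (split; [split; [repeat split; assumption|] | simpl; lra]); repeat split;
  first [ apply (Half _ (b - a)%C); [assumption | unfold mid; field | reflexivity]
        | apply (Half _ (c - b)%C); [assumption | unfold mid; field | reflexivity]
        | apply (Half _ (a - c)%C); [assumption | unfold mid; field | reflexivity]
        | apply (Half _ (a - b)%C); [assumption | unfold mid; field | reflexivity]
        | apply (Half _ (b - c)%C); [assumption | unfold mid; field | reflexivity]
        | apply (Half _ (c - a)%C); [assumption | unfold mid; field | reflexivity] ].
Qed.

Lemma tri_int_next_large (f : C -> C) (rho rho' L : R) (T : C * C * C) :
  contb rho' f -> rho < rho' -> tri_int_bound T rho L ->
  Cmod (tri3 f T) / 4 <= Cmod (tri3 f (tri_int_next f T)).
Proof.
  destruct T as [[a b] c]. intros Hf Hr [[Ha [Hb Hc]] _].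
  unfold tri3 at 1; simpl fst; simpl snd.
  assert (E := tri_int_split f rho' a b c Hf ltac:(lra) ltac:(lra) ltac:(lra)).
  unfold tri_int_next.
  destruct Rle_dec; [assumption|]. destruct Rle_dec; [assumption|]. destruct Rle_dec; [assumption|].
  unfold tri3; simpl fst; simpl snd.
  apply (f_equal Cmod) in E.
  assert (A1 := Cmod_triangle (tri_int f a (mid a b) (mid c a) + tri_int f (mid a b) b (mid b c)
     + tri_int f (mid c a) (mid b c) c) (tri_int f (mid a b) (mid b c) (mid c a))).
  assert (A2 := Cmod_triangle (tri_int f a (mid a b) (mid c a) + tri_int f (mid a b) b (mid b c))
       (tri_int f (mid c a) (mid b c) c)).
  assert (A3 := Cmod_triangle (tri_int f a (mid a b) (mid c a)) (tri_int f (mid a b) b (mid b c))).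
  lra.
Qed.

Lemma geometric_real_limit (u : nat -> R) (K : R) :
  (forall n, Rabs (u (S n) - u n) <= K * (/ 2) ^ n) ->
  exists x, forall n, Rabs (u n - x) <= 2 * K * (/ 2) ^ n.
Proof.
  intros H.
  assert (P : forall n, 0 < (/ 2) ^ n) by (intros; apply pow_lt; lra).
  assert (H2 : forall n m, Rabs (u (n + m)%nat - u n) <= 2 * K * ((/ 2) ^ n - (/ 2) ^ (n + m))).
  { intros n m. induction m as [|m IH].
    - rewrite Nat.add_0_r, !Rminus_diag, Rabs_R0. lra.
    - rewrite Nat.add_succ_r. replace (u (S (n + m)) - u n)
        with ((u (S (n + m)) - u (n + m)%nat) + (u (n + m)%nat - u n)) by ring.
      eapply Rle_trans; [apply Rabs_triang|]. assert (A := H (n + m)%nat). simpl pow. lra. }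
  assert (K0 : 0 <= K).
  { assert (A := H 0%nat). assert (B := Rabs_pos (u 1%nat - u 0%nat)). simpl in A. lra. }
  assert (H3 : forall n m, Rabs (u (n + m)%nat - u n) <= 2 * K * (/ 2) ^ n).
  { intros n m. eapply Rle_trans; [apply H2|]. assert (A := P (n + m)%nat). nra. }
  assert (HC : ex_finite_lim_seq u).
  { apply ex_lim_seq_cauchy_corr. intros e.
    assert (Hl : is_lim_seq (fun n => 2 * K * (/ 2) ^ n) 0).
    { replace (Finite 0) with (Rbar_mult (2 * K) 0) by (simpl; f_equal; ring).
      apply is_lim_seq_scal_l, is_lim_seq_geom. rewrite Rabs_pos_eq; lra. }
    apply is_lim_seq_spec in Hl. assert (He2 : 0 < e / 2) by (assert (A := cond_pos e); lra).
    destruct (Hl (mkposreal (e / 2) He2)) as [N HN].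
    exists N. intros n m Hn Hm. specialize (HN N (le_n N)).
    assert (A := P N). rewrite Rminus_0_r, Rabs_pos_eq in HN by nra. simpl in HN.
    assert (B1 := H3 N (n - N)%nat). assert (B2 := H3 N (m - N)%nat).
    replace (N + (n - N))%nat with n in B1 by lia. replace (N + (m - N))%nat with m in B2 by lia.
    replace (u n - u m) with ((u n - u N) - (u m - u N)) by ring.
    eapply Rle_lt_trans; [apply Rabs_triang|]. rewrite Rabs_Ropp. lra. }
  destruct HC as [x Hx]. exists x. intros n.
  apply (is_lim_seq_incr_n u n) in Hx.
  assert (Hl : is_lim_seq (fun m => Rabs (u (m + n)%nat - u n)) (Rabs (x - u n))).
  { apply (is_lim_seq_abs (fun m => u (m + n)%nat - u n) (x - u n)).
    apply is_lim_seq_minus'; [assumption | apply is_lim_seq_const]. }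
  assert (Q := is_lim_seq_le _ (fun _ => 2 * K * (/ 2) ^ n) _ _
     (fun m => eq_ind _ (fun k => Rabs (u k - u n) <= _) (H3 n m) _ (Nat.add_comm n m))
     Hl (is_lim_seq_const _)).
  simpl in Q. rewrite Rabs_minus_sym. exact Q.
Qed.

(** Real and imaginary parts converge separately, and their errors, 2 K each, add up to 4 K. *)
Lemma geometric_limit (u : nat -> C) (K : R) :
  (forall n, Cmod (u (S n) - u n) <= K * (/ 2) ^ n) ->
  exists x, forall n, Cmod (u n - x) <= 4 * K * (/ 2) ^ n.
Proof.
  intros H.
  destruct (geometric_real_limit (fun n => Re (u n)) K) as [x Hx].
  { intros n. rewrite <- Re_minus. eapply Rle_trans; [apply re_le_Cmod | apply H]. }
  destruct (geometric_real_limit (fun n => Im (u n)) K) as [y Hy].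
  { intros n. rewrite <- Im_minus. eapply Rle_trans; [apply Im_le_Cmod | apply H]. }
  exists (x, y). intros n. specialize (Hx n). specialize (Hy n).
  replace (u n - (x, y))%C with (RtoC (Re (u n) - x) + Ci * RtoC (Im (u n) - y))%C.
  - eapply Rle_trans; [apply Cmod_triangle|]. rewrite Cmod_mult, Cmod_Ci, !Cmod_R. lra.
  - rewrite <- pair_RtoC. reflexivity.
Qed.

Theorem goursat (rho : R) (f : C -> C) (a b c : C) : holo rho f ->
  Cmod a < rho -> Cmod b < rho -> Cmod c < rho -> tri_int f a b c = 0.
Proof.
  intros Hf Ha Hb Hc.
  assert (Hcf := holo_contb _ _ Hf).
  set (T := (a, b, c)).
  set (rho' := Rmax (Cmod a) (Rmax (Cmod b) (Cmod c))).
  assert (Hr' : rho' < rho) by (unfold rho'; repeat apply Rmax_lub_lt; assumption).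
  set (L := Cmod (b - a) + Cmod (c - b) + Cmod (a - c)).
  assert (HT : tri_int_bound T rho' L).
  { assert (X1 := Cmod_ge_0 (b - a)). assert (X2 := Cmod_ge_0 (c - b)). assert (X3 := Cmod_ge_0 (a - c)).
    split; [repeat split|unfold L; lra]; unfold rho'.
    - apply Rmax_l.
    - eapply Rle_trans; [|apply Rmax_r]. apply Rmax_l.
    - eapply Rle_trans; [|apply Rmax_r]. apply Rmax_r. }
  set (Tn := tri_int_seq f T).
  assert (Hn : forall n, tri_int_bound (Tn n) rho' (L * (/ 2) ^ n)).
  { induction n as [|n IH]; [unfold Tn; simpl; rewrite Rmult_1_r; assumption|].
    apply (tri_int_next_bound f) in IH. destruct IH as [IH _].
    replace (L * (/ 2) ^ S n) with (L * (/ 2) ^ n / 2) by (simpl; field). exact IH. }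
  assert (Hbig : forall n, Cmod (tri_int f a b c) * ((/ 2) ^ n * (/ 2) ^ n) <= Cmod (tri3 f (Tn n))).
  { induction n as [|n IH]; [unfold Tn, tri3; simpl; lra|].
    assert (A := tri_int_next_large f rho' rho _ (Tn n) Hcf Hr' (Hn n)).
    change (Tn (S n)) with (tri_int_next f (Tn n)). simpl pow. lra. }
  destruct (geometric_limit (fun n => fst (fst (Tn n))) L) as [z Hz].
  { intros n. exact (proj2 (tri_int_next_bound f _ _ _ (Hn n))). }
  assert (L0 : 0 <= L).
  { assert (X1 := Cmod_ge_0 (b - a)). assert (X2 := Cmod_ge_0 (c - b)). assert (X3 := Cmod_ge_0 (a - c)).
    unfold L; lra. }
  assert (Hpow : forall e, 0 < e -> exists n, (/ 2) ^ n < e).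
  { intros e He. destruct (pow_lt_1_zero (/ 2) ltac:(rewrite Rabs_pos_eq; lra) e He) as [N HN].
    exists N. specialize (HN N (le_n N)). rewrite Rabs_pos_eq in HN; [assumption|].
    apply pow_le. lra. }
  assert (Hzr : Cmod z < rho).
  { destruct (Hpow ((rho - rho') / (4 * L + 1))) as [n Hp].
    { apply Rdiv_lt_0_compat; lra. }
    specialize (Hz n). specialize (Hn n). destruct (Tn n) as [[an bn] cn].
    destruct Hn as [[Han _] _]. simpl in Hz.
    assert (A := Cmod_triangle_sub z an). rewrite Cmod_minus_sym in A.
    assert (4 * L * (/ 2) ^ n < rho - rho').
    { assert (0 < (/ 2) ^ n) by (apply pow_lt; lra).
      apply Rlt_div_r in Hp; [|lra]. nra. }
    lra. }
  destruct (Hf z Hzr) as [l Hl].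
  apply Cmod_eq_0. apply Rle_antisym; [|apply Cmod_ge_0].
  apply le_epsilon. intros e He.
  (* Points of the n-th triangle lie within 5 L h of z: 4 L h from [geometric_limit] plus L h across
     the triangle. Three sides of length at most L h then give 15 L L. *)
  set (e' := e / (15 * L * L + 1)).
  assert (He' : 0 < e') by (apply Rdiv_lt_0_compat; nra).
  destruct (Hl e' He') as [d [Hd Hdd]].
  destruct (Hpow (d / (5 * L + 1))) as [n Hp].
  { apply Rdiv_lt_0_compat; lra. }
  specialize (Hz n). specialize (Hn n). specialize (Hbig n).
  set (h := (/ 2) ^ n) in *.
  assert (Hh : 0 < h) by (apply pow_lt; lra).
  assert (Hh5 : 5 * L * h < d).
  { apply Rlt_div_r in Hp; [|lra]. nra. }
  destruct (Tn n) as [[an bn] cn]. destruct Hn as [[Ban [Bbn Bcn]] [S1 [S2 S3]]].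
  unfold tri3 in Hbig. simpl in Hbig, Hz.
  (* A + l w is the first-order Taylor polynomial of f at z; its integral over a triangle is zero,
     so only the remainder counts. *)
  set (A := (f z - l * z)%C).
  assert (Haff : contb rho (fun w => A + l * w)%C).
  { intros w _. apply contD_plus; [apply contD_const|]. apply contD_mult; [apply contD_const | apply contD_id]. }
  assert (Hdiff : contb rho (fun w => f w - (A + l * w))%C).
  { intros w Hw. apply contD_minus; auto. }
  assert (Hpt : forall u v t, 0 <= t <= 1 -> Cmod (u - an) <= L * h -> Cmod (v - an) <= L * h ->
     Cmod (u + RtoC t * (v - u) - z) <= 5 * L * h).
  { intros u v t Ht Hu Hv.
    assert (B : Cmod ((u - an) + RtoC t * ((v - an) - (u - an))) <= L * h)
      by (apply seg_int_point_le; assumption).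
    replace (u + RtoC t * (v - u) - z)%C
      with (((u - an) + RtoC t * ((v - an) - (u - an))) + (an - z))%C by ring.
    eapply Rle_trans; [apply Cmod_triangle|]. lra. }
  assert (Hseg : forall u v, Cmod u <= rho' -> Cmod v <= rho' -> Cmod (v - u) <= L * h ->
    Cmod (u - an) <= L * h -> Cmod (v - an) <= L * h ->
    Cmod (seg_int (fun w => f w - (A + l * w))%C u v) <= e' * (5 * L * h) * (L * h)).
  { intros u v Hu Hv Huv Hu' Hv'. eapply Rle_trans.
    - apply (seg_int_norm _ rho u v (e' * (5 * L * h))); [assumption | lra | lra |].
      intros t Ht. specialize (Hpt u v t Ht Hu' Hv').
      set (w := (u + RtoC t * (v - u))%C) in *.
      replace (f w - (A + l * w))%C with (f w - f z - l * (w - z))%C by (unfold A; ring).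
      eapply Rle_trans; [apply Hdd; [exact I | lra]|].
      apply Rmult_le_compat_l; lra.
    - apply Rmult_le_compat_l; [|assumption]. assert (0 <= L * h) by nra. nra. }
  assert (Z0 : Cmod (an - an) <= L * h).
  { replace (an - an)%C with (RtoC 0) by ring. rewrite Cmod_0. nra. }
  assert (E : tri_int f an bn cn = tri_int (fun w => f w - (A + l * w))%C an bn cn).
  { transitivity (tri_int f an bn cn - tri_int (fun w => A + l * w)%C an bn cn)%C.
    - rewrite tri_int_affine. ring.
    - unfold tri_int. rewrite !(seg_int_minus f (fun w => A + l * w)%C rho) by (try assumption; lra). ring. }
  rewrite E in Hbig. unfold tri_int in Hbig at 2.
  assert (N3 : Cmod (cn - an) <= L * h) by (rewrite Cmod_minus_sym; assumption).
  assert (K1 := Hseg an bn Ban Bbn S1 Z0 S1).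
  assert (K2 := Hseg bn cn Bbn Bcn S2 S1 N3).
  assert (K3 := Hseg cn an Bcn Ban S3 N3 Z0).
  assert (T1 := Cmod_triangle (seg_int (fun w => f w - (A + l * w))%C an bn + seg_int (fun w => f w - (A + l * w))%C bn cn)
     (seg_int (fun w => f w - (A + l * w))%C cn an)).
  assert (T2 := Cmod_triangle (seg_int (fun w => f w - (A + l * w))%C an bn) (seg_int (fun w => f w - (A + l * w))%C bn cn)).
  assert (Q : Cmod (tri_int f a b c) * (h * h) <= 15 * L * L * e' * (h * h)) by lra.
  assert (Hhh : 0 < h * h) by nra.
  apply Rmult_le_reg_r in Q; [|assumption].
  assert (15 * L * L * e' <= e).
  { assert (E2 : e' * (15 * L * L + 1) = e) by (unfold e'; field; nra). nra. }
  lra.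
Qed.

(** Goursat on the triangle 0, z, w turns the increment of [seg_int f 0] into the integral over the
    segment from z to w, where f is close to f z. *)
Theorem holo_primitive (rho : R) (f : C -> C) : holo rho f ->
  forall z, Cmod z < rho -> cderiv (seg_int f 0) z (f z).
Proof.
  intros Hf z Hz e He.
  assert (Hcf := holo_contb _ _ Hf).
  destruct (Hcf z Hz e He) as [d [Hd H]].
  exists (Rmin d (rho - Cmod z)). split; [apply Rmin_pos; lra|].
  intros w _ Hw.
  assert (Hw1 := Rlt_le_trans _ _ _ Hw (Rmin_l _ _)).
  assert (Hw2 := Rlt_le_trans _ _ _ Hw (Rmin_r _ _)).
  assert (Hwr : Cmod w < rho) by (assert (A := Cmod_triangle_sub w z); lra).
  assert (H0 : Cmod 0 < rho) by (rewrite Cmod_0; assert (A := Cmod_ge_0 z); lra).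
  assert (G := goursat rho f 0 z w Hf H0 Hz Hwr). unfold tri_int in G.
  rewrite (seg_int_rev f rho 0 w) in G by assumption.
  assert (E : (seg_int f 0 w - seg_int f 0 z)%C = seg_int f z w).
  { replace (seg_int f 0 w) with (seg_int f 0 z + seg_int f z w - (seg_int f 0 z + seg_int f z w + - seg_int f 0 w))%C by ring.
    rewrite G. ring. }
  rewrite E.
  assert (Hk : contb rho (fun _ => f z)) by (intros ? _; apply contD_const).
  replace (f z * (w - z))%C with (seg_int (fun _ => f z) z w).
  2:{ unfold seg_int. rewrite Cint_const. rewrite Rminus_0_r. ring. }
  rewrite <- (seg_int_minus f (fun _ => f z) rho) by assumption.
  apply (seg_int_norm _ rho); try assumption.
  - intros u Hu. apply contD_minus; auto.
  - intros t Ht. left. apply H; [exact I|].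
    eapply Rle_lt_trans; [apply seg_int_point_dist; assumption | assumption].
Qed.

(** * Integrals over circles *)

(** Heine-Cantor around a compact curve. The nearby point w may leave the curve, because
    differentiation under the integral moves the curve itself. *)
Lemma uniform_near_curve (rho : R) (f : C -> C) (g : R -> C) (a b : R) :
  contb rho f -> (forall t, a <= t <= b -> rcont g t) -> (forall t, a <= t <= b -> Cmod (g t) < rho) ->
  forall eps, 0 < eps -> exists d, 0 < d /\ forall t w, a <= t <= b -> Cmod (w - g t) < d ->
    Cmod w < rho /\ Cmod (f w - f (g t)) <= eps.
Proof.
  intros Hf Hg Hr e He.
  assert (H : forall t, exists d : posreal, a <= t <= b -> exists d1, d <= d1 / 2 /\ d1 <= rho - Cmod (g t) /\
     (forall w, Cmod (w - g t) < d1 -> Cmod (f w - f (g t)) < e / 2) /\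
     (forall s, Rabs (s - t) < d -> Cmod (g s - g t) < d1 / 2)).
  (* [compactness_value_1d] takes a total radius function; outside [a, b] it gets the default value
     1. *)
  { intros t. destruct (classic (a <= t <= b)) as [Ht|Ht]; [|exists (mkposreal 1 Rlt_0_1); tauto].
    destruct (Hf (g t) (Hr t Ht) (e / 2) ltac:(lra)) as [d0 [Hd0 H0]].
    set (d1 := Rmin d0 (rho - Cmod (g t))).
    assert (Hd1 : 0 < d1) by (apply Rmin_pos; [assumption | specialize (Hr t Ht); lra]).
    destruct (rcont_elim _ _ (Hg t Ht) (d1 / 2) ltac:(lra)) as [d2 [Hd2 H2]].
    assert (Hd : 0 < Rmin d2 (d1 / 2)) by (apply Rmin_pos; lra).
    exists (mkposreal _ Hd). intros _. exists d1. simpl. repeat split.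
    - apply Rmin_r.
    - apply Rmin_r.
    - intros w Hw. apply H0; [exact I|]. eapply Rlt_le_trans; [apply Hw | apply Rmin_l].
    - intros s Hs. apply H2. eapply Rlt_le_trans; [apply Hs | apply Rmin_l]. }
  set (delta := fun t => proj1_sig (constructive_indefinite_description _ (H t))).
  assert (Hdelta := fun t => proj2_sig (constructive_indefinite_description _ (H t))).
  fold (delta) in Hdelta.
  destruct (compactness_value_1d a b delta) as [d Hd].
  exists d. split; [apply cond_pos|].
  intros x w Hx Hw. apply NNPP. intros Hn. apply (Hd x Hx). intros [t [Ht [Hxt Hdt]]]. apply Hn.
  destruct (Hdelta t Ht) as [d1 [K1 [K2 [K3 K4]]]].
  change (proj1_sig (constructive_indefinite_description _ (H t))) with (delta t) in K1, K4.
  specialize (K4 x Hxt).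
  assert (Hwt : Cmod (w - g t) < d1).
  { replace (w - g t)%C with ((w - g x) + (g x - g t))%C by ring.
    eapply Rle_lt_trans; [apply Cmod_triangle|]. lra. }
  split.
  - assert (A := Cmod_triangle_sub w (g t)). lra.
  - assert (B1 := K3 w Hwt).
    assert (Dp := cond_pos (delta t)). assert (B2 := K3 (g x) ltac:(lra)).
    replace (f w - f (g x))%C with ((f w - f (g t)) - (f (g x) - f (g t)))%C by ring.
    eapply Rle_trans; [apply Cmod_triangle_minus|]. lra.
Qed.

Lemma rcont_bounded (g : R -> C) (a b : R) : a <= b -> (forall t, a <= t <= b -> rcont g t) ->
  exists M, 0 <= M /\ forall t, a <= t <= b -> Cmod (g t) <= M.
Proof.
  intros Hab Hg.
  destruct (continuity_ab_maj (fun t => Cmod (g t)) a b Hab) as [m [Hm _]].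
  - intros t Ht. apply continuity_pt_filterlim. apply rcont_Cmod. auto.
  - exists (Cmod (g m)). split; [apply Cmod_ge_0 | exact Hm].
Qed.

Lemma increment_estimate (rho : R) (F f : C -> C) (y y' : C) (e : R) : contb rho f ->
  (forall z, Cmod z < rho -> cderiv F z (f z)) -> Cmod y < rho -> Cmod y' < rho ->
  (forall t, 0 <= t <= 1 -> Cmod (f (y + RtoC t * (y' - y)) - f y)%C <= e) ->
  Cmod (F y' - F y - f y * (y' - y)) <= e * Cmod (y' - y).
Proof.
  intros Hf HF Hy Hy' H.
  rewrite <- (seg_int_FTC F f rho) by assumption.
  replace (f y * (y' - y))%C with (seg_int (fun _ => f y) y y').
  2:{ unfold seg_int. rewrite Cint_const, Rminus_0_r. ring. }
  assert (Hk : contb rho (fun _ => f y)) by (intros ? _; apply contD_const).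
  rewrite <- (seg_int_minus f (fun _ => f y) rho) by assumption.
  apply (seg_int_norm _ rho); try assumption.
  intros z Hz. apply contD_minus; auto.
Qed.

Lemma rcont_affine (al be : R -> C) (z : C) (t : R) : rcont al t -> rcont be t ->
  rcont (fun t => al t + z * be t)%C t.
Proof.
  intros. apply rcont_plus; [assumption|]. apply rcont_mult; [apply rcont_const | assumption].
Qed.

Lemma affine_close (al be : R -> C) (a b B d : R) (z0 z : C) (t : R) :
  0 <= B -> (forall t, a <= t <= b -> Cmod (be t) <= B) -> 0 < d -> Cmod (z - z0) < d / (B + 1) ->
  a <= t <= b -> Cmod ((al t + z * be t) - (al t + z0 * be t)) < d.
Proof.
  intros HB Hb Hd Hz Ht.
  replace ((al t + z * be t) - (al t + z0 * be t))%C with ((z - z0) * be t)%C by ring.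
  rewrite Cmod_mult. specialize (Hb t Ht).
  apply Rlt_div_r in Hz; [|lra].
  assert (A := Cmod_ge_0 (z - z0)). assert (A' := Cmod_ge_0 (be t)). nra.
Qed.

(** The affine family [al t + z * be t] covers all later uses: with [al] constant and [be = cis] the
    parameter is a complex radius, with [be = 1] a centre, and with [be = RtoC] an endpoint of a
    segment. *)
Lemma Cint_param_cont (rho : R) (f : C -> C) (al be om : R -> C) (a b : R) (z0 : C) : a <= b ->
  contb rho f -> (forall t, a <= t <= b -> rcont al t) -> (forall t, a <= t <= b -> rcont be t) ->
  (forall t, a <= t <= b -> rcont om t) ->
  (forall t, a <= t <= b -> Cmod (al t + z0 * be t) < rho) ->
  ccont (fun z => Cint (fun t => f (al t + z * be t) * om t)%C a b) z0.
Proof.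
  intros Hab Hf Ha Hb Ho Hr e He.
  destruct (rcont_bounded be a b Hab Hb) as [B [HB0 HB]].
  destruct (rcont_bounded om a b Hab Ho) as [W [HW0 HW]].
  set (e' := e / (2 * (W * (b - a) + 1))).
  assert (HW1 : 0 <= W * (b - a)) by (apply Rmult_le_pos; lra).
  assert (He' : 0 < e') by (apply Rdiv_lt_0_compat; lra).
  destruct (uniform_near_curve rho f (fun t => al t + z0 * be t)%C a b Hf
     (fun t Ht => rcont_affine al be z0 t (Ha t Ht) (Hb t Ht)) Hr e' He') as [d [Hd H]].
  exists (d / (B + 1)). split; [apply Rdiv_lt_0_compat; lra|].
  intros z _ Hz.
  assert (Hc := fun t Ht => affine_close al be a b B d z0 z t HB0 HB Hd Hz Ht).
  assert (Q : forall w, (forall t, a <= t <= b -> Cmod (al t + w * be t) < rho) ->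
     forall t, a <= t <= b -> rcont (fun t => f (al t + w * be t) * om t)%C t).
  { intros w Hw t Ht. apply rcont_mult; [|auto].
    apply (rcont_comp f (fun t => al t + w * be t)%C); [apply Hf; auto|].
    apply rcont_affine; auto. }
  assert (Hr' : forall t, a <= t <= b -> Cmod (al t + z * be t) < rho).
  { intros t Ht. apply (H t _ Ht (Hc t Ht)). }
  rewrite <- Cint_minus by auto.
  apply Rle_lt_trans with (e' * W * (b - a)).
  - apply Cint_norm_const; [assumption| |].
    + intros t Ht. apply rcont_minus; auto.
    + intros t Ht.
      replace (f (al t + z * be t) * om t - f (al t + z0 * be t) * om t)%C
        with ((f (al t + z * be t) - f (al t + z0 * be t)) * om t)%C by ring.
      rewrite Cmod_mult. apply Rmult_le_compat; try apply Cmod_ge_0; [|auto].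
      apply (H t _ Ht (Hc t Ht)).
  - assert (E : e' * (2 * (W * (b - a) + 1)) = e) by (unfold e'; field; lra). nra.
Qed.

Lemma Cint_param_deriv (rho : R) (F f : C -> C) (al be om : R -> C) (a b : R) (z0 : C) : a <= b ->
  contb rho f -> (forall z, Cmod z < rho -> cderiv F z (f z)) ->
  (forall t, a <= t <= b -> rcont al t) -> (forall t, a <= t <= b -> rcont be t) ->
  (forall t, a <= t <= b -> rcont om t) ->
  (forall t, a <= t <= b -> Cmod (al t + z0 * be t) < rho) ->
  cderiv (fun z => Cint (fun t => F (al t + z * be t) * om t)%C a b) z0
    (Cint (fun t => f (al t + z0 * be t) * (be t * om t))%C a b).
Proof.
  intros Hab Hf HF Ha Hb Ho Hr e He.
  destruct (rcont_bounded be a b Hab Hb) as [B [HB0 HB]].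
  destruct (rcont_bounded om a b Hab Ho) as [W [HW0 HW]].
  assert (HBW : 0 <= B * W * (b - a)) by (apply Rmult_le_pos; [nra | lra]).
  set (e' := e / (B * W * (b - a) + 1)).
  assert (He' : 0 < e') by (apply Rdiv_lt_0_compat; lra).
  destruct (uniform_near_curve rho f (fun t => al t + z0 * be t)%C a b Hf
     (fun t Ht => rcont_affine al be z0 t (Ha t Ht) (Hb t Ht)) Hr e' He') as [d [Hd H]].
  exists (d / (B + 1)). split; [apply Rdiv_lt_0_compat; lra|].
  intros z _ Hz.
  assert (Hc := fun t Ht => affine_close al be a b B d z0 z t HB0 HB Hd Hz Ht).
  assert (HFc : contb rho F) by (intros w Hw; eapply derivD_contD, HF; assumption).
  assert (Q : forall w, (forall t, a <= t <= b -> Cmod (al t + w * be t) < rho) ->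
     forall t, a <= t <= b -> rcont (fun t => F (al t + w * be t) * om t)%C t).
  { intros w Hw t Ht. apply rcont_mult; [|auto].
    apply (rcont_comp F (fun t => al t + w * be t)%C); [apply HFc; auto|].
    apply rcont_affine; auto. }
  assert (Q' : forall t, a <= t <= b -> rcont (fun t => f (al t + z0 * be t) * (be t * om t))%C t).
  { intros t Ht. apply rcont_mult; [|apply rcont_mult; auto].
    apply (rcont_comp f (fun t => al t + z0 * be t)%C); [apply Hf; auto|].
    apply rcont_affine; auto. }
  assert (Hr' : forall t, a <= t <= b -> Cmod (al t + z * be t) < rho).
  { intros t Ht. apply (H t _ Ht (Hc t Ht)). }
  rewrite (Cmult_comm (Cint _ _ _)), <- Cint_scal by auto.
  rewrite <- !Cint_minus; try auto.
  2:{ intros t Ht. apply rcont_minus; auto. }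
  2:{ intros t Ht. apply rcont_mult; [apply rcont_const | auto]. }
  apply Rle_trans with (e' * (B * Cmod (z - z0)) * W * (b - a)).
  - apply Cint_norm_const; [assumption| |].
    + intros t Ht. apply rcont_minus; [apply rcont_minus; auto|].
      apply rcont_mult; [apply rcont_const | auto].
    + intros t Ht.
      set (y := (al t + z0 * be t)%C). set (y' := (al t + z * be t)%C).
      replace (F y' * om t - F y * om t - (z - z0) * (f y * (be t * om t)))%C
        with ((F y' - F y - f y * (y' - y)) * om t)%C by (unfold y, y'; ring).
      rewrite Cmod_mult. apply Rmult_le_compat; try apply Cmod_ge_0; [|auto].
      eapply Rle_trans.
      * apply (increment_estimate rho F f y y' e'); [assumption | assumption | apply Hr; assumption | apply Hr'; assumption |].
        intros s Hs. apply (H t _ Ht).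
        eapply Rle_lt_trans; [apply seg_int_point_dist; assumption | apply Hc; assumption].
      * apply Rmult_le_compat_l; [lra|].
        replace (y' - y)%C with (be t * (z - z0))%C by (unfold y, y'; ring).
        rewrite Cmod_mult. apply Rmult_le_compat_r; [apply Cmod_ge_0 | auto].
  - assert (E : e' * (B * W * (b - a) + 1) = e) by (unfold e'; field; lra).
    assert (A := Cmod_ge_0 (z - z0)). rewrite <- E.
    apply Rle_trans with (e' * (B * W * (b - a)) * Cmod (z - z0)); [right; ring|].
    apply Rmult_le_compat_r; [assumption|]. apply Rmult_le_compat_l; lra.
Qed.

Lemma rderiv_zero_const (G : R -> C) (a b : R) : a <= b ->
  (forall t, a <= t <= b -> rderiv G t 0) -> G b = G a.
Proof.
  intros Hab H.
  assert (E := Cint_FTC G (fun _ => RtoC 0) a b Hab H (fun t _ => rcont_const 0 t)).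
  rewrite Cint_const in E.
  replace (G b) with (G a + (G b - G a))%C by ring. rewrite <- E. ring.
Qed.

Lemma circle_point_lt (c z : C) (rho t : R) : Cmod c + Cmod z < rho -> Cmod (c + z * cis t) < rho.
Proof.
  intros H. eapply Rle_lt_trans; [apply Cmod_triangle|]. rewrite Cmod_mult, Cmod_cis. lra.
Qed.

Lemma rderiv_circle (c z : C) (t : R) : rderiv (fun t => c + z * cis t)%C t (z * (Ci * cis t)).
Proof.
  eapply rderiv_eq; [apply (rderiv_plus (fun _ => c)); [apply rderiv_const | apply rderiv_scal, rderiv_cis]|].
  ring.
Qed.

Lemma rcont_circle (c z : C) (t : R) : rcont (fun t => c + z * cis t)%C t.
Proof. eapply rcont_rderiv, rderiv_circle. Qed.

Lemma twoPI_pos : 0 <= 2 * PI.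
Proof. assert (H := PI_RGT_0). lra. Qed.

Lemma rderiv_cis_conj (t : R) : rderiv (fun s => Cconj (cis s)) t (- Ci * Cconj (cis t)).
Proof.
  apply (rderiv_ext (fun s => RtoC (cos s) + (- Ci) * RtoC (sin s))%C).
  { intros s. unfold cis, Cconj, Cplus, Cmult, Copp, Ci, RtoC; simpl. f_equal; ring. }
  eapply rderiv_eq.
  - apply (rderiv_plus (fun s => RtoC (cos s)) (fun s => - Ci * RtoC (sin s))%C).
    + apply rderiv_of_real, is_derive_cos.
    + apply (rderiv_scal (fun s => RtoC (sin s))). apply rderiv_of_real, is_derive_sin.
  - unfold cis, Cconj, Cplus, Cmult, Copp, Ci, RtoC; simpl. f_equal; ring.
Qed.

Lemma Ci_sqr : (Ci * Ci)%C = RtoC (-1).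
Proof. unfold Cmult, Ci, RtoC; simpl. f_equal; ring. Qed.

(* Integration by parts in the angle; combined with differentiation in the radius it
   makes [Cint (F (c + z cis t) / cis t) / z] independent of [z]. *)
Lemma circle_by_parts (rho : R) (F f : C -> C) (c z : C) : contb rho f ->
  (forall z, Cmod z < rho -> cderiv F z (f z)) -> Cmod c + Cmod z < rho ->
  Cint (fun t => F (c + z * cis t) * Cconj (cis t))%C 0 (2 * PI) =
  (z * Cint (fun t => f (c + z * cis t))%C 0 (2 * PI))%C.
Proof.
  intros Hf HF Hz.
  assert (HP := twoPI_pos).
  assert (Hin := fun t => circle_point_lt c z rho t Hz).
  assert (HFc : contb rho F) by (intros w Hw; eapply derivD_contD, HF; assumption).
  assert (Q1 : forall t, rcont (fun t => F (c + z * cis t) * Cconj (cis t))%C t).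
  { intros t. apply rcont_mult; [|apply rcont_conj, rcont_cis].
    apply (rcont_comp F); [auto | apply rcont_circle]. }
  assert (Q2 : forall t, rcont (fun t => f (c + z * cis t))%C t).
  { intros t. apply (rcont_comp f); [auto | apply rcont_circle]. }
  assert (E := Cint_FTC (fun t => F (c + z * cis t) * (Ci * Cconj (cis t)))%C
    (fun t => F (c + z * cis t) * Cconj (cis t) - z * f (c + z * cis t))%C 0 (2 * PI) HP).
  rewrite Cint_minus, Cint_scal in E; try assumption; try auto.
  2:{ intros. apply rcont_mult; [apply rcont_const | auto]. }
  rewrite cis_0, cis_2PI in E.
  match type of E with _ -> _ -> ?X = ?Y => assert (E' : X = Y) end.
  { apply E.
    - intros t _. eapply rderiv_eq.
      + apply (rderiv_mult (fun t => F (c + z * cis t)%C) (fun t => Ci * Cconj (cis t))%C).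
        * apply (rderiv_comp F); [apply HF; auto | apply rderiv_circle].
        * apply (rderiv_scal (fun t => Cconj (cis t))), rderiv_cis_conj.
      + cbv beta.
        replace (f (c + z * cis t) * (z * (Ci * cis t)) * (Ci * Cconj (cis t)) +
          F (c + z * cis t) * (Ci * (- Ci * Cconj (cis t))))%C with
         (f (c + z * cis t) * z * (Ci * Ci) * (cis t * Cconj (cis t)) -
          F (c + z * cis t) * (Ci * Ci) * Cconj (cis t))%C by ring.
        rewrite cis_conj, Ci_sqr. ring.
    - intros t _. apply rcont_minus; [auto|]. apply rcont_mult; [apply rcont_const | auto]. }
  match type of E' with (?X - ?Y)%C = _ => replace X with (Y + (X - Y))%C by ring end.
  rewrite E'. ring.
Qed.

(** The radius is varied in an integral of the primitive F, whose derivative f is known to be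
    continuous. Continuity of f' itself comes only with [holo_Cder], which rests on this theorem. *)
Theorem mean_value (rho : R) (f : C -> C) (c : C) (r : R) : holo rho f -> 0 <= r -> Cmod c + r < rho ->
  Cint (fun t => f (c + RtoC r * cis t))%C 0 (2 * PI) = (RtoC (2 * PI) * f c)%C.
Proof.
  intros Hf Hr Hcr.
  assert (HP := twoPI_pos).
  assert (Hcf := holo_contb _ _ Hf).
  assert (HF := holo_primitive rho f Hf). set (F := seg_int f 0) in *.
  set (M := fun z => Cint (fun t => f (c + z * cis t))%C 0 (2 * PI)).
  set (A := fun z => Cint (fun t => F (c + z * cis t) * Cconj (cis t))%C 0 (2 * PI)).
  assert (M0 : M 0 = (RtoC (2 * PI) * f c)%C).
  { unfold M. rewrite (Cint_ext _ (fun _ => f c)); [|assumption|].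
    - rewrite Cint_const, Rminus_0_r. reflexivity.
    - intros. f_equal. ring. }
  assert (HA : forall z, Cmod c + Cmod z < rho -> A z = (z * M z)%C).
  { intros z Hz. apply (circle_by_parts rho); assumption. }
  assert (HA' : forall z, Cmod c + Cmod z < rho -> cderiv A z (M z)).
  { intros z Hz. eapply derivD_eq.
    - apply (Cint_param_deriv rho F f (fun _ => c) cis (fun t => Cconj (cis t)) 0 (2 * PI) z); try assumption.
      + intros; apply rcont_const.
      + intros; apply rcont_cis.
      + intros; apply rcont_conj, rcont_cis.
      + intros; apply circle_point_lt; assumption.
    - apply Cint_ext; [assumption|]. intros t _. rewrite cis_conj. ring. }
  set (k := (RtoC (2 * PI) * f c)%C) in *.
  destruct (Rle_lt_or_eq_dec 0 r Hr) as [Hr0|<-]; [|exact M0].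
  (* [A s / s] is constant on (0, r] and tends to [A'(0) = M 0]. *)
  assert (Hconst : forall s, 0 < s <= r -> M (RtoC s) = M (RtoC r)).
  { intros s Hs.
    assert (Hin : forall x, s <= x <= r -> Cmod c + Cmod (RtoC x) < rho)
      by (intros; rewrite Cmod_RtoC_nonneg; lra).
    assert (Hne : forall x, s <= x -> RtoC x <> 0) by (intros x Hx E; injection E; lra).
    assert (E : forall x, s <= x <= r -> M (RtoC x) = (A (RtoC x) * / RtoC x)%C).
    { intros x Hx. rewrite HA by auto. field. apply Hne; lra. }
    rewrite !E by lra. symmetry.
    apply (rderiv_zero_const (fun x => A (RtoC x) * / RtoC x)%C s r); [lra|].
    intros x Hx. eapply rderiv_eq.
    - apply (rderiv_mult (fun x => A (RtoC x)) (fun x => / RtoC x)%C).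
      + apply (rderiv_comp A RtoC); [apply HA'; auto | apply rderiv_RtoC].
      + apply (rderiv_comp Cinv RtoC); [apply derivD_inv_id, Hne; lra | apply rderiv_RtoC].
    - cbv beta. rewrite HA by auto. field. apply Hne; lra. }
  change (M (RtoC r) = k). apply Ceq_minus, Cmod_eq_0. apply Rle_antisym; [|apply Cmod_ge_0].
  apply le_epsilon. intros e He. rewrite Rplus_0_l.
  assert (HB := HA' 0 ltac:(rewrite Cmod_0; lra)). rewrite M0 in HB.
  destruct (HB e He) as [d [Hd H]].
  set (s := Rmin (d / 2) r).
  assert (Hs0 : 0 < s) by (apply Rmin_pos; lra).
  assert (Hs1 : s <= r) by apply Rmin_r.
  assert (Hs2 : s <= d / 2) by apply Rmin_l.
  rewrite <- (Hconst s) by lra.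
  specialize (H (RtoC s) I).
  replace (RtoC s - 0)%C with (RtoC s) in H by ring. rewrite Cmod_RtoC_nonneg in H by lra.
  specialize (H ltac:(lra)).
  rewrite !HA in H by (rewrite ?Cmod_0, ?Cmod_RtoC_nonneg; lra).
  replace (RtoC s * M (RtoC s) - 0 * M 0 - k * RtoC s)%C with ((M (RtoC s) - k) * RtoC s)%C in H by ring.
  rewrite Cmod_mult, Cmod_RtoC_nonneg in H by lra.
  apply Rmult_le_reg_r in H; assumption.
Qed.

Lemma RtoC_neq0 (x : R) : x <> 0 -> RtoC x <> 0.
Proof. intros H E. injection E. assumption. Qed.

Lemma ball_shrink (c : C) (rho r : R) (w : C) : Cmod c + r < rho -> Cmod (w - c) < rho - r - Cmod c ->
  Cmod w + r < rho.
Proof. intros H Hw. assert (A := Cmod_triangle_sub w c). lra. Qed.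

(** By parts, the mean value formula expresses f w through F on the circle about w. The centre then
    appears only inside F, so the formula can be differentiated in w under the integral. *)
Theorem deriv_center (rho : R) (f : C -> C) (c l : C) (r : R) : holo rho f -> 0 < r -> Cmod c + r < rho ->
  cderiv f c l ->
  Cint (fun t => f (c + RtoC r * cis t) * Cconj (cis t))%C 0 (2 * PI) = (RtoC (2 * PI * r) * l)%C.
Proof.
  intros Hf Hr Hcr Hl.
  assert (HP := PI_RGT_0).
  assert (Hcf := holo_contb _ _ Hf).
  assert (HF := holo_primitive rho f Hf). set (F := seg_int f 0) in *.
  assert (Hne : RtoC (2 * PI * r) <> 0).
  { apply RtoC_neq0. assert (0 < PI * r) by nra. lra. }
  assert (E : forall w, Cmod w + r < rho ->
    f w = (/ RtoC (2 * PI * r) * Cint (fun t => F (RtoC r * cis t + w * 1) * Cconj (cis t))%C 0 (2 * PI))%C).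
  { intros w Hw.
    assert (B := circle_by_parts rho F f w (RtoC r) Hcf HF ltac:(rewrite Cmod_RtoC_nonneg; lra)).
    rewrite (mean_value rho f w r) in B by (assumption || lra).
    rewrite (Cint_ext _ (fun t => F (w + RtoC r * cis t) * Cconj (cis t))%C); [|lra|].
    - rewrite B. rewrite !RtoC_mult in *. field.
      split; apply RtoC_neq0; lra.
    - intros t _. f_equal. f_equal. ring. }
  assert (HD := derivD_scal _ _ (/ RtoC (2 * PI * r))%C _ _
    (Cint_param_deriv rho F f (fun t => RtoC r * cis t)%C (fun _ => RtoC 1) (fun t => Cconj (cis t))
      0 (2 * PI) c ltac:(lra) Hcf HF
      (fun t _ => rcont_mult _ _ t (rcont_const _ t) (rcont_cis t)) (fun t _ => rcont_const _ t)
      (fun t _ => rcont_conj _ t (rcont_cis t))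
      ltac:(intros t _; cbv beta; replace (RtoC r * cis t + c * 1)%C with (c + RtoC r * cis t)%C by ring;
            apply circle_point_lt; rewrite Cmod_RtoC_nonneg; lra))).
  cbv beta in HD.
  apply (derivD_loc _ _ f c _ (rho - r - Cmod c)) in HD; [|lra|exact I|].
  2:{ intros w _ Hw. symmetry. apply E. apply (ball_shrink c); assumption. }
  rewrite (cderiv_unique _ _ _ _ Hl HD).
  rewrite (Cint_ext (fun t => f (RtoC r * cis t + c * 1) * (1 * Cconj (cis t)))%C
    (fun t => f (c + RtoC r * cis t) * Cconj (cis t))%C); [|lra|].
  - field. assumption.
  - intros t _. rewrite Cmult_1_l. do 2 f_equal. ring.
Qed.

(** * The derivative as a holomorphic function, and difference quotients *)

Definition Cder (f : C -> C) (z : C) : C := epsilon (inhabits (RtoC 0)) (fun l => cderiv f z l).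

Lemma Cder_correct (f : C -> C) (z : C) : (exists l, cderiv f z l) -> cderiv f z (Cder f z).
Proof. intros H. exact (epsilon_spec _ _ H). Qed.

Lemma Cder_eq (f : C -> C) (z l : C) : cderiv f z l -> Cder f z = l.
Proof. intros H. apply (cderiv_unique f z); [apply Cder_correct; exists l|]; assumption. Qed.

(** Two passes over the same integral formula for f': it first yields continuity of f', and this is
    the hypothesis under which [Cint_param_deriv] differentiates the formula once more. *)
Theorem holo_Cder (rho : R) (f : C -> C) : holo rho f -> holo rho (Cder f).
Proof.
  intros Hf.
  assert (HP := PI_RGT_0).
  assert (Hcf := holo_contb _ _ Hf).
  assert (HD : forall z, Cmod z < rho -> cderiv f z (Cder f z)) by (intros; apply Cder_correct; auto).
  set (I0 := fun r z => Cint (fun t => f (RtoC r * cis t + z * 1) * Cconj (cis t))%C 0 (2 * PI)).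
  assert (E : forall r z, 0 < r -> Cmod z + r < rho -> Cder f z = (/ RtoC (2 * PI * r) * I0 r z)%C).
  { intros r z Hr Hz. unfold I0.
    rewrite (Cint_ext _ (fun t => f (z + RtoC r * cis t) * Cconj (cis t))%C); [|lra|].
    - rewrite (deriv_center rho f z (Cder f z) r) by (try assumption; apply HD; lra).
      field. apply RtoC_neq0. assert (0 < PI * r) by nra. lra.
    - intros t _. f_equal. f_equal. ring. }
  assert (Hin : forall r z, 0 < r -> Cmod z + r < rho -> forall t, Cmod (RtoC r * cis t + z * 1) < rho).
  { intros r z Hr Hz t. replace (RtoC r * cis t + z * 1)%C with (z + RtoC r * cis t)%C by ring.
    apply circle_point_lt. rewrite Cmod_RtoC_nonneg; lra. }
  assert (Hc : contb rho (Cder f)).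
  { intros z Hz. set (r := (rho - Cmod z) / 2).
    assert (Hr : 0 < r) by (unfold r; lra). assert (Hzr : Cmod z + r < rho) by (unfold r; lra).
    intros e He.
    assert (K : ccont (fun w => / RtoC (2 * PI * r) * I0 r w)%C z).
    { apply contD_mult; [apply contD_const|].
      apply (Cint_param_cont rho f (fun t => RtoC r * cis t)%C (fun _ => RtoC 1) (fun t => Cconj (cis t)));
        try assumption; try lra; intros.
      - apply rcont_mult; [apply rcont_const | apply rcont_cis].
      - apply rcont_const.
      - apply rcont_conj, rcont_cis.
      - apply Hin; assumption. }
    destruct (K e He) as [d [Hd H]].
    exists (Rmin d (rho - r - Cmod z)). split; [apply Rmin_pos; lra|].
    intros w _ Hw.
    rewrite (E r w), (E r z); try assumption.
    - apply H; [exact I|]. eapply Rlt_le_trans; [apply Hw | apply Rmin_l].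
    - apply (ball_shrink z); [assumption|]. eapply Rlt_le_trans; [apply Hw | apply Rmin_r]. }
  intros z Hz. set (r := (rho - Cmod z) / 2).
  assert (Hr : 0 < r) by (unfold r; lra). assert (Hzr : Cmod z + r < rho) by (unfold r; lra).
  eexists. apply (derivD_loc _ (fun w => / RtoC (2 * PI * r) * I0 r w)%C _ _ _ (rho - r - Cmod z)); [lra | exact I | |].
  - intros w _ Hw. symmetry. apply E; [assumption|]. apply (ball_shrink z); assumption.
  - apply derivD_scal.
    apply (Cint_param_deriv rho f (Cder f) (fun t => RtoC r * cis t)%C (fun _ => RtoC 1) (fun t => Cconj (cis t)));
      try assumption; try lra; intros.
    + apply rcont_mult; [apply rcont_const | apply rcont_cis].
    + apply rcont_const.
    + apply rcont_conj, rcont_cis.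
    + apply Hin; assumption.
Qed.

(** Hadamard's form of (f z - f a) / (z - a): an average of f' over the segment from a to z, visibly
    holomorphic at z = a as well. The trailing factor 1 is the weight [om] of [Cint_param_deriv]. *)
Definition diff_quot (f : C -> C) (a z : C) : C :=
  Cint (fun t => Cder f ((a - RtoC t * a) + z * RtoC t) * 1)%C 0 1.

Theorem difference_quotient (rho : R) (f : C -> C) (a : C) : holo rho f -> Cmod a < rho ->
  holo rho (diff_quot f a) /\ forall z, Cmod z < rho -> (f z - f a = (z - a) * diff_quot f a z)%C.
Proof.
  intros Hf Ha.
  assert (HD : forall z, Cmod z < rho -> cderiv f z (Cder f z)) by (intros; apply Cder_correct; auto).
  assert (Hf' := holo_Cder rho f Hf). assert (Hc' := holo_contb _ _ Hf').
  assert (Hf'' := holo_Cder rho _ Hf'). assert (Hc'' := holo_contb _ _ Hf'').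
  assert (HD' : forall z, Cmod z < rho -> cderiv (Cder f) z (Cder (Cder f) z)) by (intros; apply Cder_correct; auto).
  unfold diff_quot.
  assert (Hp : forall z t, ((a - RtoC t * a) + z * RtoC t)%C = (a + RtoC t * (z - a))%C) by (intros; ring).
  split.
  - intros z Hz. eexists.
    apply (Cint_param_deriv rho (Cder f) (Cder (Cder f)) (fun t => a - RtoC t * a)%C RtoC (fun _ => RtoC 1));
      try assumption; try lra; intros.
    + apply rcont_minus; [apply rcont_const|]. apply rcont_mult; [apply rcont_RtoC | apply rcont_const].
    + apply rcont_RtoC.
    + apply rcont_const.
    + rewrite Hp. apply seg_int_point_lt; assumption.
  - intros z Hz. rewrite <- (seg_int_FTC f (Cder f) rho) by assumption. unfold seg_int. f_equal.
    apply Cint_ext; [lra|]. intros t _. rewrite Hp. ring.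
Qed.

(** * Poisson formula, logarithms, Harnack inequality *)

Lemma holo_const (rho : R) (c : C) : holo rho (fun _ => c).
Proof. intros z _. eexists. apply derivD_const. Qed.

Lemma holo_id (rho : R) : holo rho (fun z => z).
Proof. intros z _. eexists. apply derivD_id. Qed.

Lemma holo_plus (rho : R) (f g : C -> C) : holo rho f -> holo rho g -> holo rho (fun z => f z + g z)%C.
Proof.
  intros Hf Hg z Hz. destruct (Hf z Hz) as [l Hl]. destruct (Hg z Hz) as [m Hm].
  eexists. apply derivD_plus; eassumption.
Qed.

Lemma holo_mult (rho : R) (f g : C -> C) : holo rho f -> holo rho g -> holo rho (fun z => f z * g z)%C.
Proof.
  intros Hf Hg z Hz. destruct (Hf z Hz) as [l Hl]. destruct (Hg z Hz) as [m Hm].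
  eexists. apply derivD_mult; eassumption.
Qed.

Lemma holo_minus (rho : R) (f g : C -> C) : holo rho f -> holo rho g -> holo rho (fun z => f z - g z)%C.
Proof.
  intros Hf Hg z Hz. destruct (Hf z Hz) as [l Hl]. destruct (Hg z Hz) as [m Hm].
  eexists. apply derivD_minus; eassumption.
Qed.

Lemma holo_inv (rho : R) (f : C -> C) : holo rho f -> (forall z, Cmod z < rho -> f z <> 0) ->
  holo rho (fun z => / f z)%C.
Proof.
  intros Hf H z Hz. destruct (Hf z Hz) as [l Hl]. eexists. apply derivD_inv; auto. eassumption.
Qed.

Lemma holo_weaken (rho rho' : R) (f : C -> C) : rho' <= rho -> holo rho f -> holo rho' f.
Proof. intros H Hf z Hz. apply Hf. lra. Qed.

Lemma holo_Cder_spec (rho : R) (f : C -> C) (z : C) : holo rho f -> Cmod z < rho -> cderiv f z (Cder f z).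
Proof. intros Hf Hz. apply Cder_correct, Hf, Hz. Qed.

(** The Poisson kernel without its factor r^2 - |w|^2; instead of being normalised, it appears in
    the statements together with its integral. *)
Definition poisson_kernel (r : R) (w : C) (t : R) : R := / (Cmod (RtoC r * cis t - w) * Cmod (RtoC r * cis t - w)).

Lemma circle_minus_neq0 (r : R) (w : C) (t : R) : 0 < r -> Cmod w < r -> (RtoC r * cis t - w)%C <> 0.
Proof.
  intros Hr Hw H. assert (A := Cmod_triangle_sub (RtoC r * cis t) w).
  rewrite H, Cmod_0, Cmod_mult, Cmod_cis, Cmod_RtoC_nonneg in A; lra.
Qed.

Lemma Cmod_circle (r t : R) : 0 <= r -> Cmod (RtoC r * cis t) = r.
Proof. intros H. rewrite Cmod_mult, Cmod_cis, Cmod_RtoC_nonneg; lra. Qed.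

Lemma pker_pos (r : R) (w : C) (t : R) : 0 < r -> Cmod w < r -> 0 < poisson_kernel r w t.
Proof.
  intros Hr Hw. assert (A := proj1 (Cmod_gt_0 _) (circle_minus_neq0 r w t Hr Hw)).
  apply Rinv_0_lt_compat. nra.
Qed.

Lemma rcont_circle0 (r : R) (t : R) : rcont (fun t => RtoC r * cis t)%C t.
Proof. apply rcont_mult; [apply rcont_const | apply rcont_cis]. Qed.

Lemma continuous_poisson_kernel (r : R) (w : C) (t : R) : 0 < r -> Cmod w < r -> continuous (poisson_kernel r w) t.
Proof.
  intros Hr Hw. unfold poisson_kernel.
  assert (H : continuous (fun t => Cmod (RtoC r * cis t - w)) t).
  { apply (rcont_Cmod (fun t => RtoC r * cis t - w)%C). apply rcont_minus; [apply rcont_circle0 | apply rcont_const]. }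
  apply (continuous_comp (fun t => Cmod (RtoC r * cis t - w) * Cmod (RtoC r * cis t - w)) Rinv).
  - apply (@continuous_mult R_UniformSpace R_AbsRing); assumption.
  - apply continuous_Rinv. assert (A := proj1 (Cmod_gt_0 _) (circle_minus_neq0 r w t Hr Hw)). nra.
Qed.

Lemma RInt_pos_const_le (h : R -> R) (a b m : R) : a <= b -> (forall t, a <= t <= b -> continuous h t) ->
  (forall t, a <= t <= b -> m <= h t) -> m * (b - a) <= RInt h a b.
Proof.
  intros Hab Hh H. replace (m * (b - a)) with (RInt (fun _ => m) a b).
  - apply RInt_le; [assumption | apply ex_RInt_const | apply RInt_cont_ex; assumption |].
    intros. apply H. lra.
  - rewrite RInt_const. apply Rmult_comm.
Qed.

Lemma RInt_poisson_kernel_pos (r : R) (w : C) : 0 < r -> Cmod w < r -> 0 < RInt (poisson_kernel r w) 0 (2 * PI).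
Proof.
  intros Hr Hw. assert (HP := PI_RGT_0). apply RInt_gt_0; [lra| |].
  - intros. apply pker_pos; assumption.
  - intros. apply continuous_poisson_kernel; assumption.
Qed.

Lemma Cint_RtoC (h : R -> R) (a b : R) : a <= b -> (forall t, a <= t <= b -> continuous h t) ->
  Cint (fun t => RtoC (h t)) a b = RtoC (RInt h a b).
Proof.
  intros Hab Hh.
  assert (Hc : forall t, a <= t <= b -> rcont (fun t => RtoC (h t)) t) by (intros; apply rcont_of_real; auto).
  apply injective_projections.
  - exact (Cint_Re _ a b Hab Hc).
  - change (Im (Cint (fun t => RtoC (h t)) a b) = 0). rewrite Cint_Im by assumption.
    rewrite (RInt_ext _ (fun _ => 0)) by (intros; reflexivity).
    rewrite RInt_const. apply Rmult_0_r.
Qed.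

(** On the circle, (f z - f w) / |z - w|^2 coincides with the holomorphic function q z * z / (r^2 -
    conj(w) z), where q is the difference quotient at w. That function vanishes at 0, so its mean is
    zero. *)
Theorem poisson (rho r : R) (f : C -> C) (w : C) : holo rho f -> 0 < r < rho -> Cmod w < r ->
  Cint (fun t => f (RtoC r * cis t) * RtoC (poisson_kernel r w t))%C 0 (2 * PI) =
  (f w * RtoC (RInt (poisson_kernel r w) 0 (2 * PI)))%C.
Proof.
  intros Hf Hr Hw.
  assert (HP := twoPI_pos). assert (Hw0 := Cmod_ge_0 w).
  destruct (difference_quotient rho f w Hf ltac:(lra)) as [Hq Eq]. set (q := diff_quot f w) in *.
  (* The denominator can vanish only at modulus r^2 / |w|; 2 r^2 / (r + |w|) lies strictly between r
     and that value and still makes sense for w = 0. *)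
  set (rho1 := Rmin rho (2 * (r * r) / (r + Cmod w))).
  assert (Hr1 : r < rho1).
  { unfold rho1. apply Rmin_glb_lt; [lra|]. apply Rmult_lt_reg_r with (r + Cmod w); [lra|].
    unfold Rdiv. rewrite Rmult_assoc, Rinv_l by lra. nra. }
  assert (Hden : forall z, Cmod z < rho1 -> (RtoC (r * r) - Cconj w * z)%C <> 0).
  { intros z Hz E.
    assert (Hz2 := Rlt_le_trans _ _ _ Hz (Rmin_r _ _)).
    assert (E2 : RtoC (r * r) = (Cconj w * z)%C) by (apply Ceq_minus; exact E).
    apply (f_equal Cmod) in E2. rewrite Cmod_mult, Cmod_conj, Cmod_RtoC_nonneg in E2 by nra.
    apply Rlt_div_r in Hz2; [|lra].
    assert (Hz0 := Cmod_ge_0 z). nra. }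
  set (Phi := fun z => (q z * (z * / (RtoC (r * r) - Cconj w * z)))%C).
  assert (HPhi : holo rho1 Phi).
  { apply holo_mult; [apply (holo_weaken rho); [apply Rmin_l | assumption]|].
    apply holo_mult; [apply holo_id|]. apply holo_inv; [|assumption].
    apply holo_minus; [apply holo_const|]. apply holo_mult; [apply holo_const | apply holo_id]. }
  assert (HM := mean_value rho1 Phi 0 r HPhi ltac:(lra) ltac:(rewrite Cmod_0; lra)).
  assert (Phi0 : Phi 0 = 0) by (unfold Phi; ring).
  rewrite Phi0, Cmult_0_r in HM.
  assert (Hcf : forall t, rcont (fun t => f (RtoC r * cis t) * RtoC (poisson_kernel r w t))%C t).
  { intros t. apply rcont_mult.
    - apply (rcont_comp f); [apply (holo_contb rho); [assumption | rewrite Cmod_circle; lra] | apply rcont_circle0].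
    - apply rcont_of_real, continuous_poisson_kernel; lra. }
  assert (Hcp : forall t, rcont (fun t => RtoC (poisson_kernel r w t)) t).
  { intros t. apply rcont_of_real, continuous_poisson_kernel; lra. }
  rewrite (Cint_ext _ (fun t => f (RtoC r * cis t) * RtoC (poisson_kernel r w t) - f w * RtoC (poisson_kernel r w t))%C) in HM.
  - rewrite Cint_minus, Cint_scal, Cint_RtoC in HM; auto.
    + apply Ceq_minus. exact HM.
    + intros. apply continuous_poisson_kernel; lra.
    + intros. apply rcont_mult; [apply rcont_const | auto].
  - assumption.
  - intros t _. unfold Phi. rewrite Cplus_0_l. set (z := (RtoC r * cis t)%C).
    assert (Hz : Cmod z = r) by (apply Cmod_circle; lra).
    assert (Hzw : (z - w)%C <> 0) by (apply circle_minus_neq0; lra).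
    assert (Ez : RtoC (r * r) = (z * Cconj z)%C).
    { rewrite <- Cmod2_conj, Hz. f_equal. ring. }
    assert (Hz0 : z <> 0) by (apply Cmod_gt_0; lra).
    assert (Hcz : (Cconj z - Cconj w)%C <> 0).
    { rewrite <- Cminus_conj. intros E. apply Hzw. apply Cmod_eq_0. rewrite <- Cmod_conj, E. apply Cmod_0. }
    assert (Ep : RtoC (poisson_kernel r w t) = (/ ((z - w) * (Cconj z - Cconj w)))%C).
    { unfold poisson_kernel. fold z. rewrite <- Cminus_conj, <- Cmod2_conj, RtoC_inv.
      - do 2 f_equal. simpl. ring.
      - apply Rgt_not_eq. assert (A := proj1 (Cmod_gt_0 _) Hzw). nra. }
    assert (Eqz : q z = ((f z - f w) * / (z - w))%C).
    { rewrite Eq by lra. field. assumption. }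
    rewrite Eqz, Ep, Ez. field. repeat split; try assumption.
    replace (z * Cconj z - Cconj w * z)%C with (z * (Cconj z - Cconj w))%C by ring.
    apply Cmult_neq_0; assumption.
Qed.

Theorem max_principle (rho r M : R) (f : C -> C) (w : C) : holo rho f -> 0 < r < rho ->
  (forall t, 0 <= t <= 2 * PI -> Cmod (f (RtoC r * cis t)%C) <= M) -> Cmod w < r -> Cmod (f w) <= M.
Proof.
  intros Hf Hr HM Hw.
  assert (HP := twoPI_pos).
  assert (E := poisson rho r f w Hf Hr Hw).
  assert (HI := RInt_poisson_kernel_pos r w (proj1 Hr) Hw).
  apply Rmult_le_reg_r with (RInt (poisson_kernel r w) 0 (2 * PI)); [assumption|].
  rewrite <- (Cmod_RtoC_nonneg (RInt (poisson_kernel r w) 0 (2 * PI))) at 1 by lra.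
  rewrite <- Cmod_mult, <- E.
  replace (M * RInt (poisson_kernel r w) 0 (2 * PI)) with (RInt (fun t => M * poisson_kernel r w t) 0 (2 * PI)).
  - apply Cint_norm_le; [assumption| | |].
    + intros t _. apply rcont_mult.
      * apply (rcont_comp f); [apply (holo_contb rho); [assumption | rewrite Cmod_circle; lra] | apply rcont_circle0].
      * apply rcont_of_real, continuous_poisson_kernel; lra.
    + intros t _. apply (@continuous_scal_r R_UniformSpace R_AbsRing R_NormedModule M). apply continuous_poisson_kernel; lra.
    + intros t Ht. assert (A := pker_pos r w t (proj1 Hr) Hw).
      rewrite Cmod_mult, (Cmod_RtoC_nonneg (poisson_kernel r w t)) by lra.
      apply Rmult_le_compat_r; [lra|]. apply HM. exact Ht.
  - apply (@RInt_scal R_CompleteNormedModule). apply RInt_cont_ex; [assumption|].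
    intros. apply continuous_poisson_kernel; lra.
Qed.

(** * Logarithms of zero-free functions and Harnack's inequality *)

Lemma mvt_closed (h dh : R -> R) (a b : R) : a <= b -> (forall x, a <= x <= b -> is_derive h x (dh x)) ->
  exists x, a <= x <= b /\ h b - h a = dh x * (b - a).
Proof.
  intros Hab H.
  destruct (MVT_gen h a b dh) as [x [Hx E]]; rewrite ?Rmin_left, ?Rmax_right in * by assumption.
  - intros x Hx. apply H. lra.
  - intros x Hx. apply continuity_pt_filterlim, (@ex_derive_continuous R_AbsRing R_NormedModule h).
    exists (dh x). apply H, Hx.
  - exists x. split; assumption.
Qed.

Lemma is_derive_ln_sqrt_sum (u v : R -> R) (t du dv : R) : 0 < u t * u t + v t * v t ->
  is_derive u t du -> is_derive v t dv ->
  is_derive (fun s => ln (sqrt (u s ^ 2 + v s ^ 2))) t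
    ((u t * du + v t * dv) / (u t * u t + v t * v t)).
Proof.
  intros Hp Hu Hv.
  assert (Hp' : 0 < u t * (u t * 1) + v t * (v t * 1)) by lra.
  auto_derive.
  - split; [eexists; exact Hu|]. split; [eexists; exact Hv|]. split; [exact Hp'|]. split; [|exact I].
    apply sqrt_lt_R0. exact Hp'.
  - change (Derive (fun x : R => u x) t) with (Derive u t). change (Derive (fun x : R => v x) t) with (Derive v t).
    rewrite (is_derive_unique _ _ _ Hu), (is_derive_unique _ _ _ Hv).
    set (S := sqrt _).
    assert (HS : 0 < S) by (apply sqrt_lt_R0; exact Hp').
    assert (HSS : S * S = u t * u t + v t * v t).
    { rewrite <- (sqrt_sqrt (u t * u t + v t * v t)) by lra. unfold S. do 2 f_equal; ring. }
    rewrite <- HSS. field. lra.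
Qed.

Lemma is_derive_ln_Cmod (g : R -> C) (t : R) (l : C) : g t <> 0 -> rderiv g t l ->
  is_derive (fun s => ln (Cmod (g s))) t (Re (l * / g t)).
Proof.
  intros H0 Hg.
  assert (Hp : 0 < Re (g t) * Re (g t) + Im (g t) * Im (g t)).
  { assert (A := proj1 (Cmod_gt_0 _) H0).
    assert (B := Cmod2_alt (g t)). simpl in B. nra. }
  assert (D := is_derive_ln_sqrt_sum (fun s => Re (g s)) (fun s => Im (g s)) t (Re l) (Im l) Hp
    (rderiv_Re g t l Hg) (rderiv_Im g t l Hg)).
  replace (Re (l * / g t)) with
    ((Re (g t) * Re l + Im (g t) * Im l) / (Re (g t) * Re (g t) + Im (g t) * Im (g t))); [exact D|].
  destruct (g t) as [x y]. destruct l as [u v]. simpl in *. field. lra.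
Qed.

Theorem holo_log (rho : R) (H : C -> C) : holo rho H -> (forall z, Cmod z < rho -> H z <> 0) ->
  exists L, holo rho L /\ forall z, Cmod z < rho ->
    cderiv L z (Cder H z * / H z) /\ Re (L z) = ln (Cmod (H z)).
Proof.
  intros HH H0.
  set (k := fun z => (Cder H z * / H z)%C).
  assert (Hk : holo rho k) by (apply holo_mult; [apply holo_Cder | apply holo_inv]; assumption).
  assert (HL := holo_primitive rho k Hk). set (L0 := seg_int k 0) in *.
  (* The constant fixes the real part at 0. Along each ray the difference of ln |H| and Re L then
     has derivative zero, since L' = H' / H. *)
  set (c := RtoC (ln (Cmod (H 0)) - Re (L0 0))).
  assert (HL' : forall z, Cmod z < rho -> cderiv (fun z => L0 z + c)%C z (k z)).
  { intros z Hz. eapply derivD_eq; [apply derivD_plus; [apply HL; assumption | apply derivD_const]|]. ring. }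
  exists (fun z => L0 z + c)%C. split.
  - intros z Hz. eexists. apply HL'. assumption.
  - intros z Hz. split; [apply HL'; assumption|].
    assert (Hr : 0 < rho) by (assert (A := Cmod_ge_0 z); lra).
    set (u := fun s => ln (Cmod (H (0 + RtoC s * z)%C)) - Re (L0 (0 + RtoC s * z)%C)).
    assert (Hin : forall s, 0 <= s <= 1 -> Cmod (0 + RtoC s * z) < rho).
    { intros s Hs. replace z with (z - 0)%C by ring. apply seg_int_point_lt; [assumption | rewrite Cmod_0; lra|].
      assumption. }
    assert (Hu : forall s, 0 <= s <= 1 -> is_derive u s 0).
    { intros s Hs.
      set (w := (0 + RtoC s * z)%C).
      assert (D : is_derive u s (Re (Cder H w * z * / H w) - Re (k w * z))).
      { apply (@is_derive_minus R_AbsRing R_NormedModule).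
        - apply (is_derive_ln_Cmod (fun s => H (0 + RtoC s * z)%C)); [apply H0, Hin, Hs|].
          apply (rderiv_comp H); [apply (holo_Cder_spec rho); [assumption | apply Hin, Hs] | apply rderiv_line].
        - apply (rderiv_Re (fun s => L0 (0 + RtoC s * z)%C)).
          apply (rderiv_comp L0); [apply HL, Hin, Hs | apply rderiv_line]. }
      rewrite <- Re_minus in D.
      replace (Cder H w * z * / H w - k w * z)%C with (RtoC 0) in D by (unfold k; ring).
      exact D. }
    destruct (mvt_closed u (fun _ => 0) 0 1 ltac:(lra) Hu) as [x [_ Hx]].
    unfold u in Hx. replace (0 + RtoC 1 * z)%C with z in Hx by ring.
    replace (0 + RtoC 0 * z)%C with (RtoC 0) in Hx by ring.
    rewrite re_plus. unfold c. rewrite re_RtoC. lra.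
Qed.

(** A Borel-Caratheodory argument. Against conj(cis t), both conj(L) and constants integrate to
    zero, so l can be computed from 2 Re L - 2 A. This function has constant sign, so its modulus
    integrates by the mean value formula. *)
Theorem derivative_bound_of_Re_le (rho r A : R) (L : C -> C) (z l : C) : holo rho L ->
  (forall w, Cmod w < rho -> Re (L w) <= A) -> 0 < r -> Cmod z + r < rho -> cderiv L z l ->
  Cmod l <= 2 / r * (A - Re (L z)).
Proof.
  intros HL HA Hr Hz Hl.
  assert (HP := PI_RGT_0). assert (HP' := twoPI_pos).
  assert (Hin : forall t, Cmod (z + RtoC r * cis t) < rho).
  { intros t. apply circle_point_lt. rewrite Cmod_RtoC_nonneg; lra. }
  assert (Q : forall t, rcont (fun t => L (z + RtoC r * cis t))%C t).
  { intros t. apply (rcont_comp L); [apply (holo_contb rho); auto | apply rcont_circle]. }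
  assert (Qc : forall t, rcont (fun t => Cconj (cis t)) t) by (intros; apply rcont_conj, rcont_cis).
  assert (E1 := deriv_center rho L z l r HL Hr Hz Hl).
  (* (w - z) L w vanishes at the centre, so its mean value says that L times cis integrates to zero;
     conjugating gives [F2]. *)
  assert (E2 := mean_value rho (fun w => (w - z) * L w)%C z r
     ltac:(apply holo_mult; [apply holo_minus; [apply holo_id | apply holo_const] | assumption]) ltac:(lra) Hz).
  assert (E3 := mean_value 2 (fun w => w) 0 1 (holo_id 2) ltac:(lra) ltac:(rewrite Cmod_0; lra)).
  assert (E4 := mean_value rho L z r HL ltac:(lra) Hz).
  assert (F2 : Cint (fun t => Cconj (L (z + RtoC r * cis t)) * Cconj (cis t))%C 0 (2 * PI) = 0).
  { rewrite (Cint_ext _ (fun t => Cconj (L (z + RtoC r * cis t) * cis t)%C)) by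
      (try assumption; intros; rewrite Cmult_conj; reflexivity).
    rewrite Cint_conj; [|assumption | intros; apply rcont_mult; [apply Q | apply rcont_cis]].
    cbv beta in E2.
    rewrite (Cint_ext _ (fun t => RtoC r * (L (z + RtoC r * cis t) * cis t))%C) in E2;
      [|assumption| intros; ring].
    rewrite Cint_scal in E2; [|assumption | intros; apply rcont_mult; [apply Q | apply rcont_cis]].
    replace (z - z)%C with (RtoC 0) in E2 by ring. rewrite Cmult_0_l, Cmult_0_r in E2.
    assert (X : Cint (fun t => L (z + RtoC r * cis t) * cis t)%C 0 (2 * PI) = 0).
    { destruct (Ceq_dec (Cint (fun t => L (z + RtoC r * cis t) * cis t)%C 0 (2 * PI)) 0) as [|N]; [assumption|].
      exfalso. apply (Cmult_neq_0 (RtoC r) _ (RtoC_neq0 r ltac:(lra)) N). exact E2. }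
    rewrite X. unfold Cconj; simpl. unfold RtoC. f_equal. ring. }
  assert (F3 : Cint (fun t => Cconj (cis t)) 0 (2 * PI) = 0).
  { rewrite Cint_conj by (try assumption; intros; apply rcont_cis).
    rewrite Cmult_0_r in E3. rewrite (Cint_ext _ cis) in E3; [|assumption| intros; ring].
    rewrite E3. unfold Cconj; simpl. unfold RtoC. f_equal. ring. }
  assert (E : (RtoC (2 * PI * r) * l)%C =
    Cint (fun t => ((L (z + RtoC r * cis t) + Cconj (L (z + RtoC r * cis t))) - RtoC (2 * A)) * Cconj (cis t))%C 0 (2 * PI)).
  { rewrite (Cint_ext _ (fun t => (L (z + RtoC r * cis t) * Cconj (cis t) +
       Cconj (L (z + RtoC r * cis t)) * Cconj (cis t)) - RtoC (2 * A) * Cconj (cis t))%C); [|assumption|intros; ring].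
    rewrite Cint_minus, Cint_plus, Cint_scal, F2, F3, E1; try assumption; try (intros; auto); try ring;
      repeat first [apply rcont_plus | apply rcont_mult | apply rcont_const | apply rcont_conj | apply Q | apply rcont_cis]. }
  assert (B : Cmod (RtoC (2 * PI * r) * l) <= RInt (fun t => 2 * A - 2 * Re (L (z + RtoC r * cis t)%C)) 0 (2 * PI)).
  { rewrite E. apply Cint_norm_le; [assumption| | |].
    - intros. repeat first [apply rcont_minus | apply rcont_plus | apply rcont_mult | apply rcont_const | apply rcont_conj | apply Q | apply rcont_cis].
    - intros. apply (@continuous_minus R_UniformSpace R_AbsRing R_NormedModule); [apply continuous_const|].
      apply (@continuous_scal_r R_UniformSpace R_AbsRing R_NormedModule 2). apply (rcont_Re (fun t => L (z + RtoC r * cis t))%C). auto.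
    - intros t _. rewrite Cmod_mult, Cmod_conj, Cmod_cis, Rmult_1_r.
      specialize (HA _ (Hin t)). destruct (L (z + RtoC r * cis t)%C) as [x y]. simpl in HA.
      replace ((x, y) + Cconj (x, y) - RtoC (2 * A))%C with (RtoC (- (2 * A - 2 * x))).
      + rewrite Cmod_R, Rabs_Ropp, Rabs_pos_eq by lra. simpl. lra.
      + unfold Cconj, Cminus, Cplus, Copp, RtoC; simpl. f_equal; ring. }
  assert (G : RInt (fun t => 2 * A - 2 * Re (L (z + RtoC r * cis t)%C)) 0 (2 * PI) = 2 * PI * (2 * (A - Re (L z)))).
  { rewrite (RInt_ext _ (fun t => Re (RtoC (2 * A) - RtoC 2 * L (z + RtoC r * cis t))%C)).
    - rewrite <- (Cint_Re (fun t => RtoC (2 * A) - RtoC 2 * L (z + RtoC r * cis t))%C);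
        [| assumption | intros; apply rcont_minus; [apply rcont_const | apply rcont_mult; [apply rcont_const | apply Q]]].
      rewrite Cint_minus, Cint_scal, Cint_const, E4; try assumption; try (intros; auto);
        try (apply rcont_mult); try apply rcont_const; try apply Q.
      destruct (L z) as [x y]. simpl. ring.
    - intros x _. rewrite Re_minus, re_scal_l, re_RtoC. reflexivity. }
  rewrite G, Cmod_mult, Cmod_RtoC_nonneg in B by nra.
  apply Rmult_le_reg_l with (2 * PI * r); [nra|].
  eapply Rle_trans; [apply B|]. right. field. lra.
Qed.

Lemma is_derive_exp_weight (v : R -> R) (A K s dv : R) : is_derive v s dv ->
  is_derive (fun s => (A - v s) * exp (- (K * s))) s ((- dv - K * (A - v s)) * exp (- (K * s))).
Proof.
  intros D. auto_derive; [eexists; exact D|].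
  change (Derive (fun x : R => v x) s) with (Derive v s).
  rewrite (is_derive_unique _ _ _ D). ring.
Qed.

(** A - Re L is nonnegative with gradient at most 2 / r times itself; Gronwall along the segment
    from z0 to z, with weight exp (- K s), gives the exponential. *)
Theorem harnack (rho r A : R) (L : C -> C) (z0 z : C) : holo rho L ->
  (forall w, Cmod w < rho -> Re (L w) <= A) -> 0 < r -> Cmod z0 + r < rho -> Cmod z + r < rho ->
  A - Re (L z) <= (A - Re (L z0)) * exp (2 / r * Cmod (z - z0)).
Proof.
  intros HL HA Hr Hz0 Hz.
  set (K := 2 / r * Cmod (z - z0)).
  set (p := fun s : R => (z0 + RtoC s * (z - z0))%C).
  assert (Hp : forall s, 0 <= s <= 1 -> Cmod (p s) + r < rho).
  { intros s Hs. assert (Cmod (p s) < rho - r) by (apply seg_int_point_lt; [assumption | lra | lra]). lra. }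
  set (dg := fun s => (- Re (Cder L (p s) * (z - z0)) - K * (A - Re (L (p s)))) * exp (- (K * s))).
  assert (Hd : forall s, 0 <= s <= 1 -> is_derive (fun s => (A - Re (L (p s))) * exp (- (K * s))) s (dg s)).
  { intros s Hs.
    assert (D : is_derive (fun s => Re (L (p s))) s (Re (Cder L (p s) * (z - z0)))).
    { apply (rderiv_Re (fun s => L (p s))). apply (rderiv_comp L).
      - apply (holo_Cder_spec rho); [assumption | specialize (Hp s Hs); lra].
      - apply rderiv_line. }
    exact (is_derive_exp_weight (fun s => Re (L (p s))) A K s _ D). }
  destruct (mvt_closed _ dg 0 1 ltac:(lra) Hd) as [x [Hx E]].
  assert (Hneg : dg x <= 0).
  { unfold dg. assert (EP : 0 < exp (- (K * x))) by (apply exp_pos).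
    assert (B := derivative_bound_of_Re_le rho r A L (p x) _ HL HA Hr (Hp x Hx)
      (holo_Cder_spec rho L (p x) HL ltac:(specialize (Hp x Hx); lra))).
    assert (B2 := re_le_Cmod (Cder L (p x) * (z - z0))). rewrite Cmod_mult in B2.
    apply Rabs_le_between in B2.
    assert (B3 : Cmod (Cder L (p x)) * Cmod (z - z0) <= K * (A - Re (L (p x)))).
    { unfold K. replace (2 / r * Cmod (z - z0) * (A - Re (L (p x)))) with (2 / r * (A - Re (L (p x))) * Cmod (z - z0)) by ring.
      apply Rmult_le_compat_r; [apply Cmod_ge_0 | assumption]. }
    nra. }
  unfold p in E. replace (z0 + RtoC 1 * (z - z0))%C with z in E by ring.
  replace (z0 + RtoC 0 * (z - z0))%C with z0 in E by ring.
  rewrite Rmult_0_r, Ropp_0, exp_0, !Rmult_1_r, Rminus_0_r, Rmult_1_r in E.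
  rewrite exp_Ropp in E. assert (P := exp_pos K).
  apply Rmult_le_reg_r with (/ exp K); [apply Rinv_0_lt_compat; assumption|].
  rewrite Rmult_assoc, Rinv_r by lra. lra.
Qed.

(** * Dividing out zeros *)

Definition ent (f : C -> C) : Prop := forall z, exists l, cderiv f z l.

Lemma ent_holo (f : C -> C) (rho : R) : ent f -> holo rho f.
Proof. intros H z _. apply H. Qed.

Lemma holo_ent (f : C -> C) : (forall rho, holo rho f) -> ent f.
Proof. intros H z. apply (H (Cmod z + 1)). lra. Qed.

Lemma ent_cont (f : C -> C) (z : C) : ent f -> ccont f z.
Proof. intros H. destruct (H z) as [l Hl]. eapply derivD_contD, Hl. Qed.

Lemma ent_Cder_spec (f : C -> C) (z : C) : ent f -> cderiv f z (Cder f z).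
Proof. intros H. apply Cder_correct, H. Qed.

Lemma ent_const (c : C) : ent (fun _ => c).
Proof. intros z. eexists. apply derivD_const. Qed.

Lemma ent_id : ent (fun z => z).
Proof. intros z. eexists. apply derivD_id. Qed.

Lemma ent_plus (f g : C -> C) : ent f -> ent g -> ent (fun z => f z + g z)%C.
Proof. intros. apply holo_ent. intros. apply holo_plus; apply ent_holo; assumption. Qed.

Lemma ent_minus (f g : C -> C) : ent f -> ent g -> ent (fun z => f z - g z)%C.
Proof. intros. apply holo_ent. intros. apply holo_minus; apply ent_holo; assumption. Qed.

Lemma ent_mult (f g : C -> C) : ent f -> ent g -> ent (fun z => f z * g z)%C.
Proof. intros. apply holo_ent. intros. apply holo_mult; apply ent_holo; assumption. Qed.

Lemma ent_Cder (f : C -> C) : ent f -> ent (Cder f).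
Proof. intros H. apply holo_ent. intros. apply holo_Cder, ent_holo, H. Qed.

Lemma cderiv_shift (f : C -> C) (c z l : C) : cderiv f (z + c)%C l -> cderiv (fun z => f (z + c)%C) z l.
Proof.
  intros H. eapply derivD_eq.
  - apply (derivD_comp _ (fun _ => True) f (fun z => z + c)%C); [auto | exact H|].
    apply derivD_plus; [apply derivD_id | apply derivD_const].
  - ring.
Qed.

Lemma ent_shift (f : C -> C) (c : C) : ent f -> ent (fun z => f (z + c)%C).
Proof. intros H z. destruct (H (z + c)%C) as [l Hl]. exists l. apply cderiv_shift, Hl. Qed.

Lemma ent_divide (f : C -> C) (a : C) : ent f -> f a = 0 ->
  ent (diff_quot f a) /\ forall z, f z = ((z - a) * diff_quot f a z)%C.
Proof.
  intros Hf Ha.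
  assert (H : forall rho, Cmod a < rho -> holo rho (diff_quot f a) /\
      forall z, Cmod z < rho -> (f z - f a = (z - a) * diff_quot f a z)%C).
  { intros rho Hr. apply difference_quotient; [apply ent_holo|]; assumption. }
  assert (A := Cmod_ge_0 a).
  split.
  - intros z. assert (B := Cmod_ge_0 z). destruct (H (Cmod a + Cmod z + 1) ltac:(lra)) as [H1 _]. apply H1. lra.
  - intros z. assert (B := Cmod_ge_0 z).
    destruct (H (Cmod a + Cmod z + 1) ltac:(lra)) as [_ H2]. rewrite <- H2 by lra. rewrite Ha. ring.
Qed.

(* With [s = 2 rho] each factor has modulus at least 1 on [|z| = 3 rho], which keeps the cofactor bounded. *)
Definition lin_prod (s : R) (l : list C) (z : C) : C :=
  fold_right (fun a p => ((z - a) * RtoC (/ s) * p)%C) (RtoC 1) l.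

Lemma lin_prod_cons (s : R) (a : C) (l : list C) (z : C) :
  lin_prod s (a :: l) z = ((z - a) * RtoC (/ s) * lin_prod s l z)%C.
Proof. reflexivity. Qed.

Lemma lin_prod_zero (s : R) (l : list C) (a : C) : In a l -> lin_prod s l a = 0.
Proof.
  induction l as [|b l IH]; intros H; [destruct H|]. rewrite lin_prod_cons.
  destruct H as [->|H]; [ring|]. rewrite (IH H). ring.
Qed.

Lemma lin_prod_neq0 (s : R) (l : list C) (z : C) : 0 < s -> ~ In z l -> lin_prod s l z <> 0.
Proof.
  intros Hs. induction l as [|b l IH]; intros H; [|rewrite lin_prod_cons].
  - apply C1_nz.
  - apply Cmult_neq_0; [apply Cmult_neq_0|].
    + intros E. apply H. left. symmetry. apply Ceq_minus. exact E.
    + apply RtoC_neq0, Rinv_neq_0_compat. lra.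
    + apply IH. intros K. apply H. right. exact K.
Qed.

Lemma Cmod_factor (s : R) (z a : C) : 0 < s -> Cmod ((z - a) * RtoC (/ s)) = Cmod (z - a) / s.
Proof.
  intros Hs. rewrite Cmod_mult, Cmod_RtoC_nonneg; [reflexivity|]. left. apply Rinv_0_lt_compat, Hs.
Qed.

Lemma lin_prod_circle_ge (rho : R) (l : list C) (z : C) : 0 < rho -> (forall a, In a l -> Cmod a <= rho) ->
  Cmod z = 3 * rho -> 1 <= Cmod (lin_prod (2 * rho) l z).
Proof.
  intros Hr Hl Hz. induction l as [|a l IH].
  - simpl. rewrite Cmod_1. lra.
  - rewrite lin_prod_cons, Cmod_mult, Cmod_factor by lra.
    assert (H1 : 1 <= Cmod (lin_prod (2 * rho) l z)) by (apply IH; intros; apply Hl; right; assumption).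
    assert (H2 : 1 <= Cmod (z - a) / (2 * rho)).
    { apply Rmult_le_reg_r with (2 * rho); [lra|]. unfold Rdiv. rewrite Rmult_assoc, Rinv_l by lra.
      assert (A := Cmod_triangle_sub z a). assert (B := Hl a (or_introl eq_refl)). lra. }
    nra.
Qed.

(** Each factor is at most (rho / 2 + rho) / (2 rho) = 3 / 4. *)
Lemma lin_prod_center_le (rho : R) (l : list C) (z : C) : 0 < rho -> (forall a, In a l -> Cmod a <= rho) ->
  Cmod z <= rho / 2 -> Cmod (lin_prod (2 * rho) l z) <= (3 / 4) ^ length l.
Proof.
  intros Hr Hl Hz. induction l as [|a l IH].
  - simpl. rewrite Cmod_1. lra.
  - rewrite lin_prod_cons, Cmod_mult, Cmod_factor by lra. simpl pow.
    apply Rmult_le_compat; try apply Cmod_ge_0.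
    + apply Rmult_le_pos; [apply Cmod_ge_0|]. left. apply Rinv_0_lt_compat. lra.
    + apply Rmult_le_reg_r with (2 * rho); [lra|]. unfold Rdiv at 1. rewrite Rmult_assoc, Rinv_l by lra.
      assert (A := Cmod_triangle_minus z a). assert (B := Hl a (or_introl eq_refl)). lra.
    + apply IH. intros; apply Hl; right; assumption.
Qed.

Lemma partial_factor_bounds (F H : C -> C) (rho M : R) (w0 : C) (l : list C) : ent H -> 0 < rho ->
  Cmod w0 <= rho / 2 -> (forall t, 0 <= t <= 2 * PI -> Cmod (F (RtoC (3 * rho) * cis t)%C) <= M) ->
  (forall z, F z = (lin_prod (2 * rho) l z * H z)%C) -> (forall a, In a l -> Cmod a <= rho) ->
  Cmod (F w0) <= (3 / 4) ^ length l * M /\ (forall z, Cmod z < 3 * rho -> Cmod (H z) <= M) /\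
  Cmod (F w0) <= Cmod (H w0).
Proof.
  intros HH Hr Hw HM HF Hl.
  assert (HHM : forall z, Cmod z < 3 * rho -> Cmod (H z) <= M).
  { intros z Hz. apply (max_principle (4 * rho) (3 * rho) M H z); [apply ent_holo; assumption | lra | | assumption].
    intros t Ht. specialize (HM t Ht). rewrite HF, Cmod_mult in HM.
    assert (A := lin_prod_circle_ge rho l (RtoC (3 * rho) * cis t)%C Hr Hl ltac:(apply Cmod_circle; lra)).
    assert (B := Cmod_ge_0 (H (RtoC (3 * rho) * cis t)%C)). nra. }
  assert (A := lin_prod_center_le rho l w0 Hr Hl Hw).
  assert (B := Cmod_ge_0 (H w0)). assert (B2 := HHM w0 ltac:(lra)).
  assert (P : (3 / 4) ^ length l <= 1).
  { rewrite <- (pow1 (length l)). apply pow_incr. lra. }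
  assert (P0 : 0 <= (3 / 4) ^ length l) by (apply pow_le; lra).
  split; [|split; [assumption|]]; rewrite HF, Cmod_mult.
  - apply Rmult_le_compat; try assumption. apply Cmod_ge_0.
  - assert (Q := Cmod_ge_0 (lin_prod (2 * rho) l w0)). nra.
Qed.

(* Zeros are divided out one at a time; the estimate at [w0] bounds how often this can be done. *)
Theorem peel (F : C -> C) (rho M : R) (w0 : C) : ent F -> 0 < rho -> Cmod w0 <= rho / 2 -> F w0 <> 0 ->
  (forall t, 0 <= t <= 2 * PI -> Cmod (F (RtoC (3 * rho) * cis t)%C) <= M) ->
  exists l H, ent H /\ (forall z, F z = (lin_prod (2 * rho) l z * H z)%C) /\
    (forall a, In a l -> Cmod a <= rho) /\ (forall z, Cmod z <= rho -> H z <> 0) /\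
    Cmod (F w0) <= (3 / 4) ^ length l * M /\ (forall z, Cmod z < 3 * rho -> Cmod (H z) <= M) /\
    Cmod (F w0) <= Cmod (H w0).
Proof.
  intros HF Hr Hw Hw0 HM.
  apply NNPP. intros Hno.
  (* If no zero-free cofactor ever appears, factorisations of every length n exist, and (3/4)^n M
     eventually drops below |F w0|. *)
  assert (Hpart : forall n, exists l H, length l = n /\ ent H /\ (forall z, F z = (lin_prod (2 * rho) l z * H z)%C) /\
    (forall a, In a l -> Cmod a <= rho)).
  { induction n as [|n [l [H [Hn [HH [HE Hl]]]]]].
    - exists nil, F. repeat split; auto.
      + intros z. simpl. ring.
      + intros a [].
    - destruct (classic (exists a, Cmod a <= rho /\ H a = 0)) as [[a [Ha Ha0]]|Hz].
      + destruct (ent_divide H a HH Ha0) as [Hq Eq].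
        (* The factor 2 rho undoes the normalisation by / (2 rho) in [lin_prod]. *)
        exists (a :: l), (fun z => RtoC (2 * rho) * diff_quot H a z)%C. repeat split.
        * simpl. f_equal. exact Hn.
        * apply ent_mult; [apply ent_const | assumption].
        * intros z. rewrite HE, Eq, lin_prod_cons, RtoC_inv by lra. field. apply RtoC_neq0. lra.
        * intros b [<-|Hb]; auto.
      + exfalso. apply Hno. exists l, H.
        destruct (partial_factor_bounds F H rho M w0 l HH Hr Hw HM HE Hl) as [B1 [B2 B3]].
        repeat split; try assumption. intros z Hzr E. apply Hz. exists z. split; assumption. }
  assert (HF0 : 0 < Cmod (F w0)) by (apply Cmod_gt_0; assumption).
  assert (HMp : 0 <= M).
  { eapply Rle_trans; [apply Cmod_ge_0 | apply (HM 0)]. assert (H := PI_RGT_0). lra. }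
  destruct (pow_lt_1_zero (3 / 4) ltac:(rewrite Rabs_pos_eq; lra) (Cmod (F w0) / (M + 1))) as [N HN].
  { apply Rdiv_lt_0_compat; lra. }
  specialize (HN N (le_n N)). rewrite Rabs_pos_eq in HN by (apply pow_le; lra).
  destruct (Hpart N) as [l [H [Hn [HH [HE Hl]]]]].
  destruct (partial_factor_bounds F H rho M w0 l HH Hr Hw HM HE Hl) as [B1 _].
  rewrite Hn in B1.
  apply Rlt_div_r in HN; [|lra].
  assert (P0 : 0 <= (3 / 4) ^ N) by (apply pow_le; lra). unfold Rdiv in B1, P0. nra.
Qed.

Lemma ent_bounded_circle (F : C -> C) (r : R) : ent F ->
  exists M, 0 <= M /\ forall t, 0 <= t <= 2 * PI -> Cmod (F (RtoC r * cis t)%C) <= M.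
Proof.
  intros HF. apply (rcont_bounded (fun t => F (RtoC r * cis t)%C)); [apply twoPI_pos|].
  intros t _. apply (rcont_comp F); [apply ent_cont; assumption | apply rcont_circle0].
Qed.

Lemma ent_factor_disc (F : C -> C) (w0 : C) (R0 : R) : ent F -> F w0 <> 0 ->
  exists rho l H, R0 <= rho /\ 0 < rho /\ ent H /\ (forall z, F z = (lin_prod (2 * rho) l z * H z)%C) /\
   (forall z, Cmod z <= rho -> H z <> 0).
Proof.
  intros HF Hw.
  set (rho := Rmax R0 (2 * Cmod w0 + 1)).
  assert (A := Cmod_ge_0 w0). assert (B : 2 * Cmod w0 + 1 <= rho) by apply Rmax_r.
  destruct (ent_bounded_circle F (3 * rho) HF) as [M [_ HM]].
  destruct (peel F rho M w0 HF ltac:(lra) ltac:(lra) Hw HM) as [l [H [H1 [H2 [_ [H3 _]]]]]].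
  exists rho, l, H. repeat split; try assumption; [apply Rmax_l | lra].
Qed.

(** * Identity theorem, and estimates for the local factorisation *)

Lemma list_isolated (l : list C) (z : C) : exists d, 0 < d /\ forall a, In a l -> a <> z -> d <= Cmod (a - z).
Proof.
  induction l as [|b l [d [Hd H]]].
  - exists 1. split; [lra|]. intros a [].
  - destruct (Ceq_dec b z) as [->|Hb].
    + exists d. split; [assumption|]. intros a [<-|Ha] Hne; [congruence|auto].
    + assert (0 < Cmod (b - z)) by (apply Cmod_gt_0, Cminus_eq_contra; assumption).
      exists (Rmin d (Cmod (b - z))). split; [apply Rmin_pos; assumption|].
      intros a [<-|Ha] Hne; [apply Rmin_r|]. eapply Rle_trans; [apply Rmin_l | auto].
Qed.

(** Identity theorem. On a disc F is a finite product times a zero-free factor, so a displacement of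
    z shorter than the distance to the other listed zeros reaches a nonzero value. *)
Lemma ent_nonzero_dense (F : C -> C) (w0 z : C) (d : R) : ent F -> F w0 <> 0 -> 0 < d ->
  exists w, Cmod (w - z) < d /\ F w <> 0.
Proof.
  intros HF Hw Hd.
  destruct (ent_factor_disc F w0 (Cmod z + d) HF Hw) as [rho [l [H [Hr [Hr0 [_ [HE Hz]]]]]]].
  destruct (list_isolated l z) as [e [He Hl]].
  set (x := Rmin d e / 2).
  assert (Hm : 0 < Rmin d e) by (apply Rmin_pos; assumption).
  assert (Hx : 0 < x) by (unfold x; lra).
  assert (Hxd : x < d) by (assert (A := Rmin_l d e); unfold x; lra).
  assert (Hxe : x < e) by (assert (A := Rmin_r d e); unfold x; lra).
  assert (Ex : Cmod (z + RtoC x - z) = x).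
  { replace (z + RtoC x - z)%C with (RtoC x) by ring. apply Cmod_RtoC_nonneg. lra. }
  exists (z + RtoC x)%C. split; [lra|]. rewrite HE. apply Cmult_neq_0.
  - apply lin_prod_neq0; [lra|]. intros Hin.
    assert (K := Hl _ Hin). rewrite Ex in K.
    assert (z + RtoC x <> z)%C by (intros E; rewrite E in Ex; replace (z - z)%C with (RtoC 0) in Ex by ring; rewrite Cmod_0 in Ex; lra).
    specialize (K H0). lra.
  - apply Hz. assert (A := Cmod_triangle_sub (z + RtoC x) z). lra.
Qed.

(** Allows division by F across its zeros. Asking only for continuity of A at one point makes it
    applicable to functions that are holomorphic merely on a disc. *)
Lemma cont_zero_dense (F A : C -> C) (w0 z : C) : ent F -> F w0 <> 0 -> ccont A z ->
  (exists d, 0 < d /\ forall w, Cmod (w - z) < d -> (A w * F w)%C = 0) -> A z = 0.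
Proof.
  intros HF Hw HA [d0 [Hd0 H]]. apply Cmod_eq_0. apply Rle_antisym; [|apply Cmod_ge_0].
  apply le_epsilon. intros e He. rewrite Rplus_0_l.
  destruct (HA e He) as [d [Hd Hc]].
  destruct (ent_nonzero_dense F w0 z (Rmin d d0) HF Hw ltac:(apply Rmin_pos; assumption)) as [w [Hwz HFw]].
  assert (AW : A w = 0).
  { destruct (Ceq_dec (A w) 0) as [|N]; [assumption|]. exfalso.
    apply (Cmult_neq_0 _ _ N HFw). apply H. eapply Rlt_le_trans; [apply Hwz | apply Rmin_r]. }
  specialize (Hc w I (Rlt_le_trans _ _ _ Hwz (Rmin_l _ _))).
  rewrite AW in Hc. rewrite Cmod_minus_sym in Hc. replace (A z - 0)%C with (A z) in Hc by ring. lra.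
Qed.

Lemma ent_cancel (F A B : C -> C) (w0 : C) : ent F -> F w0 <> 0 -> ent A -> ent B ->
  (forall z, (A z * F z = B z * F z)%C) -> forall z, A z = B z.
Proof.
  intros HF Hw HA HB H z. apply Ceq_minus.
  apply (cont_zero_dense F (fun z => A z - B z)%C w0 z HF Hw).
  - apply contD_minus; apply ent_cont; assumption.
  - exists 1. split; [lra|]. intros w _.
    replace ((A w - B w) * F w)%C with (A w * F w - B w * F w)%C by ring. rewrite H. ring.
Qed.

Lemma three_quarters_pow_exp (n : nat) : (3 / 4) ^ n <= exp (- (INR n / 4)).
Proof.
  induction n as [|n IH].
  - simpl. replace (- (0 / 4)) with 0 by field. rewrite exp_0. lra.
  - rewrite S_INR. replace (- ((INR n + 1) / 4)) with (- (1 / 4) + - (INR n / 4)) by field.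
    rewrite exp_plus. simpl pow.
    assert (E := exp_ineq1_le (- (1 / 4))).
    apply Rmult_le_compat; try lra. apply pow_le; lra.
Qed.

(** Everything is governed by the deficit B. It bounds the number of zeros through (3/4)^n <= exp (-
    n / 4), and the size and logarithmic derivative of H through [harnack] and
    [derivative_bound_of_Re_le], applied to a logarithm of H with A = ln M. The 8 in exp 8 is 2 /
    (rho / 4) times the distance from w0 to z, which is at most rho. *)
Theorem local_factor (F : C -> C) (rho M : R) (w0 : C) : ent F -> 0 < rho -> Cmod w0 <= rho / 2 -> F w0 <> 0 ->
  (forall t, 0 <= t <= 2 * PI -> Cmod (F (RtoC (3 * rho) * cis t)%C) <= M) ->
  let B := ln M - ln (Cmod (F w0)) in
  exists l H, ent H /\ (forall z, F z = (lin_prod (2 * rho) l z * H z)%C) /\ (forall a, In a l -> Cmod a <= rho) /\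
    INR (length l) <= 4 * B /\ 0 <= B /\ 0 < M /\
    forall z, Cmod z <= rho / 2 -> H z <> 0 /\ Cmod (H z) <= M /\ ln M - exp 8 * B <= ln (Cmod (H z)) /\
      Cmod (Cder H z) <= 8 * exp 8 / rho * B * Cmod (H z).
Proof.
  intros HF Hr Hw Hw0 HM B.
  destruct (peel F rho M w0 HF Hr Hw Hw0 HM) as [l [H [HH [HE [Hl [Hz [B1 [B2 B3]]]]]]]].
  assert (HF0 : 0 < Cmod (F w0)) by (apply Cmod_gt_0; assumption).
  assert (HMp : 0 < M) by (eapply Rlt_le_trans; [|apply (B2 w0); lra]; lra).
  exists l, H. split; [assumption|]. split; [assumption|]. split; [assumption|].
  assert (Hn : INR (length l) <= 4 * B).
  { assert (A := three_quarters_pow_exp (length l)).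
    assert (A2 : Cmod (F w0) <= exp (- (INR (length l) / 4)) * M).
    { eapply Rle_trans; [apply B1|]. apply Rmult_le_compat_r; lra. }
    apply ln_le in A2; [|assumption].
    rewrite ln_mult, ln_exp in A2 by (try apply exp_pos; assumption). unfold B. lra. }
  assert (HB : 0 <= B).
  { unfold B. assert (A := B2 w0 ltac:(lra)).
    assert (Cmod (F w0) <= M) by lra. apply ln_le in H0; lra. }
  split; [assumption|]. split; [assumption|]. split; [assumption|].
  destruct (holo_log rho H (ent_holo H rho HH) ltac:(intros; apply Hz; lra)) as [L [HL HL2]].
  assert (HA : forall w, Cmod w < rho -> Re (L w) <= ln M).
  { intros w Hwr. rewrite (proj2 (HL2 w Hwr)). apply ln_le; [apply Cmod_gt_0, Hz; lra | apply B2; lra]. }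
  intros z Hzr.
  assert (Hh := harnack rho (rho / 4) (ln M) L w0 z HL HA ltac:(lra) ltac:(lra) ltac:(lra)).
  assert (HzH : 0 < Cmod (H z)) by (apply Cmod_gt_0, Hz; lra).
  rewrite (proj2 (HL2 z ltac:(lra))), (proj2 (HL2 w0 ltac:(lra))) in Hh.
  assert (Hexp : exp (2 / (rho / 4) * Cmod (z - w0)) <= exp 8).
  { assert (2 / (rho / 4) * Cmod (z - w0) <= 8).
    { replace (2 / (rho / 4) * Cmod (z - w0)) with (8 * (Cmod (z - w0) / rho)) by (field; lra).
      assert (Cmod (z - w0) / rho <= 1).
      { apply Rmult_le_reg_r with rho; [assumption|]. unfold Rdiv. rewrite Rmult_assoc, Rinv_l by lra.
        assert (A := Cmod_triangle_minus z w0). lra. }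
      lra. }
    destruct H0 as [H0|H0]; [left; apply exp_increasing; assumption | right; f_equal; assumption]. }
  assert (Hw0H : ln M - ln (Cmod (H w0)) <= B).
  { unfold B. assert (A := ln_le _ _ HF0 B3). lra. }
  assert (Hmain : ln M - ln (Cmod (H z)) <= exp 8 * B).
  { eapply Rle_trans; [apply Hh|]. rewrite (Rmult_comm (exp 8)).
    assert (P := exp_pos (2 / (rho / 4) * Cmod (z - w0))).
    assert (P0 : 0 <= ln M - ln (Cmod (H w0))).
    { assert (A := HA w0 ltac:(lra)). rewrite (proj2 (HL2 w0 ltac:(lra))) in A. lra. }
    apply Rmult_le_compat; lra. }
  split; [apply Hz; lra|]. split; [apply B2; lra|]. split; [lra|].
  assert (Hd := derivative_bound_of_Re_le rho (rho / 4) (ln M) L z _ HL HA ltac:(lra) ltac:(lra) (proj1 (HL2 z ltac:(lra)))).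
  rewrite (proj2 (HL2 z ltac:(lra))) in Hd.
  rewrite Cmod_mult, Cmod_inv in Hd by (apply Hz; lra).
  apply Rmult_le_reg_r with (/ Cmod (H z)); [apply Rinv_0_lt_compat; assumption|].
  eapply Rle_trans; [apply Hd|]. rewrite Rmult_assoc, Rinv_r, Rmult_1_r by lra.
  replace (8 * exp 8 / rho * B) with (2 / (rho / 4) * (exp 8 * B)) by (field; lra).
  apply Rmult_le_compat_l; [|assumption].
  left. apply Rdiv_lt_0_compat; lra.
Qed.

(** * Radii far from the zeros *)

Definition rsum (f : R -> R) (l : list R) : R := fold_right (fun x s => f x + s) 0 l.

Lemma rsum_cons (f : R -> R) (x : R) (l : list R) : rsum f (x :: l) = f x + rsum f l.
Proof. reflexivity. Qed.

Lemma rsum_le (f g : R -> R) (l : list R) : (forall x, In x l -> f x <= g x) -> rsum f l <= rsum g l.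
Proof.
  induction l as [|x l IH]; intros H; [simpl; lra | rewrite !rsum_cons].
  assert (A := H x (or_introl eq_refl)). assert (B := IH (fun y Hy => H y (or_intror Hy))). lra.
Qed.

Lemma rsum_nonneg (f : R -> R) (l : list R) : (forall x, In x l -> 0 <= f x) -> 0 <= rsum f l.
Proof.
  induction l as [|x l IH]; intros H; [simpl; lra | rewrite !rsum_cons].
  assert (A := H x (or_introl eq_refl)). assert (B := IH (fun y Hy => H y (or_intror Hy))). lra.
Qed.

Lemma rsum_mem (f : R -> R) (l : list R) (x : R) : (forall y, In y l -> 0 <= f y) -> In x l -> f x <= rsum f l.
Proof.
  induction l as [|y l IH]; intros H Hx; [destruct Hx | rewrite rsum_cons].
  assert (A := rsum_nonneg f l (fun z Hz => H z (or_intror Hz))).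
  destruct Hx as [->|Hx]; [lra|].
  assert (B := IH (fun z Hz => H z (or_intror Hz)) Hx). assert (C0 := H y (or_introl eq_refl)). lra.
Qed.

Lemma rsum_scal (f : R -> R) (c : R) (l : list R) : rsum (fun x => c * f x) l = c * rsum f l.
Proof. induction l as [|x l IH]; [simpl; ring|]. rewrite !rsum_cons, IH. ring. Qed.

Lemma rsum_minus_le (f g : R -> R) (c : R) (l : list R) : (forall x, In x l -> f x - g x <= c) ->
  rsum f l - rsum g l <= INR (length l) * c.
Proof.
  induction l as [|x l IH]; intros H; [simpl; lra|].
  assert (A := H x (or_introl eq_refl)). assert (B := IH (fun y Hy => H y (or_intror Hy))).
  rewrite !rsum_cons.
  change (length (x :: l)) with (S (length l)). rewrite S_INR. lra.
Qed.

Lemma rsum_app (f : R -> R) (l1 l2 : list R) : rsum f (l1 ++ l2) = rsum f l1 + rsum f l2.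
Proof. induction l1 as [|x l IH]; [simpl; ring|]. simpl app. rewrite !rsum_cons, IH. ring. Qed.

(* A smooth increasing primitive of a function comparable to [1 / sqrt (|t| + e)]. *)
Definition root_primitive (e t : R) : R :=
  sqrt (sqrt (t * t + e * e) + t) - sqrt (sqrt (t * t + e * e) - t).

Definition root_density (e t : R) : R :=
  (sqrt (sqrt (t * t + e * e) + t) + sqrt (sqrt (t * t + e * e) - t)) / (2 * sqrt (t * t + e * e)).

Lemma sqrt_sum_gt_abs (e t : R) : 0 < e -> Rabs t < sqrt (t * t + e * e).
Proof.
  intros He. rewrite <- sqrt_Rsqr_abs. apply sqrt_lt_1; unfold Rsqr; nra.
Qed.

Lemma root_primitive_derive (e t : R) : 0 < e -> is_derive (root_primitive e) t (root_density e t).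
Proof.
  intros He. assert (A := sqrt_sum_gt_abs e t He). apply Rabs_def2 in A.
  unfold root_primitive.
  assert (Hp : 0 < t * t + e * e) by nra.
  auto_derive.
  - repeat split; try assumption; lra.
  - unfold root_density. set (s := sqrt (t * t + e * e)) in *.
    set (p := sqrt (s + t)). set (q := sqrt (s + - t)).
    replace (sqrt (s - t)) with q by (unfold q; f_equal; ring).
    assert (Hpp : 0 < p) by (apply sqrt_lt_R0; lra).
    assert (Hqq : 0 < q) by (apply sqrt_lt_R0; lra).
    assert (Hs : 0 < s) by lra.
    assert (P2 : p * p = s + t) by (apply sqrt_sqrt; lra).
    assert (Q2 : q * q = s - t) by (unfold q; rewrite sqrt_sqrt; lra).
    (* Expressing s and t through p and q makes the identity rational, within reach of [field]. *)
    assert (E1 : s = (p * p + q * q) / 2) by lra. assert (E2 : t = (p * p - q * q) / 2) by lra.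
    rewrite E2, E1. field. repeat split; nra.
Qed.

(** From p p + q q = 2 s follows p + q >= sqrt (2 s), so the density is at least 1 / sqrt (2 s), and
    s <= |t| + e. *)
Lemma root_density_ge (e t : R) : 0 < e -> / sqrt (Rabs t + e) <= sqrt 2 * root_density e t.
Proof.
  intros He. assert (A := sqrt_sum_gt_abs e t He). assert (A' := Rabs_def2 _ _ A).
  unfold root_density. set (s := sqrt (t * t + e * e)) in *.
  set (p := sqrt (s + t)). set (q := sqrt (s - t)).
  assert (Hpp : 0 < p) by (apply sqrt_lt_R0; lra).
  assert (Hqq : 0 < q) by (apply sqrt_lt_R0; lra).
  assert (P2 : p * p = s + t) by (apply sqrt_sqrt; lra).
  assert (Q2 : q * q = s - t) by (apply sqrt_sqrt; lra).
  assert (Hs : 0 < s) by (assert (B := Rabs_pos t); lra).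
  assert (Hse : s <= Rabs t + e).
  { assert (B := Rabs_pos t). rewrite <- (sqrt_Rsqr (Rabs t + e)) by lra. apply sqrt_le_1; unfold Rsqr; try nra.
    assert (E : Rabs t * Rabs t = t * t) by (rewrite <- Rabs_mult; apply Rabs_pos_eq; nra). nra. }
  apply Rle_trans with (/ sqrt s).
  { apply Rinv_le_contravar; [apply sqrt_lt_R0; assumption | apply sqrt_le_1; lra]. }
  assert (Hss : 0 < sqrt s) by (apply sqrt_lt_R0; assumption).
  assert (Es : sqrt s * sqrt s = s) by (apply sqrt_sqrt; lra).
  assert (Hpq : sqrt 2 * sqrt s <= p + q).
  { rewrite <- sqrt_mult by lra. rewrite <- (sqrt_Rsqr (p + q)) by lra. apply sqrt_le_1; unfold Rsqr; nra. }
  assert (H2 : 0 < sqrt 2) by (apply sqrt_lt_R0; lra).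
  assert (E2 : sqrt 2 * sqrt 2 = 2) by (apply sqrt_sqrt; lra).
  apply Rmult_le_reg_r with (2 * s); [lra|].
  replace (sqrt 2 * ((p + q) / (2 * s)) * (2 * s)) with (sqrt 2 * (p + q)) by (field; lra).
  replace (/ sqrt s * (2 * s)) with (2 * sqrt s) by (rewrite <- Es at 3; field; lra).
  nra.
Qed.

Lemma sqrt_diff_le (x y : R) : 0 <= x -> 0 <= y -> sqrt y - sqrt x <= sqrt (Rmax 0 (y - x)).
Proof.
  intros Hx Hy.
  assert (A := sqrt_pos x). assert (B := sqrt_pos (Rmax 0 (y - x))).
  assert (Ex : sqrt x * sqrt x = x) by (apply sqrt_sqrt; lra).
  assert (Ey : sqrt y * sqrt y = y) by (apply sqrt_sqrt; lra).
  assert (Em : sqrt (Rmax 0 (y - x)) * sqrt (Rmax 0 (y - x)) = Rmax 0 (y - x)) by (apply sqrt_sqrt, Rmax_l).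
  assert (M := Rmax_r 0 (y - x)).
  assert (sqrt y <= sqrt x + sqrt (Rmax 0 (y - x))); [|lra].
  rewrite <- (sqrt_Rsqr (sqrt x + sqrt (Rmax 0 (y - x)))) by lra. apply sqrt_le_1; unfold Rsqr; nra.
Qed.

Lemma sqrt_sum_lipschitz (e t u : R) : 0 < e -> Rabs (sqrt (u * u + e * e) - sqrt (t * t + e * e)) <= Rabs (u - t).
Proof.
  intros He.
  assert (A := sqrt_sum_gt_abs e t He). assert (B := sqrt_sum_gt_abs e u He).
  set (s := sqrt (t * t + e * e)) in *. set (v := sqrt (u * u + e * e)) in *.
  assert (Es : s * s = t * t + e * e) by (apply sqrt_sqrt; nra).
  assert (Ev : v * v = u * u + e * e) by (apply sqrt_sqrt; nra).
  assert (At := Rabs_pos t). assert (Au := Rabs_pos u).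
  apply Rmult_le_reg_r with (v + s); [lra|].
  rewrite <- (Rabs_pos_eq (v + s)) at 1 by lra. rewrite <- Rabs_mult.
  replace ((v - s) * (v + s)) with ((u - t) * (u + t)) by lra.
  rewrite Rabs_mult. apply Rmult_le_compat_l; [apply Rabs_pos|].
  eapply Rle_trans; [apply Rabs_triang | lra].
Qed.

(** The square root is Holder continuous of exponent 1/2 and each outer argument moves by at most 2
    d. The bound is uniform in e, which leaves e free to depend on the number of points. *)
Lemma root_primitive_increment (e t d : R) : 0 < e -> 0 <= d ->
  root_primitive e (t + d) - root_primitive e t <= 2 * sqrt (2 * d).
Proof.
  intros He Hd. unfold root_primitive.
  assert (A := sqrt_sum_gt_abs e t He). assert (B := sqrt_sum_gt_abs e (t + d) He).
  assert (L := sqrt_sum_lipschitz e t (t + d) He).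
  replace (t + d - t) with d in L by ring. rewrite (Rabs_pos_eq d) in L by assumption.
  set (s := sqrt (t * t + e * e)) in *. set (v := sqrt ((t + d) * (t + d) + e * e)) in *.
  apply Rabs_def2 in A. apply Rabs_def2 in B. apply Rabs_le_between in L.
  assert (H1 := sqrt_diff_le (s + t) (v + (t + d)) ltac:(lra) ltac:(lra)).
  assert (H2 := sqrt_diff_le (v - (t + d)) (s - t) ltac:(lra) ltac:(lra)).
  assert (K : forall x, x <= 2 * d -> sqrt (Rmax 0 x) <= sqrt (2 * d)).
  { intros x Hx. apply sqrt_le_1; [apply Rmax_l | lra | apply Rmax_lub; lra]. }
  assert (K1 := K (v + (t + d) - (s + t)) ltac:(lra)).
  assert (K2 := K (s - t - (v - (t + d))) ltac:(lra)). lra.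
Qed.

Lemma rsum_derive (K k : R -> R) (l : list R) (r : R) : (forall t, is_derive K t (k t)) ->
  is_derive (fun r => rsum (fun x => K (r - x)) l) r (rsum (fun x => k (r - x)) l).
Proof.
  intros HK. induction l as [|x l IH].
  - simpl. apply (@is_derive_const R_AbsRing R_NormedModule).
  - apply (@is_derive_plus R_AbsRing R_NormedModule (fun r => K (r - x)) (fun r => rsum (fun x => K (r - x)) l)); [|exact IH].
    replace (k (r - x)) with (scal 1 (k (r - x))) by (apply Rmult_1_l).
    apply (@is_derive_comp R_AbsRing R_NormedModule K (fun r => r - x)); [apply HK|].
    auto_derive; [exact I | ring].
Qed.

(** The exponent 1/2 is integrable in r, so a typical radius gives a small sum. When r lies in l a
    term is / 0, and therefore statements about this sum exclude that case separately. *)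
Definition root_sum (l : list R) (r : R) : R := rsum (fun x => / sqrt (Rabs (r - x))) l.

(** The mean value theorem replaces averaging over r: for the sum of the [root_primitive e (r - x)]
    on [a, 2 a] it yields a radius at which the sum of the densities is at most its mean, O(n / sqrt
    a). *)
Theorem good_radius (l : list R) (a : R) : 0 < a ->
  exists r, a <= r <= 2 * a /\ (forall x, In x l -> x <> r) /\
    root_sum l r <= 8 * INR (length l) / sqrt a.
Proof.
  intros Ha.
  assert (Hsa : 0 < sqrt a) by (apply sqrt_lt_R0; assumption).
  assert (Esa : sqrt a * sqrt a = a) by (apply sqrt_sqrt; lra).
  destruct l as [|x0 l0].
  { exists a. split; [lra|]. split; [intros x []|]. unfold root_sum; simpl. unfold Rdiv. rewrite Rmult_0_r, Rmult_0_l. lra. }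
  set (l := x0 :: l0). set (n := INR (length l)).
  assert (Hn : 1 <= n) by (unfold n, l; simpl length; rewrite S_INR; assert (A := pos_INR (length l0)); lra).
  (* The bound on the smoothed sum will give |r - x| + e >= a / (16 n^2) = 2 e for each x in l. Then
     |r - x| >= e, and removing e from the denominators at most doubles the sum. *)
  set (e := a / (32 * (n * n))).
  assert (He : 0 < e) by (apply Rdiv_lt_0_compat; nra).
  destruct (mvt_closed (fun r => rsum (fun x => root_primitive e (r - x)) l)
     (fun r => rsum (fun x => root_density e (r - x)) l) a (2 * a) ltac:(lra)) as [r [Hr E]].
  { intros r _. apply rsum_derive. intros t. apply root_primitive_derive. assumption. }
  assert (Hinc : rsum (fun x => root_primitive e (2 * a - x)) l - rsum (fun x => root_primitive e (a - x)) l
     <= n * (2 * sqrt (2 * a))).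
  { apply rsum_minus_le. intros x _. replace (2 * a - x) with ((a - x) + a) by ring.
    apply root_primitive_increment; lra. }
  rewrite E in Hinc.
  assert (Hge : rsum (fun x => / sqrt (Rabs (r - x) + e)) l <= sqrt 2 * rsum (fun x => root_density e (r - x)) l).
  { rewrite <- rsum_scal. apply rsum_le. intros x _. apply root_density_ge. assumption. }
  set (D := rsum (fun x => root_density e (r - x)) l) in *.
  assert (H2 : 0 < sqrt 2) by (apply sqrt_lt_R0; lra).
  assert (E2 : sqrt 2 * sqrt 2 = 2) by (apply sqrt_sqrt; lra).
  rewrite sqrt_mult in Hinc by lra.
  assert (HD : sqrt 2 * D * sqrt a <= 4 * n).
  { apply Rmult_le_reg_r with (sqrt a); [assumption|].
    apply (Rmult_le_compat_l (sqrt 2)) in Hinc; [|lra].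
    replace (sqrt 2 * D * sqrt a * sqrt a) with (sqrt 2 * D * a) by (rewrite <- Esa at 1; ring).
    replace (sqrt 2 * (n * (2 * (sqrt 2 * sqrt a)))) with (sqrt 2 * sqrt 2 * (2 * n * sqrt a)) in Hinc by ring.
    rewrite E2 in Hinc. lra. }
  assert (Hsum : rsum (fun x => / sqrt (Rabs (r - x) + e)) l * sqrt a <= 4 * n) by nra.
  assert (Hfar : forall x, In x l -> e <= Rabs (r - x)).
  { intros x Hx.
    assert (Hpos : forall y, 0 < Rabs (r - y) + e) by (intros y; assert (A := Rabs_pos (r - y)); lra).
    assert (Hm := rsum_mem (fun x => / sqrt (Rabs (r - x) + e)) l x
      (fun y _ => Rlt_le _ _ (Rinv_0_lt_compat _ (sqrt_lt_R0 _ (Hpos y)))) Hx). cbv beta in Hm.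
    set (s := sqrt (Rabs (r - x) + e)) in *.
    assert (Hs : 0 < s) by (apply sqrt_lt_R0, Hpos).
    assert (Es : s * s = Rabs (r - x) + e) by (apply sqrt_sqrt; specialize (Hpos x); lra).
    assert (Q : sqrt a <= 4 * n * s).
    { apply Rmult_le_reg_l with (/ s); [apply Rinv_0_lt_compat; assumption|].
      replace (/ s * (4 * n * s)) with (4 * n) by (field; lra). nra. }
    assert (Q2 : a <= 16 * (n * n) * (s * s)) by nra.
    assert (Ee : e * (32 * (n * n)) = a) by (unfold e; field; lra).
    assert (Hnn : 0 < n * n) by nra.
    assert (2 * e <= s * s) by nra. lra. }
  exists r. split; [assumption|]. split.
  + intros x Hx E0. specialize (Hfar x Hx). rewrite E0, Rminus_diag, Rabs_R0 in Hfar. lra.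
  + apply Rle_trans with (2 * rsum (fun x => / sqrt (Rabs (r - x) + e)) l).
    * unfold root_sum. rewrite <- rsum_scal. apply rsum_le. intros x Hx. specialize (Hfar x Hx).
      set (d := Rabs (r - x)) in *.
      replace (2 * / sqrt (d + e)) with (/ (sqrt (d + e) / 2)).
      2:{ field. apply Rgt_not_eq, sqrt_lt_R0. lra. }
      apply Rinv_le_contravar.
      -- assert (0 < sqrt (d + e)) by (apply sqrt_lt_R0; lra). lra.
      -- replace (sqrt (d + e) / 2) with (sqrt ((d + e) / 4)).
         ++ apply sqrt_le_1; lra.
         ++ unfold Rdiv. rewrite sqrt_mult by lra. f_equal.
            replace (/ 4) with (Rsqr (/ 2)) by (unfold Rsqr; field). apply sqrt_Rsqr. lra.
    * apply Rmult_le_reg_r with (sqrt a); [assumption|].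
      unfold Rdiv. rewrite (Rmult_assoc (8 * n)), Rinv_l by lra. lra.
Qed.

(** * Growth *)

(* Order [k / 2] up to a logarithm; at [k = 0] it is the growth of polynomials. *)
Definition gauge (k : nat) (x : R) : R := (1 + ln x) * sqrt x ^ k.

Lemma ln_nonneg (x : R) : 1 <= x -> 0 <= ln x.
Proof. intros H. rewrite <- ln_1. apply ln_le; lra. Qed.

Lemma sqrt_ge_1 (x : R) : 1 <= x -> 1 <= sqrt x.
Proof. intros H. rewrite <- sqrt_1. apply sqrt_le_1; lra. Qed.

Lemma gauge_ge_1 (k : nat) (x : R) : 1 <= x -> 1 <= gauge k x.
Proof.
  intros H. unfold gauge. assert (A := ln_nonneg x H). assert (B := pow_R1_Rle (sqrt x) k (sqrt_ge_1 x H)). nra.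
Qed.

Lemma gauge_mono (k : nat) (x y : R) : 1 <= x -> x <= y -> gauge k x <= gauge k y.
Proof.
  intros H Hxy. unfold gauge. apply Rmult_le_compat.
  - assert (A := ln_nonneg x H). lra.
  - apply pow_le, sqrt_pos.
  - assert (A := ln_le x y ltac:(lra) Hxy). lra.
  - apply pow_incr. split; [apply sqrt_pos | apply sqrt_le_1; lra].
Qed.

(** Submultiplicativity turns every change of scale, such as a larger circle or a shift of the
    argument, into a constant factor. *)
Lemma gauge_mult (k : nat) (x y : R) : 1 <= x -> 1 <= y -> gauge k (x * y) <= gauge k x * gauge k y.
Proof.
  intros Hx Hy. unfold gauge. rewrite ln_mult, sqrt_mult, Rpow_mult_distr by lra.
  assert (A := ln_nonneg x Hx). assert (B := ln_nonneg y Hy).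
  assert (P := pow_le (sqrt x) k (sqrt_pos x)). assert (Q := pow_le (sqrt y) k (sqrt_pos y)).
  assert (0 <= sqrt x ^ k * sqrt y ^ k) by (apply Rmult_le_pos; assumption).
  replace ((1 + ln x) * sqrt x ^ k * ((1 + ln y) * sqrt y ^ k)) with
    ((1 + ln x) * (1 + ln y) * (sqrt x ^ k * sqrt y ^ k)) by ring.
  apply Rmult_le_compat_r; [assumption|]. nra.
Qed.

Lemma gauge_S (k : nat) (x : R) : gauge (S k) x = gauge k x * sqrt x.
Proof. unfold gauge. simpl. ring. Qed.

Lemma gauge_le_S (k : nat) (x : R) : 1 <= x -> gauge k x <= gauge (S k) x.
Proof. intros H. rewrite gauge_S. assert (A := gauge_ge_1 k x H). assert (B := sqrt_ge_1 x H). nra. Qed.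

Lemma gauge0_le (k : nat) (x : R) : 1 <= x -> gauge 0 x <= gauge k x.
Proof. intros H. induction k as [|k IH]; [lra|]. eapply Rle_trans; [apply IH | apply gauge_le_S, H]. Qed.

Lemma exp_le (x y : R) : x <= y -> exp x <= exp y.
Proof. intros [H|H]; [left; apply exp_increasing, H | right; f_equal; exact H]. Qed.

(** Serves to absorb the polynomial bounds on logarithmic derivatives into exp (O(gauge 0)). *)
Lemma gauge_le_exp (k : nat) (x : R) : 1 <= x -> gauge k x <= exp ((1 + INR k) * gauge 0 x).
Proof.
  intros H. unfold gauge at 2. simpl pow. rewrite Rmult_1_r.
  assert (A := ln_nonneg x H).
  apply Rle_trans with (exp ((1 + INR k) * ln x)).
  - rewrite Rmult_plus_distr_r, Rmult_1_l, exp_plus, exp_ln by lra.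
    unfold gauge. apply Rmult_le_compat.
    + lra.
    + apply pow_le, sqrt_pos.
    + assert (E := exp_ineq1_le (ln x)). rewrite exp_ln in E by lra. lra.
    + rewrite <- ln_pow, exp_ln by (try apply pow_lt; lra). apply pow_incr. split; [apply sqrt_pos|].
      assert (B := sqrt_ge_1 x H). assert (E := sqrt_sqrt x ltac:(lra)). nra.
  - apply exp_le. assert (B := pos_INR k). nra.
Qed.

(** log M(r, F) = O(gauge k); the argument 1 + |z| stays in the range where [gauge] is monotone and
    at least 1. *)
Definition small (k : nat) (F : C -> C) : Prop :=
  exists K, 0 <= K /\ forall z, Cmod (F z) <= exp (K * gauge k (1 + Cmod z)).

Lemma sqr_le_exp (y : R) : 0 <= y -> y * y <= exp (2 * y).
Proof.
  intros H. replace (2 * y) with (y + y) by ring. rewrite exp_plus.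
  assert (E := exp_ineq1_le y). apply Rmult_le_compat; lra.
Qed.

Lemma le_exp_sqrt (x : R) : 0 <= x -> x <= exp (2 * sqrt x).
Proof. intros H. rewrite <- (sqrt_sqrt x) at 1 by assumption. apply sqr_le_exp, sqrt_pos. Qed.

(** With x = |eta| / d this charges the effect of a shift on a zero at distance d to d^(-1/2), a
    term of [root_sum]. *)
Lemma one_plus_le_exp_sqrt (x : R) : 0 <= x -> 1 + x <= exp (2 * sqrt x).
Proof.
  intros H. assert (E := exp_ineq1_le (sqrt x)). assert (P := sqrt_pos x).
  replace (2 * sqrt x) with (sqrt x + sqrt x) by ring. rewrite exp_plus.
  assert (Q := sqrt_sqrt x H). nra.
Qed.

Lemma root_sum_cons (x : R) (l : list R) (r : R) :
  root_sum (x :: l) r = / sqrt (Rabs (r - x)) + root_sum l r.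
Proof. reflexivity. Qed.

Lemma root_sum_nonneg (l : list R) (r : R) : (forall x, In x l -> x <> r) -> 0 <= root_sum l r.
Proof.
  intros H. apply rsum_nonneg. intros x Hx. left. apply Rinv_0_lt_compat, sqrt_lt_R0, Rabs_pos_lt.
  specialize (H x Hx). lra.
Qed.

Lemma Cmod_minus_ge (z a : C) : Rabs (Cmod z - Cmod a) <= Cmod (z - a).
Proof.
  assert (A := Cmod_triangle_sub z a). assert (B := Cmod_triangle_sub a z).
  rewrite (Cmod_minus_sym a) in B. apply Rabs_le. lra.
Qed.

(** Since |z - a| >= ||z| - |a||, the moduli of the zeros suffice, and s / d <= exp (2 sqrt (s / d))
    converts each inverse factor into a term of [root_sum]. *)
Lemma lin_prod_inv_bound (s : R) (l : list C) (z : C) : 0 < s -> (forall a, In a l -> Cmod a <> Cmod z) ->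
  / Cmod (lin_prod s l z) <= exp (2 * sqrt s * root_sum (map Cmod l) (Cmod z)).
Proof.
  intros Hs. induction l as [|a l IH]; intros H.
  - simpl. rewrite Cmod_1, Rmult_0_r, exp_0. lra.
  - simpl map. rewrite lin_prod_cons, root_sum_cons, Cmod_mult, Cmod_factor by assumption.
    specialize (IH (fun b Hb => H b (or_intror Hb))).
    assert (Hne := H a (or_introl eq_refl)).
    assert (Hd : 0 < Rabs (Cmod z - Cmod a)) by (apply Rabs_pos_lt; lra).
    assert (Hza := Cmod_minus_ge z a).
    rewrite Rmult_plus_distr_l, exp_plus, Rinv_mult.
    apply Rmult_le_compat.
    + left. apply Rinv_0_lt_compat, Rdiv_lt_0_compat; lra.
    + left. apply Rinv_0_lt_compat, Cmod_gt_0, lin_prod_neq0; [assumption|].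
      intros K. apply (H z (or_intror K)). reflexivity.
    + set (d := Rabs (Cmod z - Cmod a)) in *.
      replace (2 * sqrt s * / sqrt d) with (2 * sqrt (s / d)).
      * eapply Rle_trans; [|apply le_exp_sqrt; left; apply Rdiv_lt_0_compat; assumption].
        unfold Rdiv. rewrite Rinv_mult, Rinv_inv, Rmult_comm.
        apply Rmult_le_compat_l; [lra|]. apply Rinv_le_contravar; assumption.
      * rewrite sqrt_div_alt by assumption. unfold Rdiv. ring.
    + exact IH.
Qed.

Lemma lin_prod_shift_bound (s : R) (l : list C) (z eta : C) : 0 < s -> (forall a, In a l -> Cmod a <> Cmod z) ->
  Cmod (lin_prod s l (z + eta)) <= Cmod (lin_prod s l z) * exp (2 * sqrt (Cmod eta) * root_sum (map Cmod l) (Cmod z)).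
Proof.
  intros Hs. assert (He := Cmod_ge_0 eta). induction l as [|a l IH]; intros H.
  - simpl. rewrite Cmod_1, Rmult_0_r, exp_0. lra.
  - simpl map. rewrite !lin_prod_cons, root_sum_cons, !Cmod_mult.
    specialize (IH (fun b Hb => H b (or_intror Hb))).
    assert (Hne := H a (or_introl eq_refl)).
    assert (Hd : 0 < Rabs (Cmod z - Cmod a)) by (apply Rabs_pos_lt; lra).
    assert (Hza := Cmod_minus_ge z a).
    rewrite Rmult_plus_distr_l, exp_plus.
    set (d := Rabs (Cmod z - Cmod a)) in *.
    assert (B : Cmod (z + eta - a) <= Cmod (z - a) * exp (2 * sqrt (Cmod eta) * / sqrt d)).
    { replace (z + eta - a)%C with ((z - a) + eta)%C by ring.
      eapply Rle_trans; [apply Cmod_triangle|].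
      replace (2 * sqrt (Cmod eta) * / sqrt d) with (2 * sqrt (Cmod eta / d)).
      - eapply Rle_trans; [|apply Rmult_le_compat_l; [apply Cmod_ge_0 | apply one_plus_le_exp_sqrt]].
        + rewrite Rmult_plus_distr_l, Rmult_1_r. apply Rplus_le_compat_l.
          replace (Cmod eta) with (d * (Cmod eta / d)) at 1 by (field; lra).
          apply Rmult_le_compat_r; [|assumption]. apply Rmult_le_pos; [assumption|]. left. apply Rinv_0_lt_compat, Hd.
        + apply Rmult_le_pos; [assumption|]. left. apply Rinv_0_lt_compat, Hd.
      - rewrite sqrt_div_alt by assumption. unfold Rdiv. ring. }
    assert (Hsi := Cmod_ge_0 (RtoC (/ s))).
    apply Rle_trans with (Cmod (z - a) * exp (2 * sqrt (Cmod eta) * / sqrt d) * Cmod (RtoC (/ s)) *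
      (Cmod (lin_prod s l z) * exp (2 * sqrt (Cmod eta) * root_sum (map Cmod l) (Cmod z)))); [|right; ring].
    apply Rmult_le_compat; [|apply Cmod_ge_0| |assumption].
    + apply Rmult_le_pos; [apply Cmod_ge_0 | assumption].
    + apply Rmult_le_compat_r; assumption.
Qed.

(** A zero contributes at most 1 / d = (1 / sqrt d)^2 to the logarithmic derivative, and a sum of
    squares of positive terms is at most the square of the sum. The radius chosen for [root_sum]
    thus controls derivatives too. *)
Lemma lin_prod_deriv_bound (s : R) (l : list C) (z : C) : 0 < s -> (forall a, In a l -> Cmod a <> Cmod z) ->
  exists m, cderiv (lin_prod s l) z m /\
    Cmod m <= Cmod (lin_prod s l z) * (root_sum (map Cmod l) (Cmod z) * root_sum (map Cmod l) (Cmod z)).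
Proof.
  intros Hs. induction l as [|a l IH]; intros H.
  - exists 0. split; [apply derivD_const|]. rewrite Cmod_0. simpl. lra.
  - destruct (IH (fun b Hb => H b (or_intror Hb))) as [m [Hm Bm]].
    exists (RtoC (/ s) * lin_prod s l z + (z - a) * RtoC (/ s) * m)%C. split.
    + eapply derivD_eq.
      * apply (derivD_mult _ (fun z => (z - a) * RtoC (/ s))%C (lin_prod s l)); [|exact Hm].
        apply (derivD_mult _ (fun z => z - a)%C (fun _ => RtoC (/ s))); [|apply derivD_const].
        apply derivD_minus; [apply derivD_id | apply derivD_const].
      * cbv beta. ring.
    + simpl map. rewrite lin_prod_cons, root_sum_cons, !Cmod_mult.
      assert (Hne := H a (or_introl eq_refl)).
      assert (Hd : 0 < Rabs (Cmod z - Cmod a)) by (apply Rabs_pos_lt; lra).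
      assert (Hza := Cmod_minus_ge z a).
      set (d := Rabs (Cmod z - Cmod a)) in *.
      assert (HT : 0 <= root_sum (map Cmod l) (Cmod z)).
      { apply root_sum_nonneg. intros x Hx. apply in_map_iff in Hx. destruct Hx as [b [<- Hb]].
        apply H. right. exact Hb. }
      set (T := root_sum (map Cmod l) (Cmod z)) in *.
      assert (Hu : 0 < / sqrt d) by (apply Rinv_0_lt_compat, sqrt_lt_R0, Hd).
      assert (Eu : / sqrt d * / sqrt d * d = 1).
      { rewrite <- Rinv_mult, sqrt_sqrt by lra. field. lra. }
      set (u := / sqrt d) in *. set (x := Cmod (z - a)) in *.
      assert (Hsi := Cmod_ge_0 (RtoC (/ s))). set (i := Cmod (RtoC (/ s))) in *.
      assert (Hp := Cmod_ge_0 (lin_prod s l z)). set (p := Cmod (lin_prod s l z)) in *.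
      eapply Rle_trans; [apply Cmod_triangle|]. rewrite !Cmod_mult. fold i p x.
      assert (Hip : 0 <= i * p) by (apply Rmult_le_pos; assumption).
      assert (X1 : i * p <= i * p * (u * u * x)).
      { assert (1 <= u * u * x) by (rewrite <- Eu; apply Rmult_le_compat_l; nra). nra. }
      assert (Hxi : 0 <= x * i) by nra.
      assert (X2 : x * i * Cmod m <= x * i * (p * (T * T))) by (apply Rmult_le_compat_l; assumption).
      assert (X3 : 0 <= x * i * p * (2 * u * T)) by (repeat apply Rmult_le_pos; lra).
      nra.
Qed.

Lemma growth_along_segment (H : C -> C) (z w : C) (K : R) : ent H -> 0 <= K ->
  (forall t, 0 <= t <= 1 -> H (z + RtoC t * (w - z))%C <> 0 /\
     Cmod (Cder H (z + RtoC t * (w - z))%C) <= K * Cmod (H (z + RtoC t * (w - z))%C)) ->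
  Cmod (H w) <= Cmod (H z) * exp (K * Cmod (w - z)).
Proof.
  intros HH HK Hseg.
  set (p := fun t => (z + RtoC t * (w - z))%C).
  assert (D : forall t, 0 <= t <= 1 -> is_derive (fun t => ln (Cmod (H (p t)))) t (Re (Cder H (p t) * (w - z) * / H (p t)))).
  { intros t Ht. apply (is_derive_ln_Cmod (fun t => H (p t))); [apply (Hseg t Ht)|].
    apply (rderiv_comp H); [apply ent_Cder_spec, HH | apply rderiv_line]. }
  destruct (mvt_closed _ _ 0 1 ltac:(lra) D) as [x [Hx E]].
  assert (P1 : p 1 = w) by (unfold p; ring). assert (P0 : p 0 = z) by (unfold p; ring).
  rewrite P1, P0, Rminus_0_r, Rmult_1_r in E.
  destruct (Hseg x Hx) as [S1 S2]. fold (p x) in S1, S2.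
  assert (Hw0 : 0 < Cmod (H w)). { rewrite <- P1. apply Cmod_gt_0. apply (Hseg 1); lra. }
  assert (Hz0 : 0 < Cmod (H z)). { rewrite <- P0. apply Cmod_gt_0. apply (Hseg 0); lra. }
  assert (B : ln (Cmod (H w)) - ln (Cmod (H z)) <= K * Cmod (w - z)).
  { rewrite E. eapply Rle_trans; [apply Rle_abs|]. eapply Rle_trans; [apply re_le_Cmod|].
    rewrite !Cmod_mult, Cmod_inv by assumption.
    assert (Hx0 : 0 < Cmod (H (p x))) by (apply Cmod_gt_0; assumption).
    apply Rmult_le_reg_r with (Cmod (H (p x))); [assumption|].
    rewrite Rmult_assoc, Rinv_l, Rmult_1_r by lra.
    assert (A := Cmod_ge_0 (w - z)). nra. }
  rewrite <- (exp_ln _ Hw0), <- (exp_ln _ Hz0), <- exp_plus. apply exp_le. lra.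
Qed.

(* The zeros enter only through [root_sum], so that one radius can later serve two functions. *)
Theorem circle_estimates (F : C -> C) (k : nat) (eta w0 : C) : ent F -> F w0 <> 0 -> small k F ->
  exists K a0, 0 <= K /\ 1 <= a0 /\ forall a, a0 <= a -> exists l : list R,
    INR (length l) <= K * gauge k a /\
    forall r, a <= r <= 2 * a -> (forall x, In x l -> x <> r) -> forall z, Cmod z = r ->
      F z <> 0 /\ / Cmod (F z) <= exp (K * (gauge k a + sqrt a * root_sum l r)) /\
      Cmod (Cder F z) <= Cmod (F z) * (root_sum l r * root_sum l r + K * gauge k a) /\
      Cmod (F (z + eta)%C) <= Cmod (F z) * exp (K * (root_sum l r + gauge k a / a)).
Proof.
  intros HF Hw0 [K0 [HK0 Hsm]].
  (* The factorisation below uses rho = 8 a, hence the circle |z| = 24 a, and 1 + 24 a <= 25 a. K1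
     is made so that B <= K1 * gauge k a. *)
  set (K1 := K0 * gauge k 25 + Rabs (ln (Cmod (F w0)))).
  assert (L25 := gauge_ge_1 k 25 ltac:(lra)).
  assert (HK1 : 0 <= K1) by (unfold K1; assert (A := Rabs_pos (ln (Cmod (F w0)))); nra).
  assert (E8 : 1 <= exp 8) by (assert (A := exp_ineq1_le 8); lra).
  assert (He := Cmod_ge_0 eta). assert (Hw := Cmod_ge_0 w0).
  set (K := (8 + 8 * exp 8 + 2 * sqrt (Cmod eta)) * (1 + K1) * (1 + Cmod eta)).
  assert (Hsq := sqrt_pos (Cmod eta)).
  assert (HKa : 8 + 8 * exp 8 + 2 * sqrt (Cmod eta) <= K).
  { unfold K. assert (0 <= (8 + 8 * exp 8 + 2 * sqrt (Cmod eta)) * K1) by (apply Rmult_le_pos; lra).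
    assert (0 <= (8 + 8 * exp 8 + 2 * sqrt (Cmod eta)) * (1 + K1) * Cmod eta) by (repeat apply Rmult_le_pos; lra).
    lra. }
  assert (HKb : 8 * exp 8 * K1 * (1 + Cmod eta) <= K).
  { unfold K. apply Rmult_le_compat_r; [lra|]. apply Rmult_le_compat; lra. }
  assert (HKc : 8 * K1 <= K).
  { eapply Rle_trans; [|apply HKb]. assert (0 <= K1 * Cmod eta) by (apply Rmult_le_pos; lra).
    assert (1 * (K1 * (1 + Cmod eta)) <= exp 8 * (K1 * (1 + Cmod eta))) by (apply Rmult_le_compat_r; [nra|lra]). lra. }
  assert (HKd : 8 * exp 8 * K1 <= K).
  { eapply Rle_trans; [|apply HKb]. assert (0 <= exp 8 * K1) by (apply Rmult_le_pos; lra). nra. }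
  set (a0 := 1 + Cmod eta + Cmod w0).
  exists K, a0. split; [lra|]. split; [unfold a0; lra|]. intros a Ha.
  assert (Ha1 : 1 <= a) by (unfold a0 in Ha; lra).
  assert (La := gauge_ge_1 k a Ha1). set (la := gauge k a) in *.
  set (M := exp (K0 * gauge k 25 * la)).
  (* With rho = 8 a the estimates hold on |z| <= 4 a. This contains the circles of radius at most 2
     a together with their shifts by eta, because |eta| < a. *)
  destruct (local_factor F (8 * a) M w0 HF ltac:(lra) ltac:(unfold a0 in Ha; lra) Hw0) as
    [l [H [HH [HE [Hl [Hn [HB [HM Hz]]]]]]]].
  { intros t _. eapply Rle_trans; [apply Hsm|]. apply exp_le. rewrite Cmod_circle by lra.
    rewrite Rmult_assoc. apply Rmult_le_compat_l; [assumption|].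
    eapply Rle_trans; [apply (gauge_mono k _ (25 * a)); lra|]. apply gauge_mult; lra. }
  set (B := ln M - ln (Cmod (F w0))) in *.
  assert (HBK : B <= K1 * la).
  { unfold B, M. rewrite ln_exp. unfold K1. rewrite Rmult_plus_distr_r.
    assert (A := Rle_abs (- ln (Cmod (F w0)))). rewrite Rabs_Ropp in A.
    assert (A2 := Rabs_pos (ln (Cmod (F w0)))). nra. }
  assert (HM1 : 0 <= ln M).
  { unfold M. rewrite ln_exp. apply Rmult_le_pos; [apply Rmult_le_pos|]; lra. }
  exists (map Cmod l). rewrite length_map. split; [nra|].
  intros r Hr Hne z Hzr.
  assert (Hne' : forall b, In b l -> Cmod b <> Cmod z).
  { intros b Hb. rewrite Hzr. apply Hne, in_map, Hb. }
  rewrite <- Hzr.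
  assert (HT := root_sum_nonneg (map Cmod l) (Cmod z) ltac:(rewrite Hzr; exact Hne)).
  set (T := root_sum (map Cmod l) (Cmod z)) in *.
  destruct (Hz z ltac:(lra)) as [Z1 [Z2 [Z3 Z4]]].
  assert (HHz : 0 < Cmod (H z)) by (apply Cmod_gt_0; assumption).
  assert (Hlp : lin_prod (2 * (8 * a)) l z <> 0).
  { apply lin_prod_neq0; [lra|]. intros Hin. apply (Hne' z Hin). reflexivity. }
  assert (Hlp0 : 0 < Cmod (lin_prod (2 * (8 * a)) l z)) by (apply Cmod_gt_0; assumption).
  assert (Hsa := sqrt_pos a).
  split; [|split; [|split]].
  - rewrite HE. apply Cmult_neq_0; assumption.
  - rewrite HE, Cmod_mult, Rinv_mult.
    assert (I1 := lin_prod_inv_bound (2 * (8 * a)) l z ltac:(lra) Hne'). fold T in I1.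
    assert (I2 : / Cmod (H z) <= exp (exp 8 * K1 * la)).
    { rewrite <- (exp_ln (Cmod (H z))), <- exp_Ropp by assumption. apply exp_le.
      assert (exp 8 * B <= exp 8 * (K1 * la)) by (apply Rmult_le_compat_l; lra). lra. }
    eapply Rle_trans.
    + apply Rmult_le_compat; [| |apply I1 | apply I2]; left; apply Rinv_0_lt_compat; assumption.
    + rewrite <- exp_plus. apply exp_le.
      replace (sqrt (2 * (8 * a))) with (4 * sqrt a).
      * assert (0 <= sqrt a * T) by (apply Rmult_le_pos; assumption).
        assert (8 * (sqrt a * T) <= K * (sqrt a * T)) by (apply Rmult_le_compat_r; lra).
        assert (exp 8 * K1 * la <= K * la).
        { apply Rmult_le_compat_r; [lra|]. assert (0 <= exp 8 * K1) by (apply Rmult_le_pos; lra). lra. }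
        lra.
      * replace (2 * (8 * a)) with (4 * 4 * a) by ring. rewrite sqrt_mult, sqrt_square by lra. reflexivity.
  - destruct (lin_prod_deriv_bound (2 * (8 * a)) l z ltac:(lra) Hne') as [m [Hm Bm]]. fold T in Bm.
    assert (HD : Cder F z = (m * H z + lin_prod (2 * (8 * a)) l z * Cder H z)%C).
    { apply Cder_eq. apply (derivD_loc _ (fun z => lin_prod (2 * (8 * a)) l z * H z)%C _ _ _ 1); [lra | exact I | |].
      - intros. symmetry. apply HE.
      - apply derivD_mult; [exact Hm | apply ent_Cder_spec, HH]. }
    rewrite HD, HE, Cmod_mult. eapply Rle_trans; [apply Cmod_triangle|]. rewrite !Cmod_mult.
    set (p := Cmod (lin_prod (2 * (8 * a)) l z)) in *. set (h := Cmod (H z)) in *.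
    assert (X1 : Cmod m * h <= p * (T * T) * h) by (apply Rmult_le_compat_r; lra).
    assert (X2 : 8 * exp 8 / (8 * a) * B <= K * la).
    { replace (8 * exp 8 / (8 * a)) with (exp 8 * / a) by (field; lra).
      assert (/ a <= 1) by (rewrite <- Rinv_1; apply Rinv_le_contravar; lra).
      assert (0 < / a) by (apply Rinv_0_lt_compat; lra).
      apply Rle_trans with (exp 8 * 1 * (K1 * la)).
      - apply Rmult_le_compat; try nra.
      - replace (exp 8 * 1 * (K1 * la)) with (exp 8 * K1 * la) by ring. apply Rmult_le_compat_r; [lra|].
        assert (0 <= exp 8 * K1) by (apply Rmult_le_pos; lra). lra. }
    assert (X3 : p * Cmod (Cder H z) <= p * (K * la * h)).
    { apply Rmult_le_compat_l; [lra|]. eapply Rle_trans; [apply Z4|]. apply Rmult_le_compat_r; lra. }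
    lra.
  - rewrite !HE, !Cmod_mult.
    assert (I1 := lin_prod_shift_bound (2 * (8 * a)) l z eta ltac:(lra) Hne'). fold T in I1.
    set (kap := 8 * exp 8 / (8 * a) * B).
    assert (Hkap : 0 <= kap).
    { unfold kap. apply Rmult_le_pos; [|assumption]. left. apply Rdiv_lt_0_compat; lra. }
    assert (I2 : Cmod (H (z + eta)%C) <= Cmod (H z) * exp (kap * Cmod eta)).
    { replace (Cmod eta) with (Cmod (z + eta - z)) by (f_equal; ring).
      apply growth_along_segment; [assumption | assumption|]. intros t Ht.
      set (y := (z + RtoC t * (z + eta - z))%C).
      assert (Hy : Cmod y <= 8 * a / 2).
      { apply seg_int_point_le; [assumption | lra|]. eapply Rle_trans; [apply Cmod_triangle|]. unfold a0 in Ha. lra. }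
      destruct (Hz y Hy) as [Y1 [_ [_ Y4]]]. split; assumption. }
    assert (I3 : kap * Cmod eta <= K * (la / a)).
    { unfold kap. replace (8 * exp 8 / (8 * a) * B * Cmod eta) with (exp 8 * Cmod eta * B * / a) by (field; lra).
      assert (0 < / a) by (apply Rinv_0_lt_compat; lra).
      unfold Rdiv. rewrite <- Rmult_assoc. apply Rmult_le_compat_r; [lra|].
      assert (P : 0 <= exp 8 * Cmod eta) by (apply Rmult_le_pos; lra).
      apply Rle_trans with (exp 8 * Cmod eta * (K1 * la)); [apply Rmult_le_compat_l; assumption|].
      rewrite <- Rmult_assoc. apply Rmult_le_compat_r; [lra|].
      eapply Rle_trans; [|apply HKb]. assert (0 <= exp 8 * K1) by (apply Rmult_le_pos; lra).
      assert (0 <= exp 8 * K1 * Cmod eta) by (apply Rmult_le_pos; lra). lra. }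
    assert (I4 : 2 * sqrt (Cmod eta) * T <= K * T) by (apply Rmult_le_compat_r; lra).
    apply Rle_trans with ((Cmod (lin_prod (2 * (8 * a)) l z) * exp (2 * sqrt (Cmod eta) * T)) * (Cmod (H z) * exp (kap * Cmod eta))).
    + apply Rmult_le_compat; try apply Cmod_ge_0; assumption.
    + replace (Cmod (lin_prod (2 * (8 * a)) l z) * exp (2 * sqrt (Cmod eta) * T) * (Cmod (H z) * exp (kap * Cmod eta)))
        with (Cmod (lin_prod (2 * (8 * a)) l z) * Cmod (H z) * (exp (2 * sqrt (Cmod eta) * T) * exp (kap * Cmod eta))) by ring.
      apply Rmult_le_compat_l; [nra|]. rewrite <- exp_plus. apply exp_le. lra.
Qed.

(** Three different prices: gauge k for the inverse, only gauge 0 for the logarithmic derivative,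
    and gauge k / sqrt a for the shift quotient. The last one is the gain of half an order. *)
Definition good_circle (F : C -> C) (eta : C) (k : nat) (K a : R) (z : C) : Prop :=
  F z <> 0 /\ / Cmod (F z) <= exp (K * gauge k a) /\
  Cmod (Cder F z) <= Cmod (F z) * exp (K * gauge 0 a) /\
  Cmod (F (z + eta)%C) <= Cmod (F z) * exp (K * (gauge k a / sqrt a)).

(** Here T is the value of [root_sum] at a good radius. Then sqrt a * T is O(gauge k a), T itself
    carries the gain 1 / sqrt a, and T * T is polynomial in a, hence absorbed by [gauge_le_exp]. *)
Lemma good_circle_of_estimates (F : C -> C) (eta : C) (k : nat) (K1 K2 a T : R) (z : C) :
  0 <= K1 -> 0 <= K2 -> 1 <= a -> 0 <= T <= K2 * gauge k a / sqrt a ->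
  F z <> 0 -> / Cmod (F z) <= exp (K1 * (gauge k a + sqrt a * T)) ->
  Cmod (Cder F z) <= Cmod (F z) * (T * T + K1 * gauge k a) ->
  Cmod (F (z + eta)%C) <= Cmod (F z) * exp (K1 * (T + gauge k a / a)) ->
  good_circle F eta k ((K1 + 1) * (K2 + 1) + 2 * (K2 + 1) + K1 + 2 * (1 + INR k)) a z.
Proof.
  intros HK1 HK2 Ha HT H0 H1 H2 H3.
  assert (La := gauge_ge_1 k a Ha). assert (Lx := gauge_le_exp k a Ha). assert (L0 := gauge_ge_1 0 a Ha).
  set (la := gauge k a) in *.
  assert (Hk := pos_INR k).
  assert (Hs := sqrt_ge_1 a Ha). assert (Es := sqrt_sqrt a ltac:(lra)). set (s := sqrt a) in *.
  set (KK := (K1 + 1) * (K2 + 1) + 2 * (K2 + 1) + K1 + 2 * (1 + INR k)).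
  assert (HKK : (K1 + 1) * (K2 + 1) <= KK) by (unfold KK; lra).
  assert (HsT : s * T <= K2 * la).
  { replace (K2 * la) with (s * (K2 * la / s)) by (field; lra). apply Rmult_le_compat_l; lra. }
  assert (HTa : T <= K2 * la).
  { eapply Rle_trans; [|apply HsT]. rewrite <- (Rmult_1_l T) at 1. apply Rmult_le_compat_r; lra. }
  assert (Hla : la / a <= la / s).
  { apply Rmult_le_compat_l; [lra|]. apply Rinv_le_contravar; nra. }
  assert (Hls : 0 <= la / s) by (apply Rmult_le_pos; [lra|]; left; apply Rinv_0_lt_compat; lra).
  assert (K12 : 0 <= K1 * K2) by (apply Rmult_le_pos; assumption).
  unfold good_circle. fold la s KK.
  split; [assumption|]. split; [|split].
  - eapply Rle_trans; [apply H1|]. apply exp_le.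
    apply Rle_trans with (K1 * (la + K2 * la)); [apply Rmult_le_compat_l; lra|].
    replace (K1 * (la + K2 * la)) with ((K1 * (K2 + 1)) * la) by ring. apply Rmult_le_compat_r; lra.
  - eapply Rle_trans; [apply H2|]. apply Rmult_le_compat_l; [apply Cmod_ge_0|].
    apply Rle_trans with (exp (2 * (K2 + 1) + K1) * (la * la)).
    + assert (A1 : (K2 + 1) * (K2 + 1) <= exp (2 * (K2 + 1))) by (apply sqr_le_exp; lra).
      assert (A2 := exp_ineq1_le K1).
      rewrite exp_plus.
      assert (B1 : T * T <= K2 * K2 * (la * la)).
      { replace (K2 * K2 * (la * la)) with ((K2 * la) * (K2 * la)) by ring. apply Rmult_le_compat; lra. }
      assert (B2 : K1 * la <= K1 * (la * la)) by (apply Rmult_le_compat_l; nra).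
      apply Rle_trans with ((K2 * K2 + K1) * (la * la)); [lra|].
      apply Rmult_le_compat_r; [nra|].
      apply Rle_trans with ((K2 + 1) * (K2 + 1) * (1 + K1)); [nra|].
      apply Rmult_le_compat; nra.
    + apply Rle_trans with (exp (2 * (K2 + 1) + K1) * (exp ((1 + INR k) * gauge 0 a) * exp ((1 + INR k) * gauge 0 a))).
      * apply Rmult_le_compat_l; [left; apply exp_pos|]. apply Rmult_le_compat; lra.
      * rewrite <- !exp_plus. apply exp_le.
        apply Rle_trans with ((2 * (K2 + 1) + K1) * gauge 0 a + ((1 + INR k) * gauge 0 a + (1 + INR k) * gauge 0 a)).
        -- apply Rplus_le_compat_r. rewrite <- (Rmult_1_r (2 * (K2 + 1) + K1)) at 1. apply Rmult_le_compat_l; lra.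
        -- replace ((2 * (K2 + 1) + K1) * gauge 0 a + ((1 + INR k) * gauge 0 a + (1 + INR k) * gauge 0 a))
             with ((2 * (K2 + 1) + K1 + 2 * (1 + INR k)) * gauge 0 a) by ring.
           apply Rmult_le_compat_r; [lra|]. unfold KK. nra.
  - eapply Rle_trans; [apply H3|]. apply Rmult_le_compat_l; [apply Cmod_ge_0|]. apply exp_le.
    apply Rle_trans with (K1 * (K2 * la / s + la / s)); [apply Rmult_le_compat_l; lra|].
    replace (K1 * (K2 * la / s + la / s)) with (K1 * (K2 + 1) * (la / s)) by (unfold Rdiv; ring).
    apply Rmult_le_compat_r; lra.
Qed.

(** One circle has to serve both f and f - a in [shift_log_derivative], so [good_radius] is applied
    to the concatenation of the two lists. *)
Theorem good_circles (F1 F2 : C -> C) (k : nat) (eta w1 w2 : C) :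
  ent F1 -> F1 w1 <> 0 -> small k F1 -> ent F2 -> F2 w2 <> 0 -> small k F2 ->
  exists K a0, 0 <= K /\ 1 <= a0 /\ forall a, a0 <= a -> exists r, a <= r <= 2 * a /\
    forall z, Cmod z = r -> good_circle F1 eta k K a z /\ good_circle F2 eta k K a z.
Proof.
  intros E1 N1 S1 E2 N2 S2.
  destruct (circle_estimates F1 k eta w1 E1 N1 S1) as [K1 [a1 [HK1 [Ha1 H1]]]].
  destruct (circle_estimates F2 k eta w2 E2 N2 S2) as [K2 [a2 [HK2 [Ha2 H2]]]].
  set (Kn := 8 * (K1 + K2)).
  set (KK := (K1 + K2 + 1) * (Kn + 1) + 2 * (Kn + 1) + (K1 + K2) + 2 * (1 + INR k)).
  assert (Hk := pos_INR k).
  assert (HKn : 0 <= Kn) by (unfold Kn; lra).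
  exists KK, (Rmax a1 a2). split; [unfold KK; assert (0 <= (K1 + K2 + 1) * (Kn + 1)) by (apply Rmult_le_pos; lra); lra|].
  split; [eapply Rle_trans; [apply Ha1 | apply Rmax_l]|].
  intros a Ha.
  assert (Haa1 : a1 <= a) by (eapply Rle_trans; [apply Rmax_l | apply Ha]).
  assert (Haa2 : a2 <= a) by (eapply Rle_trans; [apply Rmax_r | apply Ha]).
  destruct (H1 a Haa1) as [l1 [Q1 H1']]. destruct (H2 a Haa2) as [l2 [Q2 H2']].
  destruct (good_radius (l1 ++ l2) a ltac:(lra)) as [r [Hr [Hne Hs]]].
  exists r. split; [assumption|].
  assert (Ne1 : forall x, In x l1 -> x <> r) by (intros; apply Hne, in_or_app; left; assumption).
  assert (Ne2 : forall x, In x l2 -> x <> r) by (intros; apply Hne, in_or_app; right; assumption).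
  assert (T1 := root_sum_nonneg l1 r Ne1). assert (T2 := root_sum_nonneg l2 r Ne2).
  assert (Hsa : 0 < sqrt a) by (apply sqrt_lt_R0; lra).
  assert (La := gauge_ge_1 k a ltac:(lra)).
  assert (Hsum : root_sum l1 r + root_sum l2 r <= Kn * gauge k a / sqrt a).
  { unfold root_sum in *. rewrite rsum_app in Hs. eapply Rle_trans; [apply Hs|].
    apply Rmult_le_compat_r; [left; apply Rinv_0_lt_compat; assumption|].
    rewrite length_app, plus_INR. unfold Kn. lra. }
  intros z Hz. specialize (H1' r Hr Ne1 z Hz). specialize (H2' r Hr Ne2 z Hz).
  destruct H1' as [A1 [A2 [A3 A4]]]. destruct H2' as [B1 [B2 [B3 B4]]].
  assert (Hla : 0 <= gauge k a / a) by (apply Rmult_le_pos; [lra|]; left; apply Rinv_0_lt_compat; lra).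
  assert (Up : forall F K' X Y, Y <= F * exp (K' * X) -> 0 <= F -> K' <= K1 + K2 -> 0 <= X -> Y <= F * exp ((K1 + K2) * X)).
  { intros F K' X Y HY HF HK HX. eapply Rle_trans; [apply HY|]. apply Rmult_le_compat_l; [assumption|].
    apply exp_le, Rmult_le_compat_r; assumption. }
  assert (X1 : 0 <= gauge k a + sqrt a * root_sum l1 r) by (assert (0 <= sqrt a * root_sum l1 r) by (apply Rmult_le_pos; lra); lra).
  assert (X2 : 0 <= gauge k a + sqrt a * root_sum l2 r) by (assert (0 <= sqrt a * root_sum l2 r) by (apply Rmult_le_pos; lra); lra).
  split.
  - apply (good_circle_of_estimates F1 eta k (K1 + K2) Kn a (root_sum l1 r)); try lra.
    + exact A1.
    + eapply Rle_trans; [apply A2|]. apply exp_le, Rmult_le_compat_r; lra.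
    + eapply Rle_trans; [apply A3|]. apply Rmult_le_compat_l; [apply Cmod_ge_0|].
      assert (0 <= K2 * gauge k a) by (apply Rmult_le_pos; lra). lra.
    + apply (Up _ K1); try lra; apply Cmod_ge_0.
  - apply (good_circle_of_estimates F2 eta k (K1 + K2) Kn a (root_sum l2 r)); try lra.
    + exact B1.
    + eapply Rle_trans; [apply B2|]. apply exp_le, Rmult_le_compat_r; lra.
    + eapply Rle_trans; [apply B3|]. apply Rmult_le_compat_l; [apply Cmod_ge_0|].
      assert (0 <= K1 * gauge k a) by (apply Rmult_le_pos; lra). lra.
    + apply (Up _ K2); try lra; apply Cmod_ge_0.
Qed.

(** The maximum principle fills in the discs, so one good radius in each [a, 2 a] is enough. For the
    point w the scale a0 (1 + |w|) is used, which puts w inside the circle. *)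
Theorem small_of_circles (F : C -> C) (k : nat) (K a0 : R) : ent F -> 0 <= K -> 1 <= a0 ->
  (forall a, a0 <= a -> exists r, a <= r <= 2 * a /\ forall z, Cmod z = r -> Cmod (F z) <= exp (K * gauge k a)) ->
  small k F.
Proof.
  intros HF HK Ha0 H. exists (K * gauge k a0).
  assert (L0 := gauge_ge_1 k a0 Ha0). split; [apply Rmult_le_pos; lra|].
  intros w. assert (Hw := Cmod_ge_0 w).
  destruct (H (a0 * (1 + Cmod w)) ltac:(nra)) as [r [Hr Hz]].
  eapply Rle_trans.
  - apply (max_principle (r + 1) r (exp (K * gauge k (a0 * (1 + Cmod w)))) F w).
    + apply ent_holo, HF.
    + nra.
    + intros t _. apply Hz, Cmod_circle. nra.
    + nra.
  - apply exp_le. rewrite Rmult_assoc. apply Rmult_le_compat_l; [assumption|]. apply gauge_mult; lra.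
Qed.

(** * Closure properties of [small] *)

Lemma small_weaken (k : nat) (F : C -> C) : small k F -> small (S k) F.
Proof.
  intros [K [HK H]]. exists K. split; [assumption|]. intros z. eapply Rle_trans; [apply H|].
  apply exp_le, Rmult_le_compat_l; [assumption|]. apply gauge_le_S. assert (A := Cmod_ge_0 z). lra.
Qed.

Lemma small_const (k : nat) (c : C) : small k (fun _ => c).
Proof.
  exists (Cmod c). split; [apply Cmod_ge_0|]. intros z. assert (A := Cmod_ge_0 z).
  assert (L := gauge_ge_1 k (1 + Cmod z) ltac:(lra)). assert (B := Cmod_ge_0 c).
  apply Rle_trans with (exp (Cmod c)); [assert (E := exp_ineq1_le (Cmod c)); lra|].
  apply exp_le. nra.
Qed.

Lemma small_mult (k : nat) (F G : C -> C) : small k F -> small k G -> small k (fun z => F z * G z)%C.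
Proof.
  intros [K [HK H]] [K' [HK' H']]. exists (K + K'). split; [lra|]. intros z.
  rewrite Cmod_mult, Rmult_plus_distr_r, exp_plus. apply Rmult_le_compat; auto using Cmod_ge_0.
Qed.

Lemma small_plus (k : nat) (F G : C -> C) : small k F -> small k G -> small k (fun z => F z + G z)%C.
Proof.
  (* The extra 1 pays for having two summands: 2 <= 1 + gauge <= exp gauge. *)
  intros [K [HK H]] [K' [HK' H']]. exists (K + K' + 1). split; [lra|]. intros z.
  assert (A := Cmod_ge_0 z). assert (L := gauge_ge_1 k (1 + Cmod z) ltac:(lra)).
  set (la := gauge k (1 + Cmod z)) in *.
  eapply Rle_trans; [apply Cmod_triangle|].
  assert (B1 := H z). assert (B2 := H' z). fold la in B1, B2.
  assert (C1 : exp (K * la) <= exp ((K + K') * la)) by (apply exp_le, Rmult_le_compat_r; lra).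
  assert (C2 : exp (K' * la) <= exp ((K + K') * la)) by (apply exp_le, Rmult_le_compat_r; lra).
  rewrite Rmult_plus_distr_r, exp_plus, Rmult_1_l.
  assert (E := exp_ineq1_le la). assert (P := exp_pos ((K + K') * la)). nra.
Qed.

Lemma small_minus (k : nat) (F G : C -> C) : small k F -> small k G -> small k (fun z => F z - G z)%C.
Proof.
  intros HF HG. apply (small_plus k F (fun z => - G z)%C HF).
  destruct HG as [K [HK H]]. exists K. split; [assumption|]. intros z. rewrite Cmod_opp. apply H.
Qed.

Lemma small_near (k : nat) (F : C -> C) (d : R) : 0 <= d -> small k F ->
  exists K, 0 <= K /\ forall z w, Cmod (w - z) <= d -> Cmod (F w) <= exp (K * gauge k (1 + Cmod z)).
Proof.
  intros Hd [K [HK H]]. exists (K * gauge k (1 + d)).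
  assert (L := gauge_ge_1 k (1 + d) ltac:(lra)). split; [apply Rmult_le_pos; lra|].
  intros z w Hw. eapply Rle_trans; [apply H|]. apply exp_le. rewrite Rmult_assoc.
  apply Rmult_le_compat_l; [assumption|].
  assert (A := Cmod_ge_0 z). assert (B := Cmod_triangle_sub w z). assert (B0 := Cmod_ge_0 w).
  eapply Rle_trans; [apply (gauge_mono k _ ((1 + d) * (1 + Cmod z))); nra|]. apply gauge_mult; lra.
Qed.

Lemma small_shift (k : nat) (F : C -> C) (c : C) : small k F -> small k (fun z => F (z + c)%C).
Proof.
  intros H. destruct (small_near k F (Cmod c) (Cmod_ge_0 c) H) as [K [HK H']].
  exists K. split; [assumption|]. intros z. apply H'.
  right. f_equal. ring.
Qed.

Lemma small_Cder (k : nat) (F : C -> C) : ent F -> small k F -> small k (Cder F).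
Proof.
  intros HF H. destruct (small_near k F 1 ltac:(lra) H) as [K [HK H']].
  exists K. split; [assumption|]. intros z.
  assert (HP := PI_RGT_0).
  assert (E := deriv_center (Cmod z + 2) F z (Cder F z) 1 (ent_holo F _ HF) ltac:(lra) ltac:(lra) (ent_Cder_spec F z HF)).
  apply Rmult_le_reg_l with (2 * PI); [lra|].
  rewrite <- (Cmod_RtoC_nonneg (2 * PI)) at 1 by lra. rewrite <- Cmod_mult.
  replace (2 * PI * 1) with (2 * PI) in E by ring. rewrite <- E.
  eapply Rle_trans; [apply (Cint_norm_const _ (exp (K * gauge k (1 + Cmod z))))|].
  - lra.
  - intros t _. apply rcont_mult; [|apply rcont_conj, rcont_cis].
    apply (rcont_comp F); [apply ent_cont, HF | apply rcont_circle].
  - intros t _. rewrite Cmod_mult, Cmod_conj, Cmod_cis, Rmult_1_r. apply H'.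
    right. replace (z + RtoC 1 * cis t - z)%C with (cis t) by ring. apply Cmod_cis.
  - right. ring.
Qed.

(** * Maximum modulus and characteristic *)

Lemma continuous_ln_Cmod (g : R -> C) (t : R) : g t <> 0 -> rcont g t -> continuous (fun t => ln (Cmod (g t))) t.
Proof.
  intros H0 Hg. apply (continuous_comp (fun t => Cmod (g t)) ln); [apply rcont_Cmod, Hg|].
  apply continuity_pt_filterlim. apply derivable_continuous_pt. exists (/ Cmod (g t)).
  apply derivable_pt_lim_ln. apply Cmod_gt_0, H0.
Qed.

Lemma continuous_log_poisson_kernel (g : R -> C) (r : R) (w : C) (t : R) : 0 < r -> Cmod w < r -> g t <> 0 -> rcont g t ->
  continuous (fun t => ln (Cmod (g t)) * poisson_kernel r w t) t.
Proof.
  intros Hr Hw H0 Hg. apply (@continuous_mult R_UniformSpace R_AbsRing);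
    [apply continuous_ln_Cmod | apply continuous_poisson_kernel]; assumption.
Qed.

Lemma log_mean_zero_free (rho r : R) (H : C -> C) (w : C) : holo rho H ->
  (forall z, Cmod z < rho -> H z <> 0) -> 0 < r < rho -> Cmod w < r ->
  ln (Cmod (H w)) * RInt (poisson_kernel r w) 0 (2 * PI) =
  RInt (fun t => ln (Cmod (H (RtoC r * cis t)%C)) * poisson_kernel r w t) 0 (2 * PI).
Proof.
  intros HH H0 Hr Hw.
  assert (HP := twoPI_pos).
  destruct (holo_log rho H HH H0) as [L [HL HL2]].
  assert (E := poisson rho r L w HL Hr Hw). apply (f_equal Re) in E.
  rewrite re_scal_r, (proj2 (HL2 w ltac:(lra))) in E. rewrite <- E, Cint_Re.
  - apply RInt_ext. intros t _. rewrite re_scal_r, (proj2 (HL2 (RtoC r * cis t)%C ltac:(rewrite Cmod_circle; lra))). reflexivity.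
  - assumption.
  - intros t _. apply rcont_mult.
    + apply (rcont_comp L); [apply (holo_contb rho); [assumption | rewrite Cmod_circle; lra] | apply rcont_circle0].
    + apply rcont_of_real, continuous_poisson_kernel; lra.
Qed.

(* The Blaschke factor of [a] dominates [z - a] inside the circle and has the same modulus on it. *)
Lemma blaschke_le (r : R) (w a : C) : 0 < r -> Cmod w <= r -> Cmod a <= r ->
  r * Cmod (w - a) <= Cmod (RtoC (r * r) - Cconj a * w).
Proof.
  intros Hr Hw Ha.
  assert (Aw := Cmod2_alt w). assert (Aa := Cmod2_alt a).
  assert (D1 := Cmod2_alt (w - a)). assert (D2 := Cmod2_alt (RtoC (r * r) - Cconj a * w)).
  assert (P1 := Cmod_ge_0 w). assert (P2 := Cmod_ge_0 a).
  assert (P3 := Cmod_ge_0 (w - a)). assert (P4 := Cmod_ge_0 (RtoC (r * r) - Cconj a * w)).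
  set (m1 := Cmod (w - a)) in *. set (m2 := Cmod (RtoC (r * r) - Cconj a * w)) in *.
  set (mw := Cmod w) in *. set (ma := Cmod a) in *.
  destruct w as [x y]. destruct a as [u v]. simpl in D1, D2, Aw, Aa.
  assert (E : m2 * m2 - r * m1 * (r * m1) = (r * r - ma * ma) * (r * r - mw * mw)).
  { replace (m2 * m2) with (m2 * (m2 * 1)) by ring. rewrite D2.
    replace (r * m1 * (r * m1)) with (r * r * (m1 * (m1 * 1))) by ring. rewrite D1.
    replace (ma * ma) with (ma * (ma * 1)) by ring. rewrite Aa.
    replace (mw * mw) with (mw * (mw * 1)) by ring. rewrite Aw. ring. }
  assert (0 <= (r * r - ma * ma) * (r * r - mw * mw)) by (apply Rmult_le_pos; nra).
  assert (0 <= r * m1) by nra. nra.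
Qed.

Lemma blaschke_circle (r t : R) (a : C) : 0 < r ->
  Cmod (RtoC (r * r) - Cconj a * (RtoC r * cis t)) = r * Cmod (RtoC r * cis t - a).
Proof.
  intros Hr. set (z := (RtoC r * cis t)%C).
  assert (Hz : Cmod z = r) by (apply Cmod_circle; lra).
  assert (Ez : RtoC (r * r) = (z * Cconj z)%C) by (rewrite <- Cmod2_conj, Hz; f_equal; ring).
  replace (RtoC (r * r) - Cconj a * z)%C with (z * Cconj (z - a))%C by (rewrite Cminus_conj, Ez; ring).
  rewrite Cmod_mult, Cmod_conj, Hz. reflexivity.
Qed.

(** The inequality half of Poisson-Jensen, bundled with the nonvanishing that its logarithms need.
    In this form it is closed under products, so F can be treated factor by factor. *)
Definition log_submean (r : R) (w : C) (F : C -> C) : Prop :=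
  (forall t, F (RtoC r * cis t)%C <> 0 /\ rcont (fun t => F (RtoC r * cis t)%C) t) /\ F w <> 0 /\
  ln (Cmod (F w)) * RInt (poisson_kernel r w) 0 (2 * PI) <=
  RInt (fun t => ln (Cmod (F (RtoC r * cis t)%C)) * poisson_kernel r w t) 0 (2 * PI).

Lemma log_submean_mult (r : R) (w : C) (F G : C -> C) : 0 < r -> Cmod w < r ->
  log_submean r w F -> log_submean r w G -> log_submean r w (fun z => F z * G z)%C.
Proof.
  intros Hr Hw [F1 [F2 F3]] [G1 [G2 G3]]. assert (HP := twoPI_pos).
  split; [|split].
  - intros t. destruct (F1 t). destruct (G1 t). split; [apply Cmult_neq_0 | apply rcont_mult]; assumption.
  - apply Cmult_neq_0; assumption.
  - rewrite Cmod_mult, ln_mult by (apply Cmod_gt_0; assumption).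
    rewrite (RInt_ext (fun t => ln (Cmod (F (RtoC r * cis t) * G (RtoC r * cis t))%C) * poisson_kernel r w t)
      (fun t => ln (Cmod (F (RtoC r * cis t)%C)) * poisson_kernel r w t +
      ln (Cmod (G (RtoC r * cis t)%C)) * poisson_kernel r w t)).
    + rewrite (@RInt_plus R_CompleteNormedModule (fun t => ln (Cmod (F (RtoC r * cis t)%C)) * poisson_kernel r w t)
        (fun t => ln (Cmod (G (RtoC r * cis t)%C)) * poisson_kernel r w t)).
      * rewrite Rmult_plus_distr_r. apply Rplus_le_compat; assumption.
      * apply RInt_cont_ex; [assumption|]. intros t _.
        apply (continuous_log_poisson_kernel (fun t => F (RtoC r * cis t)%C)); [assumption | assumption | apply F1 | apply F1].
      * apply RInt_cont_ex; [assumption|]. intros t _.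
        apply (continuous_log_poisson_kernel (fun t => G (RtoC r * cis t)%C)); [assumption | assumption | apply G1 | apply G1].
    + intros t _. destruct (F1 t). destruct (G1 t).
      rewrite Cmod_mult, ln_mult by (apply Cmod_gt_0; assumption). apply Rmult_plus_distr_r.
Qed.

Lemma log_submean_zero_free (rho r : R) (w : C) (H : C -> C) : holo rho H ->
  (forall z, Cmod z < rho -> H z <> 0) -> 0 < r < rho -> Cmod w < r -> log_submean r w H.
Proof.
  intros HH H0 Hr Hw. split; [|split].
  - intros t. split; [apply H0; rewrite Cmod_circle; lra|].
    apply (rcont_comp H); [apply (holo_contb rho); [assumption | rewrite Cmod_circle; lra] | apply rcont_circle0].
  - apply H0. lra.
  - right. apply (log_mean_zero_free rho); assumption.
Qed.

(** A zero outside the circle leaves the factor zero-free on a larger disc. For a zero inside, z - a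
    is traded for g z = (r^2 - conj(a) z) / r, which is zero-free there, has the same modulus on the
    circle and at least the modulus of w - a at w. *)
Lemma log_submean_linear (r : R) (w a : C) : 0 < r -> Cmod w < r -> Cmod a <> r -> w <> a ->
  log_submean r w (fun z => z - a)%C.
Proof.
  intros Hr Hw Ha Hwa.
  assert (Hwa0 : (w - a)%C <> 0) by (apply Cminus_eq_contra; assumption).
  destruct (Rlt_or_le r (Cmod a)) as [Hout|Hin].
  { apply (log_submean_zero_free (Cmod a)); try lra.
    - apply holo_minus; [apply holo_id | apply holo_const].
    - intros z Hz E. assert (z = a) by (apply Ceq_minus; exact E). subst z. lra. }
  assert (Hin' : Cmod a < r) by lra.
  assert (Hne : forall t, (RtoC r * cis t - a)%C <> 0) by (intros; apply circle_minus_neq0; assumption).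
  split; [|split; [assumption|]].
  { intros t. split; [apply Hne|]. apply rcont_minus; [apply rcont_circle0 | apply rcont_const]. }
  assert (Ha0 := Cmod_ge_0 a).
  (* As in [poisson], rho1 lies between r and the modulus r^2 / |a| of a possible zero of g. *)
  set (rho1 := 2 * (r * r) / (r + Cmod a)).
  assert (Hr1 : r < rho1).
  { unfold rho1. apply Rmult_lt_reg_r with (r + Cmod a); [lra|].
    unfold Rdiv. rewrite Rmult_assoc, Rinv_l by lra. nra. }
  set (g := fun z => (RtoC (/ r) * (RtoC (r * r) - Cconj a * z))%C).
  assert (Hg : holo rho1 g).
  { apply holo_mult; [apply holo_const|]. apply holo_minus; [apply holo_const|].
    apply holo_mult; [apply holo_const | apply holo_id]. }
  assert (Hg0 : forall z, Cmod z < rho1 -> g z <> 0).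
  { intros z Hz. apply Cmult_neq_0; [apply RtoC_neq0, Rinv_neq_0_compat; lra|].
    intros E. assert (E2 : RtoC (r * r) = (Cconj a * z)%C) by (apply Ceq_minus; exact E).
    apply (f_equal Cmod) in E2. rewrite Cmod_mult, Cmod_conj, Cmod_RtoC_nonneg in E2 by nra.
    unfold rho1 in Hz. apply Rlt_div_r in Hz; [|lra].
    assert (Hz0 := Cmod_ge_0 z). nra. }
  assert (E := log_mean_zero_free rho1 r g w Hg Hg0 ltac:(lra) Hw).
  assert (Hri : 0 < / r) by (apply Rinv_0_lt_compat; lra).
  assert (Emod : forall z, Cmod (g z) = / r * Cmod (RtoC (r * r) - Cconj a * z)).
  { intros z. unfold g. rewrite Cmod_mult, Cmod_RtoC_nonneg by lra. reflexivity. }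
  rewrite (RInt_ext (fun t => ln (Cmod (g (RtoC r * cis t)%C)) * poisson_kernel r w t)
    (fun t => ln (Cmod (RtoC r * cis t - a)) * poisson_kernel r w t)) in E.
  2:{ intros t _. rewrite Emod, blaschke_circle, <- Rmult_assoc, Rinv_l, Rmult_1_l by lra. reflexivity. }
  rewrite <- E. apply Rmult_le_compat_r; [left; apply RInt_poisson_kernel_pos; assumption|].
  apply ln_le; [apply Cmod_gt_0; assumption|]. rewrite Emod.
  apply Rmult_le_reg_l with r; [assumption|]. rewrite <- Rmult_assoc, Rinv_r, Rmult_1_l by lra.
  apply blaschke_le; lra.
Qed.

Lemma log_submean_lin_prod (s r : R) (l : list C) (w : C) : 0 < s -> 0 < r -> Cmod w < r ->
  (forall a, In a l -> Cmod a <> r) -> ~ In w l -> log_submean r w (lin_prod s l).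
Proof.
  intros Hs Hr Hw. induction l as [|a l IH]; intros Hl Hwl.
  - apply (log_submean_zero_free (r + 1)); try lra.
    + apply holo_const.
    + intros z _. apply C1_nz.
  - apply (log_submean_mult r w (fun z => (z - a) * RtoC (/ s))%C (lin_prod s l)); try assumption.
    + apply (log_submean_mult r w (fun z => z - a)%C (fun _ => RtoC (/ s))); try assumption.
      * apply log_submean_linear; try assumption.
        -- apply Hl. left. reflexivity.
        -- intros E. apply Hwl. left. symmetry. exact E.
      * apply (log_submean_zero_free (r + 1)); try lra; [apply holo_const|].
        intros z _. apply RtoC_neq0, Rinv_neq_0_compat. lra.
    + apply IH; [intros b Hb; apply Hl; right; exact Hb | intros K; apply Hwl; right; exact K].
Qed.

Lemma circle_pair (r t : R) : ((r * cos t, r * sin t) : C) = (RtoC r * cis t)%C.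
Proof. unfold cis, Cmult, RtoC; simpl. f_equal; ring. Qed.

Lemma continuous_logplus (g : R -> R) (t : R) : continuous g t -> (forall s, 0 < g s) ->
  continuous (fun t => logplus (g t)) t.
Proof.
  intros Hg Hp. unfold logplus.
  apply (continuous_ext (fun t => (ln (g t) + Rabs (ln (g t))) / 2)).
  - intros s. unfold Rmax. destruct Rle_dec; [rewrite Rabs_pos_eq by assumption; lra|].
    rewrite Rabs_left1 by lra. lra.
  - assert (Hl : continuous (fun t => ln (g t)) t).
    { apply (continuous_comp g ln); [assumption|].
      apply continuity_pt_filterlim, derivable_continuous_pt. exists (/ g t). apply derivable_pt_lim_ln, Hp. }
    apply (@continuous_mult R_UniformSpace R_AbsRing); [|apply continuous_const].
    apply (@continuous_plus R_UniformSpace R_AbsRing R_NormedModule); [assumption|].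
    apply (continuous_comp (fun t => ln (g t)) Rabs); [assumption | apply continuous_Rabs].
Qed.

(** The circle is moved off the zeros of F by [good_radius], so that ln |F| is continuous on it;
    this is why r is only located in [a, 2 a]. *)
Theorem log_le_characteristic (F : C -> C) (w : C) (a : R) : ent F -> F w <> 0 -> 0 < a -> 2 * Cmod w <= a ->
  exists r, a <= r <= 2 * a /\ ln (Cmod (F w)) <= 9 * nev_T F r /\ 0 <= nev_T F r.
Proof.
  intros HF Hw Ha Hwa.
  assert (HP := PI_RGT_0).
  destruct (ent_factor_disc F w (2 * a + 1) HF Hw) as [rho [l [H [Hrho [Hr0 [HH [HE Hz]]]]]]].
  destruct (good_radius (map Cmod l) a Ha) as [r [Hr [Hne _]]].
  exists r. split; [assumption|].
  assert (Hw0 := Cmod_ge_0 w).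
  assert (Hwl : ~ In w l).
  { intros K. apply Hw. rewrite HE, (lin_prod_zero _ _ _ K). ring. }
  assert (Hsub : log_submean r w (fun z => lin_prod (2 * rho) l z * H z)%C).
  { apply log_submean_mult; try lra.
    - apply log_submean_lin_prod; try lra; [|assumption]. intros b Hb. apply Hne, in_map, Hb.
    - apply (log_submean_zero_free rho); try lra; [apply ent_holo, HH|]. intros z Hzr. apply Hz. lra. }
  destruct Hsub as [Hc [_ Hsub]].
  assert (Hc' : forall t, F (RtoC r * cis t)%C <> 0 /\ rcont (fun t => F (RtoC r * cis t)%C) t).
  { intros t. destruct (Hc t) as [C1 C2]. split; [rewrite HE; exact C1|].
    apply (rcont_comp F); [apply ent_cont, HF | apply rcont_circle0]. }
  set (lg := fun t => logplus (Cmod (F (RtoC r * cis t)%C))).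
  assert (Hlg : forall t, continuous lg t).
  { intros t. unfold lg. apply (continuous_logplus (fun t => Cmod (F (RtoC r * cis t)%C))).
    - apply rcont_Cmod. apply Hc'.
    - intros s. apply Cmod_gt_0, Hc'. }
  assert (Hlg0 : forall t, 0 <= lg t) by (intros; apply Rmax_l).
  assert (ET : nev_T F r = / (2 * PI) * RInt lg 0 (2 * PI)).
  { unfold nev_T. f_equal. apply RInt_ext. intros t _. rewrite circle_pair. reflexivity. }
  assert (HI0 : 0 <= RInt lg 0 (2 * PI)).
  { apply RInt_ge_0; [lra | apply RInt_cont_ex; [lra | intros; apply Hlg] | intros; apply Hlg0]. }
  assert (HT0 : 0 <= nev_T F r).
  { rewrite ET. apply Rmult_le_pos; [left; apply Rinv_0_lt_compat; lra | assumption]. }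
  split; [|assumption].
  destruct (Rle_lt_dec (ln (Cmod (F w))) 0) as [Hneg|Hpos]; [lra|].
  (* As |w| <= r / 2, the kernel lies between 4 / (9 r^2) and 4 / r^2; the ratio 9 of these bounds
     is the constant of the theorem. *)
  assert (Hdist : forall t, r / 2 <= Cmod (RtoC r * cis t - w) <= 3 * r / 2).
  { intros t. assert (A1 := Cmod_triangle_sub (RtoC r * cis t) w).
    assert (A2 := Cmod_triangle_minus (RtoC r * cis t) w).
    rewrite Cmod_circle in A1, A2 by lra. lra. }
  assert (Hup : forall t, poisson_kernel r w t <= 4 / (r * r)).
  { intros t. unfold poisson_kernel. specialize (Hdist t).
    replace (4 / (r * r)) with (/ (r / 2 * (r / 2))) by (field; lra).
    apply Rinv_le_contravar; nra. }
  assert (Hlow : forall t, 4 / (9 * (r * r)) <= poisson_kernel r w t).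
  { intros t. unfold poisson_kernel. specialize (Hdist t).
    replace (4 / (9 * (r * r))) with (/ (3 * r / 2 * (3 * r / 2))) by (field; lra).
    apply Rinv_le_contravar; nra. }
  assert (I1 : 4 / (9 * (r * r)) * (2 * PI) <= RInt (poisson_kernel r w) 0 (2 * PI)).
  { replace (2 * PI) with (2 * PI - 0) at 1 by ring. apply RInt_pos_const_le; [lra| |].
    - intros. apply continuous_poisson_kernel; lra.
    - intros. apply Hlow. }
  assert (I2 : RInt (fun t => ln (Cmod (lin_prod (2 * rho) l (RtoC r * cis t) * H (RtoC r * cis t)%C)) * poisson_kernel r w t) 0 (2 * PI)
     <= RInt (fun t => 4 / (r * r) * lg t) 0 (2 * PI)).
  { apply RInt_le; [lra | | |].
    - apply RInt_cont_ex; [lra|]. intros t _.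
      apply (continuous_log_poisson_kernel (fun t => lin_prod (2 * rho) l (RtoC r * cis t) * H (RtoC r * cis t)%C)%C); try lra; apply Hc.
    - apply RInt_cont_ex; [lra|]. intros t _.
      apply (@continuous_scal_r R_UniformSpace R_AbsRing R_NormedModule (4 / (r * r))). apply Hlg.
    - intros t _. rewrite <- HE.
      assert (Hpk := pker_pos r w t ltac:(lra) ltac:(lra)). specialize (Hup t). specialize (Hlg0 t).
      assert (Hll : ln (Cmod (F (RtoC r * cis t)%C)) <= lg t) by apply Rmax_r.
      apply Rle_trans with (lg t * poisson_kernel r w t); [apply Rmult_le_compat_r; lra|].
      rewrite (Rmult_comm (4 / (r * r))). apply Rmult_le_compat_l; lra. }
  rewrite <- HE in Hsub.
  assert (I3 : RInt (fun t => 4 / (r * r) * lg t) 0 (2 * PI) = 4 / (r * r) * RInt lg 0 (2 * PI)).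
  { apply (@RInt_scal R_CompleteNormedModule). apply RInt_cont_ex; [lra | intros; apply Hlg]. }
  rewrite I3 in I2.
  assert (Hmain : ln (Cmod (F w)) * (4 / (9 * (r * r)) * (2 * PI)) <= 4 / (r * r) * (2 * PI * nev_T F r)).
  { eapply Rle_trans; [apply Rmult_le_compat_l; [lra | apply I1]|].
    eapply Rle_trans; [apply Hsub|]. eapply Rle_trans; [apply I2|]. right. rewrite ET. field. lra. }
  apply Rmult_le_reg_r with (4 / (9 * (r * r)) * (2 * PI)).
  { apply Rmult_lt_0_compat; [|lra]. apply Rdiv_lt_0_compat; nra. }
  eapply Rle_trans; [apply Hmain|]. right. field. lra.
Qed.

Theorem finite_order_small (F : C -> C) : ent F -> finite_order F -> exists k, small k F.
Proof.
  intros HF [s [R0 Hs]].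
  destruct (nfloor_ex (Rmax 0 s) (Rmax_l _ _)) as [N0 [_ HN0]].
  set (N := S N0). assert (HN : s <= INR N) by (unfold N; rewrite S_INR; assert (A := Rmax_r 0 s); lra).
  (* Makes every radius r >= c / 2 * x exceed R0, 1 and 2 |w|, so that the order hypothesis and
     [log_le_characteristic] both apply. *)
  set (c := 2 * (Rabs R0 + 3)).
  assert (Hc : 6 <= c) by (unfold c; assert (A := Rabs_pos R0); lra).
  (* [gauge] counts half orders and sqrt x ^ (2 N) = x ^ N; the 9 comes from
     [log_le_characteristic], and c ^ N from r <= c x. *)
  exists (2 * N)%nat, (9 * c ^ N). split.
  { apply Rmult_le_pos; [lra|]. apply pow_le. lra. }
  intros w. assert (Hw0 := Cmod_ge_0 w). set (x := 1 + Cmod w).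
  destruct (Ceq_dec (F w) 0) as [E|Hw].
  { rewrite E, Cmod_0. left. apply exp_pos. }
  destruct (log_le_characteristic F w (c / 2 * x) HF Hw) as [r [Hr [Hln HT]]].
  { apply Rmult_lt_0_compat; unfold x; lra. }
  { unfold x. nra. }
  assert (Hx : 1 <= x) by (unfold x; lra).
  assert (HR0 : R0 < r).
  { assert (A := Rle_abs R0). unfold c in Hr. assert (0 <= Rabs R0) by apply Rabs_pos. nra. }
  assert (Hr1 : 1 < r) by nra.
  assert (Hlnr : 0 < ln r) by (rewrite <- ln_1; apply ln_increasing; lra).
  specialize (Hs r HR0 Hr1).
  assert (HTr : nev_T F r <= (c * x) ^ N).
  { destruct (Rle_lt_or_eq_dec 0 _ HT) as [HTp|HT0].
    - assert (A : ln (nev_T F r) <= s * ln r).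
      { apply Rle_trans with (logplus (nev_T F r)); [apply Rmax_r|].
        apply Rmult_le_reg_r with (/ ln r); [apply Rinv_0_lt_compat; assumption|].
        rewrite (Rmult_assoc s), Rinv_r, Rmult_1_r by lra. exact Hs. }
      rewrite <- (exp_ln (nev_T F r)) by assumption.
      apply Rle_trans with (exp (INR N * ln r)); [apply exp_le; nra|].
      rewrite <- ln_pow, exp_ln by (try apply pow_lt; lra). apply pow_incr. lra.
    - rewrite <- HT0. apply pow_le. nra. }
  rewrite <- (exp_ln (Cmod (F w))) by (apply Cmod_gt_0; assumption). apply exp_le.
  eapply Rle_trans; [apply Hln|]. rewrite Rmult_assoc. apply Rmult_le_compat_l; [lra|].
  eapply Rle_trans; [apply HTr|]. rewrite Rpow_mult_distr. apply Rmult_le_compat_l; [apply pow_le; lra|].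
  unfold gauge. rewrite pow_mult. replace (sqrt x ^ 2) with x by (simpl; rewrite Rmult_1_r, sqrt_sqrt; lra).
  assert (A := ln_nonneg x Hx). assert (B : 0 <= x ^ N) by (apply pow_le; lra). nra.
Qed.

(** * Descent *)

Lemma ent_lin_prod (s : R) (l : list C) : ent (lin_prod s l).
Proof.
  induction l as [|a l IH].
  - apply (ent_const (RtoC 1)).
  - apply (ent_mult (fun z => (z - a) * RtoC (/ s))%C (lin_prod s l)); [|exact IH].
    apply ent_mult; [|apply ent_const]. apply ent_minus; [apply ent_id | apply ent_const].
Qed.

(** The logarithmic derivative is the sum of the 1 / (z - a), and P / (z - a) is entire as soon as P
    a = 0. Repetitions in l are harmless: each summand has a simple pole. *)
Lemma lin_prod_log_derivative (s : R) (P : C -> C) (l : list C) : ent P -> (forall a, In a l -> P a = 0) ->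
  exists th, ent th /\ forall z, (th z * lin_prod s l z = P z * Cder (lin_prod s l) z)%C.
Proof.
  intros HP. induction l as [|a l IH]; intros Hl.
  - exists (fun _ => RtoC 0). split; [apply ent_const|]. intros z.
    rewrite (Cder_eq (lin_prod s nil) z 0); [ring | apply derivD_const].
  - destruct (IH (fun b Hb => Hl b (or_intror Hb))) as [th [Hth E]].
    destruct (ent_divide P a HP (Hl a (or_introl eq_refl))) as [Hq Eq].
    exists (fun z => diff_quot P a z + th z)%C. split; [apply ent_plus; assumption|].
    intros z. rewrite lin_prod_cons.
    rewrite (Cder_eq (lin_prod s (a :: l)) z (RtoC (/ s) * lin_prod s l z + (z - a) * RtoC (/ s) * Cder (lin_prod s l) z)%C).
    + replace (P z * (RtoC (/ s) * lin_prod s l z + (z - a) * RtoC (/ s) * Cder (lin_prod s l) z))%C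
        with (P z * (RtoC (/ s) * lin_prod s l z) + (z - a) * RtoC (/ s) * (P z * Cder (lin_prod s l) z))%C by ring.
      rewrite <- E, Eq. ring.
    + eapply derivD_eq.
      * apply (derivD_mult _ (fun z => (z - a) * RtoC (/ s))%C (lin_prod s l)); [|apply ent_Cder_spec, ent_lin_prod].
        apply (derivD_mult _ (fun z => z - a)%C (fun _ => RtoC (/ s))); [|apply derivD_const].
        apply derivD_minus; [apply derivD_id | apply derivD_const].
      * cbv beta. ring.
Qed.

(** On a disc Y is a finite product times a zero-free H, and there P Y' / Y is [th] plus P H' / H.
    Zeros of Y have to be zeros of P only as points, which is what sharing IM delivers. *)
Theorem entire_log_derivative (P Y : C -> C) (w0 : C) : ent P -> ent Y -> Y w0 <> 0 ->
  (forall z, Y z = 0 -> P z = 0) -> exists chi, ent chi /\ forall z, (chi z * Y z = P z * Cder Y z)%C.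
Proof.
  intros HP HY Hw HPY.
  assert (Hloc : forall z0, exists chi, holo (Cmod z0 + 1) chi /\
     forall z, Cmod z < Cmod z0 + 1 -> (chi z * Y z = P z * Cder Y z)%C).
  { intros z0.
    destruct (ent_factor_disc Y w0 (Cmod z0 + 1) HY Hw) as [rho [l [H [Hr [Hr0 [HH [HE Hz]]]]]]].
    destruct (lin_prod_log_derivative (2 * rho) P l HP) as [th [Hth Eth]].
    { intros a Ha. apply HPY. rewrite HE, (lin_prod_zero _ _ _ Ha). ring. }
    exists (fun z => th z + P z * Cder H z * / H z)%C. split.
    - apply holo_plus; [apply ent_holo, Hth|]. apply holo_mult.
      + apply ent_holo, ent_mult; [assumption | apply ent_Cder, HH].
      + apply holo_inv; [apply ent_holo, HH|]. intros z Hzr. apply Hz. lra.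
    - intros z Hzr. assert (HHz : H z <> 0) by (apply Hz; lra).
      rewrite (Cder_eq Y z (Cder (lin_prod (2 * rho) l) z * H z + lin_prod (2 * rho) l z * Cder H z)%C).
      + rewrite HE. replace (P z * (Cder (lin_prod (2 * rho) l) z * H z + lin_prod (2 * rho) l z * Cder H z))%C
          with ((P z * Cder (lin_prod (2 * rho) l) z) * H z + P z * lin_prod (2 * rho) l z * Cder H z)%C by ring.
        rewrite <- Eth. field. assumption.
      + apply (derivD_loc _ (fun z => lin_prod (2 * rho) l z * H z)%C _ _ _ 1); [lra | exact I | |].
        * intros. symmetry. apply HE.
        * apply derivD_mult; apply ent_Cder_spec; [apply ent_lin_prod | assumption]. }
  set (X := fun z0 => proj1_sig (constructive_indefinite_description _ (Hloc z0))).
  assert (HX := fun z0 => proj2_sig (constructive_indefinite_description _ (Hloc z0))). cbv beta in HX.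
  change (forall z0, holo (Cmod z0 + 1) (X z0) /\
     forall z, Cmod z < Cmod z0 + 1 -> (X z0 z * Y z = P z * Cder Y z)%C) in HX.
  (* Gluing by a diagonal: two local solutions agree off the zeros of Y, hence by [cont_zero_dense]
     wherever both are defined, so near z the diagonal equals X z. *)
  exists (fun z => X z z). split.
  - intros z. destruct (HX z) as [H1 H2]. destruct (H1 z ltac:(lra)) as [d Hd]. exists d.
    apply (derivD_loc _ (X z) _ _ _ 1); [lra | exact I | | exact Hd].
    intros w _ Hwz.
    assert (Hwz' : Cmod w < Cmod z + 1) by (assert (A := Cmod_triangle_sub w z); lra).
    destruct (HX w) as [G1 G2].
    apply Ceq_minus. apply (cont_zero_dense Y (fun u => X z u - X w u)%C w0 w HY Hw).
    + apply contD_minus; [apply (holo_contb _ _ H1); assumption | apply (holo_contb _ _ G1); lra].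
    + exists (Rmin 1 (Cmod z + 1 - Cmod w)). split; [apply Rmin_pos; lra|]. intros u Hu.
      assert (Hu1 := Rlt_le_trans _ _ _ Hu (Rmin_l _ _)). assert (Hu2 := Rlt_le_trans _ _ _ Hu (Rmin_r _ _)).
      assert (A := Cmod_triangle_sub u w).
      replace ((X z u - X w u) * Y u)%C with (X z u * Y u - X w u * Y u)%C by ring.
      rewrite H2, G2 by lra. ring.
  - intros z. apply (proj2 (HX z)). lra.
Qed.

Lemma ent_zero_derivative (F : C -> C) : ent F -> (forall z, Cder F z = 0) -> forall z w, F z = F w.
Proof.
  intros HF HD z w.
  assert (E := rderiv_zero_const (fun t => F (w + RtoC t * (z - w))%C) 0 1 ltac:(lra)).
  cbv beta in E.
  replace (w + RtoC 1 * (z - w))%C with z in E by ring. replace (w + RtoC 0 * (z - w))%C with w in E by ring.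
  apply E. intros t _. eapply rderiv_eq.
  - apply (rderiv_comp F); [apply ent_Cder_spec, HF | apply rderiv_line].
  - rewrite HD. ring.
Qed.

Lemma ent_mult_nonzero (F G : C -> C) (w1 w2 : C) : ent F -> ent G -> F w1 <> 0 -> G w2 <> 0 ->
  exists w, (F w * G w)%C <> 0.
Proof.
  intros HF HG H1 H2. apply NNPP. intros Hno. apply H2.
  apply (cont_zero_dense F G w1 w2 HF H1); [apply ent_cont, HG|].
  exists 1. split; [lra|]. intros w _. apply NNPP. intros K. apply Hno. exists w. rewrite Cmult_comm. exact K.
Qed.

Lemma zero_or_nonzero (F : C -> C) : (forall z, F z = 0) \/ exists w, F w <> 0.
Proof.
  destruct (classic (exists w, F w <> 0)) as [H|H]; [right; assumption|].
  left. intros z. apply NNPP. intros K. apply H. exists z. exact K.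
Qed.

Lemma small_on_circle (k : nat) (F : C -> C) : small k F ->
  exists K, 0 <= K /\ forall a z, 1 <= a -> Cmod z <= 2 * a -> Cmod (F z) <= exp (K * gauge k a).
Proof.
  intros [K [HK H]]. assert (L3 := gauge_ge_1 k 3 ltac:(lra)).
  exists (K * gauge k 3). split; [apply Rmult_le_pos; lra|]. intros a z Ha Hz.
  assert (Hz0 := Cmod_ge_0 z).
  eapply Rle_trans; [apply H|]. apply exp_le. rewrite Rmult_assoc. apply Rmult_le_compat_l; [assumption|].
  eapply Rle_trans; [apply (gauge_mono k _ (3 * a)); lra|]. apply gauge_mult; lra.
Qed.

Theorem small_quotient (k : nat) (f A B : C -> C) (w0 : C) : ent f -> ent A -> A w0 <> 0 ->
  small k A -> small k B -> (forall z, (f z * A z = B z)%C) -> small k f.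
Proof.
  intros Hf HA Hw SA SB E.
  (* One function and no shift are involved, hence A twice and shift 0; what counts is the bound on
     1 / |A|. *)
  destruct (good_circles A A k 0 w0 w0 HA Hw SA HA Hw SA) as [K [a0 [HK [Ha0 H]]]].
  destruct (small_on_circle k B SB) as [K' [HK' HB]].
  apply (small_of_circles f k (K' + K) a0 Hf ltac:(lra) Ha0).
  intros a Ha. destruct (H a Ha) as [r [Hr Hz]]. exists r. split; [assumption|].
  intros z Hzr. destruct (Hz z Hzr) as [[N0 [N1 _]] _].
  assert (Ef : f z = (B z * / A z)%C) by (rewrite <- E; field; assumption).
  rewrite Ef, Cmod_mult, Cmod_inv, Rmult_plus_distr_r, exp_plus by assumption.
  apply Rmult_le_compat; [apply Cmod_ge_0 | | | assumption].
  - left. apply Rinv_0_lt_compat, Cmod_gt_0. assumption.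
  - apply HB; lra.
Qed.

(** On good circles Y' / Y costs only exp (O(gauge 0 a)), so chi inherits the level k of P although
    Y is one level higher. *)
Theorem small_log_derivative (k : nat) (P Y chi : C -> C) (w0 : C) : ent chi -> ent Y -> Y w0 <> 0 ->
  small (S k) Y -> small k P -> (forall z, (chi z * Y z = P z * Cder Y z)%C) -> small k chi.
Proof.
  intros Hchi HY Hw SY SP E.
  destruct (good_circles Y Y (S k) 0 w0 w0 HY Hw SY HY Hw SY) as [K [a0 [HK [Ha0 H]]]].
  destruct (small_on_circle k P SP) as [K' [HK' HP]].
  apply (small_of_circles chi k (K' + K) a0 Hchi ltac:(lra) Ha0).
  intros a Ha. destruct (H a Ha) as [r [Hr Hz]]. exists r. split; [assumption|].
  intros z Hzr. destruct (Hz z Hzr) as [[N0 [_ [N2 _]]] _].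
  assert (HY0 : 0 < Cmod (Y z)) by (apply Cmod_gt_0; assumption).
  apply Rmult_le_reg_r with (Cmod (Y z)); [assumption|].
  rewrite <- Cmod_mult, E, Cmod_mult.
  assert (L := gauge0_le k a ltac:(lra)).
  rewrite Rmult_plus_distr_r, exp_plus.
  replace (exp (K' * gauge k a) * exp (K * gauge k a) * Cmod (Y z)) with
    (exp (K' * gauge k a) * (Cmod (Y z) * exp (K * gauge k a))) by ring.
  apply Rmult_le_compat; try apply Cmod_ge_0; [apply HP; lra|].
  eapply Rle_trans; [apply N2|]. apply Rmult_le_compat_l; [lra|].
  apply exp_le, Rmult_le_compat_l; assumption.
Qed.

(* [phi = f (z + c) f' / (f (f - a))] has growth one step below that of [f]:
   on good circles it is [f (z + c) / f] times the logarithmic derivative of [f - a]. *)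
Theorem shift_log_derivative (k : nat) (f : C -> C) (a c w1 w2 : C) : ent f -> a <> 0 ->
  f w1 <> 0 -> f w2 <> a -> small (S k) f ->
  (forall z, f z = 0 -> f (z + c)%C = 0) -> (forall z, f z = a -> f (z + c)%C = 0) ->
  exists phi, ent phi /\ small k phi /\ forall z, (phi z * (f z * (f z - a)) = f (z + c) * Cder f z)%C.
Proof.
  intros Hf Ha Hw1 Hw2 Sf H0 H1.
  assert (Hfc := ent_shift f c Hf).
  assert (Hfa : ent (fun z => f z - a)%C) by (apply ent_minus; [assumption | apply ent_const]).
  assert (Hfa2 : (f w2 - a)%C <> 0) by (apply Cminus_eq_contra; assumption).
  assert (HDa : forall z, Cder (fun z => f z - a)%C z = Cder f z).
  { intros z. apply Cder_eq. eapply derivD_eq; [apply derivD_minus; [apply ent_Cder_spec, Hf | apply derivD_const]|]. ring. }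
  destruct (entire_log_derivative (fun z => f (z + c)%C) f w1 Hfc Hf Hw1 H0) as [x1 [Hx1 E1]].
  destruct (entire_log_derivative (fun z => f (z + c)%C) (fun z => f z - a)%C w2 Hfc Hfa Hfa2) as [x2 [Hx2 E2]].
  { intros z Hz. apply H1, Ceq_minus. exact Hz. }
  (* Partial fractions: 1 / (y (y - a)) = (1 / a) (1 / (y - a) - 1 / y) with y = f z. *)
  set (phi := fun z => (/ a * (x2 z - x1 z))%C).
  assert (Hphi : ent phi) by (apply ent_mult; [apply ent_const | apply ent_minus; assumption]).
  assert (E : forall z, (phi z * (f z * (f z - a)) = f (z + c) * Cder f z)%C).
  { intros z. unfold phi. specialize (E1 z). specialize (E2 z). cbv beta in E1, E2. rewrite HDa in E2.
    replace (/ a * (x2 z - x1 z) * (f z * (f z - a)))%C with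
      (/ a * ((x2 z * (f z - a)) * f z - (x1 z * f z) * (f z - a)))%C by ring.
    rewrite E1, E2. field. assumption. }
  exists phi. split; [assumption|]. split; [|assumption].
  destruct (good_circles f (fun z => f z - a)%C (S k) c w1 w2 Hf Hw1 Sf Hfa Hfa2
    (small_minus _ _ _ Sf (small_const _ a))) as [K [a0 [HK [Ha0 H]]]].
  apply (small_of_circles phi k (K + K) a0 Hphi ltac:(lra) Ha0).
  intros b Hb. destruct (H b Hb) as [r [Hr Hz]]. exists r. split; [assumption|].
  intros z Hzr. destruct (Hz z Hzr) as [[N0 [_ [_ N3]]] [M0 [_ [M2 _]]]].
  cbv beta in M0, M2. rewrite HDa in M2.
  assert (P1 : 0 < Cmod (f z)) by (apply Cmod_gt_0; assumption).
  assert (P2 : 0 < Cmod (f z - a)) by (apply Cmod_gt_0; assumption).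
  assert (Hs : 0 < sqrt b) by (apply sqrt_lt_R0; lra).
  (* The descent by half an order happens here: the shift quotient of a function of level S k is of
     level k. *)
  assert (EL : gauge (S k) b / sqrt b = gauge k b) by (rewrite gauge_S; field; lra).
  rewrite EL in N3. assert (L := gauge0_le k b ltac:(lra)).
  apply Rmult_le_reg_r with (Cmod (f z) * Cmod (f z - a)); [nra|].
  rewrite <- !Cmod_mult, E, Cmod_mult, Rmult_plus_distr_r, exp_plus, Cmod_mult.
  replace (exp (K * gauge k b) * exp (K * gauge k b) * (Cmod (f z) * Cmod (f z - a))) with
    ((Cmod (f z) * exp (K * gauge k b)) * (Cmod (f z - a) * exp (K * gauge k b))) by ring.
  apply Rmult_le_compat; try apply Cmod_ge_0; [assumption|].
  eapply Rle_trans; [apply M2|]. apply Rmult_le_compat_l; [lra|].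
  apply exp_le, Rmult_le_compat_l; assumption.
Qed.

(** Where p is nonzero, V / p has derivative zero, so V vanishes on a disc about z0; a nonzero
    entire function cannot do so, by [ent_nonzero_dense]. *)
Lemma proportional_of_wronskian (V p : C -> C) (z0 : C) : ent V -> ent p -> p z0 <> 0 -> V z0 = 0 ->
  (forall z, (p z * Cder V z = Cder p z * V z)%C) -> forall z, V z = 0.
Proof.
  intros HV Hp Hz0 HV0 E. destruct (zero_or_nonzero V) as [|[w Hw]]; [assumption|exfalso].
  assert (Hpos : 0 < Cmod (p z0)) by (apply Cmod_gt_0; assumption).
  destruct (ent_cont p z0 Hp (Cmod (p z0)) Hpos) as [d [Hd Hc]].
  assert (Hne : forall u, Cmod (u - z0) < d -> p u <> 0).
  { intros u Hu K. specialize (Hc u I Hu). rewrite K in Hc.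
    replace (0 - p z0)%C with (- p z0)%C in Hc by ring. rewrite Cmod_opp in Hc. lra. }
  destruct (ent_nonzero_dense V w z0 d HV Hw Hd) as [u [Hu HVu]].
  apply HVu.
  assert (Q := rderiv_zero_const (fun t => V (z0 + RtoC t * (u - z0)) * / p (z0 + RtoC t * (u - z0)))%C 0 1 ltac:(lra)).
  cbv beta in Q.
  replace (z0 + RtoC 1 * (u - z0))%C with u in Q by ring. replace (z0 + RtoC 0 * (u - z0))%C with z0 in Q by ring.
  rewrite HV0, Cmult_0_l in Q.
  assert (Q' : (V u * / p u)%C = 0).
  { apply Q. intros t Ht.
    set (y := (z0 + RtoC t * (u - z0))%C).
    assert (Hy : p y <> 0).
    { apply Hne. eapply Rle_lt_trans; [apply seg_int_point_dist; assumption | exact Hu]. }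
    eapply rderiv_eq.
    - apply (rderiv_comp (fun z => V z * / p z)%C (fun t => z0 + RtoC t * (u - z0))%C); [|apply rderiv_line].
      apply derivD_mult; [apply ent_Cder_spec, HV | apply derivD_inv; [exact Hy | apply ent_Cder_spec, Hp]].
    - fold y. cbv beta.
      replace ((Cder V y * / p y + V y * (- Cder p y / (p y * p y))) * (u - z0))%C
        with ((p y * Cder V y - Cder p y * V y) * (/ (p y * p y)) * (u - z0))%C by (field; assumption).
      rewrite E. ring. }
  replace (V u) with ((V u * / p u) * p u)%C by (field; apply Hne; exact Hu).
  rewrite Q'. ring.
Qed.

Theorem growth_descent (k : nat) (f : C -> C) (eta a : C) : a <> 0 -> ent f -> nonconstant f ->
  share_pair_IM f (cdiff eta f) 0 0 -> share_pair_IM f (cdiff eta f) a (- a)%C ->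
  small (S k) f -> small k f.
Proof.
  intros Ha Hf [z1 [z2 Hnc]] Sh0 Sha Sf. unfold share_pair_IM, cdiff in Sh0, Sha.
  assert (Z0 : forall z, f z = 0 -> f (z + eta)%C = 0).
  { intros z Hz. assert (E := proj1 (Sh0 z) Hz). rewrite Hz in E.
    replace (f (z + eta)%C) with (f (z + eta) - 0)%C by ring. exact E. }
  assert (Za : forall z, f z = a -> f (z + eta)%C = 0).
  { intros z Hz. assert (E := proj1 (Sha z) Hz). rewrite Hz in E.
    replace (f (z + eta)%C) with (f (z + eta) - a + a)%C by ring. rewrite E. ring. }
  set (eta2 := (eta + eta)%C).
  assert (Eeta2 : forall z, (z + eta2)%C = (z + eta + eta)%C) by (intros; unfold eta2; ring).
  assert (Hw1 : exists w, f w <> 0).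
  { destruct (zero_or_nonzero f) as [H|H]; [|exact H]. exfalso. apply Hnc. rewrite !H. reflexivity. }
  destruct Hw1 as [w1 Hw1].
  assert (Hw2 : exists w, f w <> a).
  { apply NNPP. intros K. apply Hnc. transitivity a; [|symmetry]; apply NNPP; intros K'; apply K; eexists; exact K'. }
  destruct Hw2 as [w2 Hw2].
  assert (Hw3 : exists w, Cder f w <> 0).
  { destruct (zero_or_nonzero (Cder f)) as [H|H]; [|exact H]. exfalso. apply Hnc. apply ent_zero_derivative; assumption. }
  destruct Hw3 as [w3 Hw3].
  assert (Hfa : ent (fun z => f z - a)%C) by (apply ent_minus; [assumption | apply ent_const]).
  assert (Hfa2 : (f w2 - a)%C <> 0) by (apply Cminus_eq_contra; assumption).
  destruct (shift_log_derivative k f a eta w1 w2 Hf Ha Hw1 Hw2 Sf Z0 Za) as [phi [Hphi [Sphi Ephi]]].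
  destruct (shift_log_derivative k f a eta2 w1 w2 Hf Ha Hw1 Hw2 Sf) as [phi2 [Hphi2 [Sphi2 Ephi2]]].
  { intros z Hz. rewrite Eeta2. apply Z0, Z0, Hz. }
  { intros z Hz. rewrite Eeta2. apply Z0, Za, Hz. }
  assert (Hf1 := ent_shift f eta Hf).
  destruct (ent_mult_nonzero f (fun z => f z - a)%C w1 w2 Hf Hfa Hw1 Hfa2) as [w4 Hw4].
  assert (Hffa : ent (fun z => f z * (f z - a))%C) by (apply ent_mult; assumption).
  assert (E21 : forall z, (phi z * f (z + eta2) = phi2 z * f (z + eta))%C).
  { apply (ent_cancel (fun z => f z * (f z - a))%C _ _ w4 Hffa Hw4).
    - apply ent_mult; [assumption | apply ent_shift, Hf].
    - apply ent_mult; assumption.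
    - intros z.
      replace (phi z * f (z + eta2) * (f z * (f z - a)))%C with ((phi z * (f z * (f z - a))) * f (z + eta2))%C by ring.
      replace (phi2 z * f (z + eta) * (f z * (f z - a)))%C with ((phi2 z * (f z * (f z - a))) * f (z + eta))%C by ring.
      rewrite Ephi, Ephi2. ring. }
  (* Translation by -eta turns [E21] into the relation q f(z + eta) = p f between f and its first
     shift. *)
  set (p := fun z => phi2 (z + - eta)%C). set (q := fun z => phi (z + - eta)%C).
  assert (Hp : ent p) by (apply ent_shift; assumption).
  assert (Hq : ent q) by (apply ent_shift; assumption).
  assert (Sp : small k p) by (apply small_shift; assumption).
  assert (Sq : small k q) by (apply small_shift; assumption).
  assert (Epq : forall z, (q z * f (z + eta) = p z * f z)%C).
  { intros z. assert (E := E21 (z + - eta)%C). unfold p, q.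
    replace (z + - eta + eta2)%C with (z + eta)%C in E by (unfold eta2; ring).
    replace (z + - eta + eta)%C with z in E by ring. exact E. }
  (* Neither q nor p vanishes identically: the right-hand sides of [Ephi] and [Ephi2] are products
     of functions that are nonzero somewhere. *)
  assert (Hw5 : exists w, (f (w + eta) * Cder f w)%C <> 0).
  { apply (ent_mult_nonzero (fun z => f (z + eta)%C) (Cder f) (w1 - eta)%C w3); try assumption.
    - apply ent_Cder, Hf.
    - replace (w1 - eta + eta)%C with w1 by ring. assumption. }
  destruct Hw5 as [w5 Hw5]. rewrite <- Ephi in Hw5.
  assert (Hq0 : exists w, q w <> 0).
  { exists (w5 + eta)%C. unfold q. replace (w5 + eta + - eta)%C with w5 by ring.
    intros K. apply Hw5. rewrite K. ring. }
  destruct Hq0 as [w6 Hq0].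
  assert (Hw7 : exists w, (f (w + eta2) * Cder f w)%C <> 0).
  { apply (ent_mult_nonzero (fun z => f (z + eta2)%C) (Cder f) (w1 - eta2)%C w3); try assumption.
    - apply ent_shift, Hf.
    - apply ent_Cder, Hf.
    - replace (w1 - eta2 + eta2)%C with w1 by ring. assumption. }
  destruct Hw7 as [w7 Hw7]. rewrite <- Ephi2 in Hw7.
  assert (Hp0 : exists w, p w <> 0).
  { exists (w7 + eta)%C. unfold p. replace (w7 + eta + - eta)%C with w7 by ring.
    intros K. apply Hw7. rewrite K. ring. }
  destruct Hp0 as [w8 Hp0].
  assert (EODE : forall z, (p z * Cder f z = phi z * q z * (f z - a))%C).
  { apply (ent_cancel f _ _ w1 Hf Hw1).
    - apply ent_mult; [assumption | apply ent_Cder, Hf].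
    - apply ent_mult; [apply ent_mult; assumption | assumption].
    - intros z.
      replace (phi z * q z * (f z - a) * f z)%C with (q z * (phi z * (f z * (f z - a))))%C by ring.
      rewrite Ephi. replace (q z * (f (z + eta) * Cder f z))%C with ((q z * f (z + eta)) * Cder f z)%C by ring.
      rewrite Epq. ring. }
  assert (Hqp : ent (fun z => q z - p z)%C) by (apply ent_minus; assumption).
  assert (Sqp : small k (fun z => q z - p z)%C) by (apply small_minus; assumption).
  (* One function in two forms: this one makes Y' linear in f and f', the one in [EY] displays the
     zeros. *)
  set (Y := fun z => ((q z - p z) * f z - a * q z)%C).
  assert (HY : ent Y).
  { apply ent_minus; apply ent_mult; try assumption. apply ent_const. }
  assert (SY : small (S k) Y).
  { apply small_minus; apply small_mult; try assumption; try (apply small_weaken; assumption). apply small_const. }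
  assert (EY : forall z, Y z = (q z * (f z - f (z + eta) - a))%C).
  { intros z. unfold Y. replace (q z * (f z - f (z + eta) - a))%C with (q z * f z - q z * f (z + eta) - a * q z)%C by ring.
    rewrite Epq. ring. }
  (* The converse half of the (a, -a) hypothesis enters here. *)
  assert (Hdiff : forall z, (f z - f (z + eta) - a)%C = 0 -> f z = a).
  { intros z K. apply (Sha z).
    replace (f (z + eta) - f z)%C with (- (f z - f (z + eta) - a) - a)%C by ring. rewrite K. ring. }
  assert (HYw : exists w, Y w <> 0).
  { destruct (ent_mult_nonzero q (fun z => f z - f (z + eta) - a)%C w6 w2) as [w Hw]; try assumption.
    - apply ent_minus; [apply ent_minus; assumption | apply ent_const].
    - intros K. apply Hw2, Hdiff, K.
    - exists w. rewrite EY. exact Hw. }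
  destruct HYw as [w9 HYw].
  assert (Hpq : ent (fun z => p z * q z)%C) by (apply ent_mult; assumption).
  destruct (entire_log_derivative (fun z => p z * q z)%C Y w9 Hpq HY HYw) as [chi [Hchi Echi]].
  (* At a zero of Y with q nonzero, f = a and hence f(z + eta) = 0; then q f(z + eta) = p f reads 0
     = p a. *)
  { intros z K. rewrite EY in K.
    destruct (Ceq_dec (q z) 0) as [Hqz|Hqz]; [rewrite Hqz; ring|].
    assert (Hfz : f z = a).
    { apply Hdiff. apply NNPP. intros N. apply (Cmult_neq_0 _ _ Hqz N). exact K. }
    assert (E := Epq z). rewrite (Za z Hfz), Hfz in E.
    assert (Hpz : p z = 0).
    { apply NNPP. intros N. apply (Cmult_neq_0 _ _ N Ha). rewrite <- E. ring. }
    rewrite Hpz. ring. }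
  assert (Schi : small k chi).
  { apply (small_log_derivative k (fun z => p z * q z)%C Y chi w9); try assumption. apply small_mult; assumption. }
  assert (Hp' := ent_Cder p Hp). assert (Hq' := ent_Cder q Hq).
  assert (Sp' := small_Cder k p Hp Sp). assert (Sq' := small_Cder k q Hq Sq).
  assert (EY' : forall z, Cder Y z = ((Cder q z - Cder p z) * f z + (q z - p z) * Cder f z - a * Cder q z)%C).
  { intros z. apply Cder_eq.
    apply (derivD_minus _ (fun z => (q z - p z) * f z)%C (fun z => a * q z)%C).
    - apply (derivD_mult _ (fun z => q z - p z)%C f); [apply (derivD_minus _ q p)|]; apply ent_Cder_spec; assumption.
    - apply derivD_scal, ent_Cder_spec, Hq. }
  (* After p f' is replaced by phi q (f - a), the function p q Y' becomes q (al f - a be). Comparing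
     with chi Y and collecting the terms in f gives f A = B. *)
  set (al := fun z => (p z * (Cder q z - Cder p z) + (q z - p z) * (phi z * q z))%C).
  set (be := fun z => ((q z - p z) * (phi z * q z) + p z * Cder q z)%C).
  set (A := fun z => (chi z * (q z - p z) - q z * al z)%C).
  set (B := fun z => (a * (chi z * q z) - q z * (a * be z))%C).
  assert (HA : ent A).
  { apply ent_minus; apply ent_mult; try assumption. apply ent_plus; apply ent_mult; try assumption;
      [apply ent_minus | apply ent_mult]; assumption. }
  assert (Sbe : small k be).
  { apply small_plus; apply small_mult; try assumption. apply small_mult; assumption. }
  assert (SA : small k A).
  { apply small_minus; apply small_mult; try assumption. apply small_plus; apply small_mult; try assumption;
      [apply small_minus | apply small_mult]; assumption. }
  assert (SB : small k B).
  { apply small_minus; apply small_mult; try assumption; try apply small_const; apply small_mult; try assumption; apply small_const. }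
  assert (EAB : forall z, (f z * A z)%C = B z).
  { intros z. unfold A, B.
    assert (E1 := Echi z). cbv beta in E1. rewrite EY' in E1.
    replace (p z * q z * ((Cder q z - Cder p z) * f z + (q z - p z) * Cder f z - a * Cder q z))%C
      with (q z * (p z * (Cder q z - Cder p z) * f z + (q z - p z) * (p z * Cder f z) - a * p z * Cder q z))%C in E1 by ring.
    rewrite EODE in E1. unfold Y in E1.
    replace (f z * (chi z * (q z - p z) - q z * al z))%C
      with (chi z * ((q z - p z) * f z - a * q z) + a * chi z * q z - q z * al z * f z)%C by ring.
    rewrite E1. unfold al, be. ring. }
  destruct (zero_or_nonzero A) as [HA0|[w HAw]].
  2:{ apply (small_quotient k f A B w); assumption. }
  (* Both sides of [EAB] vanish: [chi = be], and [A = 0] becomes a first-order equation for [p / q]. *)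
  assert (Hbe : ent be).
  { apply ent_plus; apply ent_mult; try assumption. apply ent_mult; assumption. }
  assert (Echibe : forall z, chi z = be z).
  { apply (ent_cancel q _ _ w6 Hq Hq0 Hchi Hbe). intros z.
    assert (E := EAB z). rewrite HA0 in E. unfold B in E.
    apply Ceq_minus.
    replace (chi z * q z - be z * q z)%C with (/ a * (a * (chi z * q z) - q z * (a * be z)))%C by (field; assumption).
    rewrite <- E. ring. }
  (* With chi = be, A is p times the difference of the two sides; for w = p / q the identity is w' =
     phi (1 - w). *)
  assert (Ericcati : forall z, (q z * Cder p z - Cder q z * p z)%C = (phi z * q z * (q z - p z))%C).
  { apply (ent_cancel p _ _ w8 Hp Hp0).
    - apply ent_minus; apply ent_mult; assumption.
    - apply ent_mult; [apply ent_mult|]; assumption.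
    - intros z. apply Ceq_minus.
      assert (E := HA0 z). unfold A in E. rewrite Echibe in E. rewrite <- E. unfold al, be. ring. }
  (* W / p is the quantity (f - a) (1 - w) / w, kept free of denominators; [EW] says that its
     derivative vanishes. *)
  set (W := fun z => ((q z - p z) * (f z - a))%C).
  assert (HW : ent W) by (apply ent_mult; assumption).
  assert (EW : forall z, (p z * Cder W z = Cder p z * W z)%C).
  { intros z.
    assert (EW' : Cder W z = ((Cder q z - Cder p z) * (f z - a) + (q z - p z) * Cder f z)%C).
    { apply Cder_eq. eapply derivD_eq.
      - apply (derivD_mult _ (fun z => q z - p z)%C (fun z => f z - a)%C).
        + apply (derivD_minus _ q p); apply ent_Cder_spec; assumption.
        + apply derivD_minus; [apply ent_Cder_spec, Hf | apply derivD_const].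
      - cbv beta. ring. }
    rewrite EW'. unfold W.
    replace (p z * ((Cder q z - Cder p z) * (f z - a) + (q z - p z) * Cder f z))%C
      with ((p z * (Cder q z - Cder p z)) * (f z - a) + (q z - p z) * (p z * Cder f z))%C by ring.
    rewrite EODE.
    replace (p z * (Cder q z - Cder p z) * (f z - a) + (q z - p z) * (phi z * q z * (f z - a)))%C
      with ((p z * (Cder q z - Cder p z) + phi z * q z * (q z - p z)) * (f z - a))%C by ring.
    rewrite <- Ericcati. ring. }
  set (c := (W w8 * / p w8)%C).
  assert (EWc : forall z, W z = (c * p z)%C).
  { intros z. apply Ceq_minus.
    apply (proportional_of_wronskian (fun z => W z - c * p z)%C p w8); try assumption.
    - apply ent_minus; [assumption | apply ent_mult; [apply ent_const | assumption]].
    - unfold c. field. assumption.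
    - intros u. rewrite (Cder_eq (fun z => W z - c * p z)%C u (Cder W u - c * Cder p u)%C).
      + replace (p u * (Cder W u - c * Cder p u))%C with (p u * Cder W u - c * p u * Cder p u)%C by ring.
        rewrite EW. ring.
      + apply derivD_minus; [apply ent_Cder_spec, HW | apply derivD_scal, ent_Cder_spec, Hp]. }
  (* If q = p then f has period eta, its difference vanishes identically, and the converse half of
     the (0, 0) hypothesis makes f zero. *)
  destruct (zero_or_nonzero (fun z => q z - p z)%C) as [Hqp0|[w Hqpw]].
  - exfalso. apply Hw1. apply Sh0.
    assert (E1 : forall z, f (z + eta)%C = f z).
    { apply (ent_cancel q _ _ w6 Hq Hq0 Hf1 Hf). intros z.
      assert (Eqp : q z = p z) by (apply Ceq_minus; apply (Hqp0 z)).
      rewrite Cmult_comm, Epq, <- Eqp. ring. }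
    rewrite E1. ring.
  - apply (small_quotient k f (fun z => q z - p z)%C (fun z => c * p z + a * (q z - p z))%C w); try assumption.
    + apply small_plus; apply small_mult; try assumption; apply small_const.
    + intros z. rewrite <- EWc. unfold W. ring.
Qed.

(** * The final contradiction at level 0 *)

Lemma log_growth_factor (F : C -> C) (w0 : C) : ent F -> F w0 <> 0 -> small 0 F ->
  exists kap rho0, 0 <= kap /\ 1 <= rho0 /\ forall rho, rho0 <= rho -> exists l H, ent H /\
    (forall z, F z = (lin_prod (2 * rho) l z * H z)%C) /\ INR (length l) <= kap * sqrt rho /\
    forall z, Cmod z <= rho / 2 -> H z <> 0 /\ Cmod (Cder H z) <= kap / sqrt rho * Cmod (H z).
Proof.
  intros HF Hw [K [HK H]].
  set (K1 := K * gauge 0 4 + Rabs (ln (Cmod (F w0)))).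
  assert (L4 := gauge_ge_1 0 4 ltac:(lra)).
  assert (HK1 : 0 <= K1).
  { unfold K1. assert (A := Rabs_pos (ln (Cmod (F w0)))). assert (0 <= K * gauge 0 4) by (apply Rmult_le_pos; lra). lra. }
  assert (Hw0 := Cmod_ge_0 w0).
  assert (E8 := exp_pos 8).
  (* [local_factor] gives 4 B for the number of zeros and 8 exp 8 B / rho for the logarithmic
     derivative; B <= 3 K1 sqrt rho makes these 12 and 24. *)
  exists (12 * K1 + 24 * exp 8 * K1), (1 + 2 * Cmod w0). split.
  { assert (0 <= exp 8 * K1) by (apply Rmult_le_pos; lra). lra. }
  split; [lra|]. intros rho Hrho.
  set (M := exp (K * gauge 0 4 * gauge 0 rho)).
  assert (Lr := gauge_ge_1 0 rho ltac:(lra)).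
  destruct (local_factor F rho M w0 HF ltac:(lra) ltac:(lra) Hw) as [l [G [HG [HE [_ [Hn [HB [_ Hz]]]]]]]].
  { intros t _. eapply Rle_trans; [apply H|]. apply exp_le. rewrite Cmod_circle by lra.
    rewrite Rmult_assoc. apply Rmult_le_compat_l; [assumption|].
    eapply Rle_trans; [apply (gauge_mono 0 _ (4 * rho)); lra|]. apply gauge_mult; lra. }
  assert (Hs : 1 <= sqrt rho) by (apply sqrt_ge_1; lra).
  assert (Hsq := sqrt_sqrt rho ltac:(lra)).
  (* The logarithm is weakened to a square root. Any o(rho) would do below, against a chain of zeros
     of linear density and for a logarithmic derivative of size B / rho. *)
  assert (Hlam : gauge 0 rho <= 3 * sqrt rho).
  { unfold gauge. simpl. rewrite Rmult_1_r.
    assert (A := le_exp_sqrt rho ltac:(lra)). apply ln_le in A; [|lra]. rewrite ln_exp in A. lra. }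
  set (B := ln M - ln (Cmod (F w0))) in *.
  assert (HBK : B <= 3 * K1 * sqrt rho).
  { apply Rle_trans with (K1 * gauge 0 rho).
    - unfold B, M. rewrite ln_exp. unfold K1. rewrite Rmult_plus_distr_r.
      assert (A := Rle_abs (- ln (Cmod (F w0)))). rewrite Rabs_Ropp in A.
      assert (A2 := Rabs_pos (ln (Cmod (F w0)))). nra.
    - replace (3 * K1 * sqrt rho) with (K1 * (3 * sqrt rho)) by ring. apply Rmult_le_compat_l; assumption. }
  assert (HeK : 0 <= exp 8 * K1) by (apply Rmult_le_pos; lra).
  exists l, G. split; [assumption|]. split; [assumption|]. split.
  - assert (0 <= exp 8 * K1 * sqrt rho) by (apply Rmult_le_pos; lra). lra.
  - intros z Hzr. destruct (Hz z Hzr) as [Z1 [_ [_ Z4]]]. split; [assumption|].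
    eapply Rle_trans; [apply Z4|]. apply Rmult_le_compat_r; [apply Cmod_ge_0|].
    apply Rmult_le_reg_r with (sqrt rho); [lra|].
    unfold Rdiv at 2. rewrite (Rmult_assoc (12 * K1 + 24 * exp 8 * K1)), Rinv_l, Rmult_1_r by lra.
    replace (8 * exp 8 / rho * B * sqrt rho) with (8 * exp 8 * (B * / sqrt rho)).
    2:{ rewrite <- Hsq at 2. field. lra. }
    assert (B * / sqrt rho <= 3 * K1).
    { apply Rmult_le_reg_r with (sqrt rho); [lra|]. rewrite Rmult_assoc, Rinv_l by lra. lra. }
    assert (8 * exp 8 * (B * / sqrt rho) <= 8 * exp 8 * (3 * K1)) by (apply Rmult_le_compat_l; lra). lra.
Qed.

Lemma sqrt_unbounded (K x0 : R) : exists x, x0 <= x /\ 1 <= x /\ K < sqrt x.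
Proof.
  set (y := Rmax (Rabs x0 + 1) (Rabs K + 1)).
  assert (A1 : Rabs x0 + 1 <= y) by apply Rmax_l. assert (A2 : Rabs K + 1 <= y) by apply Rmax_r.
  assert (B1 := Rle_abs x0). assert (B2 := Rle_abs K). assert (P := Rabs_pos x0).
  exists (y * y). rewrite sqrt_square by lra. repeat split; nra.
Qed.

Lemma zero_chain (f : C -> C) (eta z0 : C) (n : nat) : (forall z, f z = 0 -> f (z + eta)%C = 0) -> f z0 = 0 ->
  f (z0 + RtoC (INR n) * eta)%C = 0.
Proof.
  intros H H0. induction n as [|n IH].
  - simpl. replace (z0 + 0 * eta)%C with z0 by ring. assumption.
  - rewrite S_INR, RtoC_plus. replace (z0 + (RtoC (INR n) + 1) * eta)%C with (z0 + RtoC (INR n) * eta + eta)%C by ring.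
    apply H, IH.
Qed.

Theorem log_growth_impossible (f : C -> C) (eta : C) : eta <> 0 -> ent f -> nonconstant f ->
  (forall z, f z = 0 -> f (z + eta)%C = 0) -> small 0 f -> False.
Proof.
  intros Heta Hf [z1 [z2 Hnc]] H0 Sf.
  assert (Hw : exists w, f w <> 0).
  { destruct (zero_or_nonzero f) as [H|H]; [|exact H]. exfalso. apply Hnc. rewrite !H. reflexivity. }
  destruct Hw as [w Hw].
  destruct (log_growth_factor f w Hf Hw Sf) as [kap [rho0 [Hkap [Hrho0 H]]]].
  destruct (classic (exists z0, f z0 = 0)) as [[z0 Hz0]|Hno].
  - assert (He : 0 < Cmod eta) by (apply Cmod_gt_0; assumption). assert (Hz0p := Cmod_ge_0 z0).
    (* With rho = b n >= rho0, the points z0 + j eta for j < n all lie in |z| <= rho / 2. They are n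
       distinct zeros, so n <= kap sqrt (b n), which fails once n > kap^2 b. *)
    set (b := 2 * Cmod eta + 2 * Cmod z0 + rho0).
    destruct (sqrt_unbounded (kap * sqrt b) 1) as [x [_ [Hx1 Hx]]].
    destruct (nfloor_ex x ltac:(lra)) as [n0 [_ Hn0]].
    set (n := S n0). assert (Hn : x < INR n) by (unfold n; rewrite S_INR; lra).
    set (rho := b * INR n).
    assert (Hb : 1 <= b) by (unfold b; lra).
    destruct (H rho ltac:(unfold rho, b; nra)) as [l [G [_ [HE [Hlen HG]]]]].
    set (pts := map (fun j => (z0 + RtoC (INR j) * eta)%C) (seq 0 n)).
    assert (Hnodup : NoDup pts).
    { apply NoDup_map_NoDup_ForallPairs; [|apply seq_NoDup].
      intros i j _ _ Hij. apply INR_eq, RtoC_inj.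
      apply (f_equal (fun z => ((z - z0) * / eta)%C)) in Hij.
      replace ((z0 + RtoC (INR i) * eta - z0) * / eta)%C with (RtoC (INR i)) in Hij by (field; assumption).
      replace ((z0 + RtoC (INR j) * eta - z0) * / eta)%C with (RtoC (INR j)) in Hij by (field; assumption).
      exact Hij. }
    assert (Hincl : incl pts l).
    { intros u Hu. apply in_map_iff in Hu. destruct Hu as [j [<- Hj]]. apply in_seq in Hj.
      assert (HjR : INR j <= INR n) by (apply le_INR; lia).
      assert (Hj0 := pos_INR j).
      destruct (HG (z0 + RtoC (INR j) * eta)%C) as [HGu _].
      { eapply Rle_trans; [apply Cmod_triangle|]. rewrite Cmod_mult, Cmod_RtoC_nonneg by assumption.
        unfold rho, b. assert (INR j * Cmod eta <= INR n * Cmod eta) by (apply Rmult_le_compat_r; lra). nra. }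
      apply NNPP. intros Hnin.
      apply (Cmult_neq_0 _ _ (lin_prod_neq0 (2 * rho) l _ ltac:(unfold rho; nra) Hnin) HGu).
      rewrite <- HE. apply zero_chain; assumption. }
    assert (Hcard := NoDup_incl_length Hnodup Hincl).
    unfold pts in Hcard. rewrite length_map, length_seq in Hcard. apply le_INR in Hcard.
    assert (Hsn : sqrt x < sqrt (INR n)) by (apply sqrt_lt_1; lra).
    assert (Hss := sqrt_sqrt (INR n) ltac:(lra)).
    unfold rho in Hlen. rewrite sqrt_mult in Hlen by lra.
    assert (0 < sqrt (INR n)) by (apply sqrt_lt_R0; lra). nra.
  - apply Hnc. apply (ent_zero_derivative f Hf). intros z.
    apply Cmod_eq_0. apply Rle_antisym; [|apply Cmod_ge_0]. apply le_epsilon. intros e He. rewrite Rplus_0_l.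
    assert (Hzp := Cmod_ge_0 z). assert (Hfz := Cmod_ge_0 (f z)).
    (* The point z stays fixed while rho grows, so |f' z| <= kap / sqrt rho * |f z| can be made
       smaller than e. *)
    destruct (sqrt_unbounded (kap * Cmod (f z) / e) (rho0 + 2 * Cmod z)) as [rho [Hr [Hr1 Hs]]].
    destruct (H rho ltac:(lra)) as [l [G [HG [HE [_ HG2]]]]].
    assert (Hl : l = nil).
    { destruct l as [|b l]; [reflexivity|]. exfalso. apply Hno. exists b. rewrite HE, (lin_prod_zero _ (b :: l) b (or_introl eq_refl)). ring. }
    subst l. simpl in HE.
    assert (EG : forall u, f u = G u) by (intros; rewrite HE; ring).
    assert (ED : Cder f z = Cder G z).
    { apply Cder_eq. apply (derivD_loc _ G _ _ _ 1); [lra | exact I | intros; symmetry; apply EG | apply ent_Cder_spec, HG]. }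
    destruct (HG2 z ltac:(lra)) as [_ B]. rewrite ED. eapply Rle_trans; [apply B|]. rewrite <- EG.
    assert (Hsr : 1 <= sqrt rho) by (apply sqrt_ge_1; lra).
    apply Rmult_le_reg_r with (sqrt rho); [lra|].
    replace (kap / sqrt rho * Cmod (f z) * sqrt rho) with (kap * Cmod (f z)) by (field; lra).
    apply (Rmult_lt_compat_l e) in Hs; [|assumption].
    replace (e * (kap * Cmod (f z) / e)) with (kap * Cmod (f z)) in Hs by (field; lra). lra.
Qed.

Theorem theorem9 (eta a : C) (Heta : eta <> 0%C) (Ha : a <> 0%C) :
  ~ (exists f : C -> C,
        entire f /\ nonconstant f /\ finite_order f /\
        share_pair_IM f (cdiff eta f) 0%C 0%C /\
        share_pair_IM f (cdiff eta f) a (- a)%C).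
Proof.
  intros [f [Hent [Hnc [Hfo [Sh0 Sha]]]]].
  assert (Hf : ent f) by (intros z; apply ex_derive_cderiv, Hent).
  destruct (finite_order_small f Hf Hfo) as [k Hk].
  assert (H0 : small 0 f).
  { induction k as [|k IH]; [assumption|]. apply IH. apply (growth_descent k f eta a); assumption. }
  apply (log_growth_impossible f eta Heta Hf Hnc); [|assumption].
  intros z Hz. assert (E := proj1 (Sh0 z) Hz). unfold cdiff in E. rewrite Hz in E.
  replace (f (z + eta)%C) with (f (z + eta) - 0)%C by ring. exact E.
Qed.
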